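(* Let $k$ be a field with $\mathrm{char}(k)=0$ or $\mathrm{char}(k)>7$, let $\mathbb{O}$ be an octonion algebra over $k$, and let $\mu_{\mathbb{O}},\psi_{\mathbb{O}},Q_{\mathbb{O}}$ be the covariants of the special orthogonal representation $\rho : \mathfrak{h} \rightarrow \mathfrak{so}(\mathbb{O},B)$ of the quadratic Lie algebra $(\mathfrak{h},B_{\mathfrak{h}})$ described in the context. The Hodge duals $*\psi_{\mathbb{O}}\in\mathrm{Alt}_5(\mathbb{O},\mathbb{O})$ and $*\mu_{\mathbb{O}}\in\mathrm{Alt}_6(\mathbb{O},\mathfrak{h})$ satisfy: a) $*\psi_{\mathbb{O}}=-56\, Q_{\mathbb{O}}\wedge \mathrm{Id}=\frac{112}{3}\, \mu_{\mathbb{O}}\wedge_{\rho}\psi_{\mathbb{O}}$; b) $*\mu_{\mathbb{O}}=-56\, Q_{\mathbb{O}}\wedge \mu_{\mathbb{O}}=-\frac{56}{3}\, \mu_{\mathbb{O}}\circ\psi_{\mathbb{O}}$.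
   Context: $\mathbb{O}$ is an octonion (Cayley) algebra over $k$, i.e. an $8$-dimensional unital composition algebra, with norm $q$ and conjugation $u\mapsto\bar u$, $q(u)=u\bar u$; $\mathrm{Im}(\mathbb{O})=\{u\in\mathbb{O}: \bar u=-u\}$; $B$ is the symmetric bilinear form with $B(u,u)=q(u)$. Left multiplication $\rho(u)(x)=ux$ ($u\in\mathrm{Im}(\mathbb{O})$, $x\in\mathbb{O}$) satisfies $\rho(u)^2=-q(u)\mathrm{Id}$, hence extends to an algebra morphism $\rho:C(\mathrm{Im}(\mathbb{O}),-q)\to\mathrm{End}(\mathbb{O})$ from the Clifford algebra (in which $u^2=-q(u)$). Let $\mathfrak{h}=C^2(\mathrm{Im}(\mathbb{O}),-q)$ be the span of the elements $uv-vu$ with $u,v\in\mathrm{Im}(\mathbb{O})$, a Lie algebra under the commutator (of type $\mathfrak{so}(7)$), with $B_{\mathfrak{h}}(x,y)=-\frac38\mathrm{Tr}(\rho(x)\rho(y))$, acting on $\mathbb{O}$ by $\rho$. $\mathrm{Alt}_p(E,F)$ is the space of alternating $p$-linear maps from $E$ to $F$. The moment map $\mu=\mu_{\mathbb{O}}\in\mathrm{Alt}_2(\mathbb{O},\mathfrak{h})$ is determined by $B_{\mathfrak{h}}(x,\mu(u,v))=B(\rho(x)(u),v)$ for all $x\in\mathfrak{h}$, $u,v\in\mathbb{O}$; write $\mu(u,v)(w)$ for $\rho(\mu(u,v))(w)$. The representation is special orthogonal, meaning $\mu(u,v)(w)+\mu(u,w)(v)=B(u,v)w+B(u,w)v-2B(v,w)u$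 for all $u,v,w\in\mathbb{O}$. Its covariants are $\mu$, $\psi=\psi_{\mathbb{O}}\in\mathrm{Alt}_3(\mathbb{O},\mathbb{O})$ and $Q=Q_{\mathbb{O}}\in\mathrm{Alt}_4(\mathbb{O},k)$, where \begin{align*} \psi(v_1,v_2,v_3)&=\mu(v_1,v_2)(v_3)+\mu(v_3,v_1)(v_2)+\mu(v_2,v_3)(v_1),\\ Q(v_1,v_2,v_3,v_4)&=B(v_1,\psi(v_2,v_3,v_4))-B(v_4,\psi(v_1,v_2,v_3))+B(v_3,\psi(v_4,v_1,v_2))-B(v_2,\psi(v_3,v_4,v_1)). \end{align*} For $f\in\mathrm{Alt}_p(E,F)$, $g\in\mathrm{Alt}_r(E,G)$ and a bilinear map $\Phi:F\times G\to H$, the exterior product $f\wedge_\Phi g\in\mathrm{Alt}_{p+r}(E,H)$ is $$f\wedge_\Phi g(v_1,\dots,v_{p+r})=\sum_\sigma\mathrm{sgn}(\sigma)\,\Phi\big(f(v_{\sigma(1)},\dots,v_{\sigma(p)}),g(v_{\sigma(p+1)},\dots,v_{\sigma(p+r)})\big),$$ the sum being over the $(p,r)$-shuffles in $S_{p+r}$ (permutations increasing on $\{1,\dots,p\}$ and on $\{p+1,\dots,p+r\}$). Here $\wedge_\rho$ uses the action $\mathfrak{h}\times \mathbb{O}\to\mathbb{O}$, $\wedge_B$ and $\wedge_{B_{\mathfrak{h}}}$ use the forms $B$ on $\mathbb{O}$ and $B_{\mathfrak{h}}$ on $\mathfrak{h}$, and $\wedge$ without subscript uses scalar multiplication; $\mathrm{Id}\in\mathrm{Alt}_1(\mathbb{O},\mathbb{O})$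 is the identity. The composition $\mu\circ\psi\in\mathrm{Alt}_6(\mathbb{O},\mathfrak{h})$ is $$(\mu\circ\psi)(v_1,\dots,v_6)=\sum_{\sigma}\mathrm{sgn}(\sigma)\,\mu\big(\psi(v_{\sigma(1)},v_{\sigma(2)},v_{\sigma(3)}),\psi(v_{\sigma(4)},v_{\sigma(5)},v_{\sigma(6)})\big),$$ the sum being over the $(3,3)$-shuffles in $S_6$. Let $B_{\Lambda^*}$ be the form on $\Lambda^i(\mathbb{O})^*$ corresponding to the determinant form $\langle v_1\wedge\dots\wedge v_i,w_1\wedge\dots\wedge w_i\rangle=\det(B(v_a,w_b))$ on $\Lambda^i(\mathbb{O})$ under the isomorphism $\Lambda^i(\mathbb{O})\cong\Lambda^i(\mathbb{O})^*$ it defines. Let $B_{\mathrm{Alt}(\mathbb{O},\mathbb{O})}$ (resp. $B_{\mathrm{Alt}(\mathbb{O},\mathfrak{h})}$) be the form on $\mathrm{Alt}_i(\mathbb{O},\mathbb{O})\cong\Lambda^i(\mathbb{O})^*\otimes\mathbb{O}$ (resp. $\mathrm{Alt}_i(\mathbb{O},\mathfrak{h})\cong\Lambda^i(\mathbb{O})^*\otimes\mathfrak{h}$) which is the tensor product of $B_{\Lambda^*}$ with $B$ (resp. $B_{\mathfrak{h}}$); equivalently, for an orthogonal basis $\{e_j\}$ of $\mathbb{O}$ its value on $(f,g)$ is $\sum_{j_1<\dots<j_i}\frac{1}{q(e_{j_1})\cdots q(e_{j_i})}\langle f(e_{j_1},\dots,e_{j_i}),g(e_{j_1},\dots,e_{j_i})\rangle$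 with $\langle\ ,\ \rangle=B$ (resp. $B_{\mathfrak{h}}$). The $8$-form $Q_{\mathbb{O}}\wedge Q_{\mathbb{O}}$ is non-zero. For $f\in\mathrm{Alt}_i(\mathbb{O},\mathbb{O})$, its Hodge dual is the unique $*f\in\mathrm{Alt}_{8-i}(\mathbb{O},\mathbb{O})$ with $\alpha\wedge_B *f=B_{\mathrm{Alt}(\mathbb{O},\mathbb{O})}(\alpha,f)\,Q_{\mathbb{O}}\wedge Q_{\mathbb{O}}$ for all $\alpha\in\mathrm{Alt}_i(\mathbb{O},\mathbb{O})$; for $f\in\mathrm{Alt}_i(\mathbb{O},\mathfrak{h})$, its Hodge dual is the unique $*f\in\mathrm{Alt}_{8-i}(\mathbb{O},\mathfrak{h})$ with $\alpha\wedge_{B_{\mathfrak{h}}} *f=B_{\mathrm{Alt}(\mathbb{O},\mathfrak{h})}(\alpha,f)\,Q_{\mathbb{O}}\wedge Q_{\mathbb{O}}$ for all $\alpha\in\mathrm{Alt}_i(\mathbb{O},\mathfrak{h})$. *)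

(* Defs.v *)
From HB Require Import structures.
From mathcomp Require Import all_boot all_fingroup all_algebra all_field.

Set Implicit Arguments.
Unset Strict Implicit.
Unset Printing Implicit Defensive.

Import GRing.Theory.
Local Open Scope ring_scope.

Definition polar (k : fieldType) (V : lmodType k) (q : V -> k) (u v : V) : k :=
  q (u + v) - q u - q v.

Definition quadratic_form (k : fieldType) (V : lmodType k) (q : V -> k) : Prop :=
  (forall a u, q (a *: u) = a ^+ 2 * q u) /\
  (forall a u v w, polar q (a *: u + v) w = a * polar q u w + polar q v w).

Record octonionAlgebra (k : fieldType) := OctonionAlgebra {
  oct_sort :> vectType k;
  oct_mul : {bilinear oct_sort -> oct_sort -> oct_sort};
  oct_one : oct_sort;
  oct_norm : oct_sort -> k;
  oct_mul1 : left_id oct_one oct_mul;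
  oct_mulr1 : right_id oct_one oct_mul;
  oct_norm_quadratic : quadratic_form oct_norm;
  oct_norm_nondegenerate :
    forall u, (forall v, polar oct_norm u v = 0) -> u = 0;
  oct_normM : forall u v, oct_norm (oct_mul u v) = oct_norm u * oct_norm v;
  oct_dim : \dim {: oct_sort} = 8%N
}.

Arguments oct_mul {k o}.
Arguments oct_one {k o}.
Arguments oct_norm {k o}.

Definition octB (k : fieldType) (O : octonionAlgebra k) (u v : O) : k :=
  polar oct_norm u v / 2.

(* The polar form is [2 B], so this is the usual [2 B(u, 1) 1 - u]. *)
Definition oct_conj (k : fieldType) (O : octonionAlgebra k) (u : O) : O :=
  polar oct_norm u oct_one *: oct_one - u.

Definition oct_Im (k : fieldType) (O : octonionAlgebra k) : {vspace O} :=
  lker (linfun (fun u : O => oct_conj u + u)).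

Lemma mem_oct_Im (k : fieldType) (O : octonionAlgebra k) (u : O) :
  (u \in oct_Im O) <-> oct_conj u = - u.
Proof.
have lin : linear (fun u : O => oct_conj u + u).
  move=> a x y; have [_ pL] := oct_norm_quadratic O.
  by rewrite /oct_conj !subrK pL scalerDl scalerA.
pose L := GRing.isLinear.Build _ _ _ _ _ lin.
pose f : {linear O -> O} := HB.pack (fun u : O => oct_conj u + u) L.
rewrite /oct_Im -[fun u : O => _]/(f : O -> O) memv_ker lfunE /= addr_eq0.
by split=> /eqP.
Qed.

Definition oct_ImT (k : fieldType) (O : octonionAlgebra k) : vectType k :=
  subvs_of (oct_Im O).

(* [C] with [iota] is the Clifford algebra of [Q]: universal among the algebras *)
(* over [k] receiving [V] with [v ^ 2 = Q v].                                  *)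
Definition is_clifford_algebra (k : fieldType) (V : vectType k) (Q : V -> k)
    (C : algType k) (iota : {linear V -> C}) : Prop :=
  (forall v, iota v * iota v = (Q v)%:A) /\
  forall (A : algType k) (f : {linear V -> A}),
    (forall v, f v * f v = (Q v)%:A) ->
    exists g : {lrmorphism C -> A},
      (forall v, g (iota v) = f v) /\
      forall g' : {lrmorphism C -> A}, (forall v, g' (iota v) = f v) -> g' =1 g.

(* [rho] is the algebra morphism [C -> End O] extending left multiplication;   *)
(* ['End(O)] carries no canonical ring structure, hence the explicit laws.     *)
Definition extends_left_mul (k : fieldType) (O : octonionAlgebra k)
    (C : falgType k) (iota : {linear oct_ImT O -> C})
    (rho : {linear C -> 'End(O)}) : Prop :=
  [/\ rho 1 = \1%VF,
      forall a b, rho (a * b) = (rho a \o rho b)%VF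
    & forall (u : oct_ImT O) (x : O), rho (iota u) x = oct_mul (vsval u) x].

(* By bilinearity the commutators of basis vectors span all the commutators:   *)
(* see [memv_commutator_space] and [commutator_space_min].                     *)
Definition commutator_space (k : fieldType) (V : vectType k) (C : falgType k)
    (iota : {linear V -> C}) : {vspace C} :=
  <<[seq iota u * iota v - iota v * iota u
       | u <- vbasis {: V}, v <- vbasis {: V}]>>%VS.

Lemma memv_commutator_space (k : fieldType) (V : vectType k) (C : falgType k)
    (iota : {linear V -> C}) (u v : V) :
  iota u * iota v - iota v * iota u \in commutator_space iota.
Proof.
pose c a b : C := iota a * iota b - iota b * iota a.
rewrite -/(c u v) (coord_vbasis (memvf u)).
have cDl I r (P : pred I) F w :
    c (\sum_(i <- r | P i) F i) w = \sum_(i <- r | P i) c (F i) w.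
  by rewrite /c linear_sum /= mulr_suml mulr_sumr -sumrB.
have cDr I r (P : pred I) F w :
    c w (\sum_(i <- r | P i) F i) = \sum_(i <- r | P i) c w (F i).
  by rewrite /c linear_sum /= mulr_suml mulr_sumr -sumrB.
rewrite cDl rpred_sum // => i _; rewrite (coord_vbasis (memvf v)).
rewrite cDr rpred_sum // => j _.
rewrite /c !linearZ /= -!scalerAl -!scalerAr !(scalerA, mulrC (coord _ i u)).
rewrite -scalerBr rpredZ //; apply/memv_span/allpairsP.
by exists ((vbasis {: V})`_i, (vbasis {: V})`_j); rewrite !mem_nth ?size_tuple.
Qed.

Lemma commutator_space_min (k : fieldType) (V : vectType k) (C : falgType k)
    (iota : {linear V -> C}) (W : {vspace C}) :
  (forall u v, iota u * iota v - iota v * iota u \in W) ->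
  (commutator_space iota <= W)%VS.
Proof. by move=> hW; apply/span_subvP=> _ /allpairsP[[u v] [_ _ ->]]. Qed.

Definition lie_h (k : fieldType) (O : octonionAlgebra k) (C : falgType k)
    (iota : {linear oct_ImT O -> C}) : vectType k :=
  subvs_of (commutator_space iota).

Definition lfun_trace (k : fieldType) (V : vectType k) (f : 'End(V)) : k :=
  \tr (passmx.mxof (vbasis {: V}) (vbasis {: V}) f).

Definition hact (k : fieldType) (O : octonionAlgebra k) (C : falgType k)
    (iota : {linear oct_ImT O -> C}) (rho : {linear C -> 'End(O)})
    (x : lie_h iota) (w : O) : O :=
  rho (vsval x) w.

Definition hB (k : fieldType) (O : octonionAlgebra k) (C : falgType k)
    (iota : {linear oct_ImT O -> C}) (rho : {linear C -> 'End(O)})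
    (x y : lie_h iota) : k :=
  - (3 / 8) * lfun_trace (rho (vsval x) \o rho (vsval y))%VF.

Definition tset (E : Type) (p : nat) (v : p.-tuple E) (i : 'I_p) (x : E) :
    p.-tuple E :=
  [tuple if j == i then x else tnth v j | j < p].

(* Membership in [Alt_p(E, F)], for [p]-ary maps given as functions of tuples. *)
Definition is_alt (k : fieldType) (E F : lmodType k) (p : nat)
    (f : p.-tuple E -> F) : Prop :=
  (forall v i a x y,
     f (tset v i (a *: x + y)) = a *: f (tset v i x) + f (tset v i y)) /\
  (forall v i j, i != j -> tnth v i = tnth v j -> f v = 0).

Definition shuffle (p r : nat) (s : 'S_(p + r)) : bool :=
  [forall i : 'I_p, forall j : 'I_p,
     (i < j)%N ==> (s (lshift r i) < s (lshift r j))%N] &&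
  [forall i : 'I_r, forall j : 'I_r,
     (i < j)%N ==> (s (rshift p i) < s (rshift p j))%N].

Definition wedge (k : fieldType) (E F G H : lmodType k) (p r : nat)
    (Phi : F -> G -> H) (f : p.-tuple E -> F) (g : r.-tuple E -> G)
    (v : (p + r).-tuple E) : H :=
  \sum_(s : 'S_(p + r) | shuffle s)
    (-1) ^+ s *: Phi (f [tuple tnth v (s (lshift r i)) | i < p])
                     (g [tuple tnth v (s (rshift p j)) | j < r]).

Definition is_moment_map (k : fieldType) (O : octonionAlgebra k)
    (C : falgType k) (iota : {linear oct_ImT O -> C})
    (rho : {linear C -> 'End(O)}) (mu : 2.-tuple O -> lie_h iota) : Prop :=
  is_alt mu /\
  forall x u v, hB rho x (mu [tuple u; v]) = octB (hact rho x u) v.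

Definition cov_psi (k : fieldType) (O : octonionAlgebra k)
    (C : falgType k) (iota : {linear oct_ImT O -> C})
    (rho : {linear C -> 'End(O)}) (mu : 2.-tuple O -> lie_h iota)
    (v : 3.-tuple O) : O :=
  hact rho (mu [tuple v`_0; v`_1]) v`_2 +
  hact rho (mu [tuple v`_2; v`_0]) v`_1 +
  hact rho (mu [tuple v`_1; v`_2]) v`_0.

Definition cov_Q (k : fieldType) (O : octonionAlgebra k)
    (C : falgType k) (iota : {linear oct_ImT O -> C})
    (rho : {linear C -> 'End(O)}) (mu : 2.-tuple O -> lie_h iota)
    (v : 4.-tuple O) : k^o :=
  octB v`_0 (cov_psi rho mu [tuple v`_1; v`_2; v`_3]) -
  octB v`_3 (cov_psi rho mu [tuple v`_0; v`_1; v`_2]) +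
  octB v`_2 (cov_psi rho mu [tuple v`_3; v`_0; v`_1]) -
  octB v`_1 (cov_psi rho mu [tuple v`_2; v`_3; v`_0]).

Definition alt_id (E : Type) (v : 1.-tuple E) : E := thead v.

Definition wedgeZ (k : fieldType) (E F : lmodType k) (p r : nat)
    (f : p.-tuple E -> k^o) (g : r.-tuple E -> F) : (p + r).-tuple E -> F :=
  wedge (fun (a : k^o) x => a *: x) f g.

(* Since [mu] is bilinear, [mu o psi] is the exterior product of [psi] with    *)
(* itself along [mu].                                                          *)
Definition mu_comp_psi (k : fieldType) (O : octonionAlgebra k)
    (C : falgType k) (iota : {linear oct_ImT O -> C})
    (rho : {linear C -> 'End(O)}) (mu : 2.-tuple O -> lie_h iota) :
    6.-tuple O -> lie_h iota :=
  wedge (fun x y => mu [tuple x; y]) (cov_psi rho mu) (cov_psi rho mu).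

Definition orthogonal_basis (k : fieldType) (O : octonionAlgebra k)
    (e : 8.-tuple O) : Prop :=
  basis_of {: O} e /\ forall i j, i != j -> octB (tnth e i) (tnth e j) = 0.

(* The form on [Alt_i(O, F)] induced by [B] on [O] and [b] on [F], computed in *)
(* an orthogonal basis [e] of [O]; the strictly increasing tuples [J] encode   *)
(* the indices [j_1 < ... < j_i].                                              *)
Definition alt_form (k : fieldType) (O : octonionAlgebra k) (F : lmodType k)
    (b : F -> F -> k) (e : 8.-tuple O) (i : nat) (f g : i.-tuple O -> F) : k :=
  \sum_(J : i.-tuple 'I_8 | sorted (fun a c : 'I_8 => (a < c)%N) J)
    (\prod_(j <- J) oct_norm (tnth e j))^-1 *
    b (f [tuple of map (tnth e) J]) (g [tuple of map (tnth e) J]).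

(* [omega] stands for the 8-form [Q /\ Q]; it is typed with [i + j] so that    *)
(* no cast is needed when [i + j] evaluates to 8.                              *)
Definition hodge_property (k : fieldType) (O : octonionAlgebra k)
    (F : lmodType k) (b : F -> F -> k) (e : 8.-tuple O) (i j : nat)
    (omega : (i + j).-tuple O -> k) (f : i.-tuple O -> F)
    (g : j.-tuple O -> F) : Prop :=
  is_alt g /\
  forall alpha : i.-tuple O -> F, is_alt alpha ->
  forall v : (i + j).-tuple O,
    wedge (H := k^o) b alpha g v = alt_form b e alpha f * omega v.

Definition is_hodge_dual (k : fieldType) (O : octonionAlgebra k)
    (F : lmodType k) (b : F -> F -> k) (e : 8.-tuple O) (i j : nat)
    (omega : (i + j).-tuple O -> k) (f : i.-tuple O -> F)
    (g : j.-tuple O -> F) : Prop :=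
  hodge_property b e omega f g /\
  forall g', hodge_property b e omega f g' -> g' =1 g.

(* Main.v *)
From HB Require Import structures.
Require Import Defs.
From mathcomp Require Import all_boot all_fingroup all_algebra all_field.
From mathcomp Require Import ring zify.

(** Why the theorem holds.

    Both covariants have closed formulas in the octonions:
      psi(u, v, w) = B(u, v) w + B(u, w) v - B(v, w) u - (v (conj u)) w,
      mu(u, v)(w) = B(u, w) v - B(v, w) u + psi(u, v, w) / 3.
    They follow from the trace of a product of four left multiplications
    ([otrace4]), which determines [B_h] on commutators and shows that the
    commutators of an orthogonal basis reproduce every element of [h]
    ([h_expand]); the moment map is then computed by summing over that basis
    ([act_mu]).  In particular [Q] is [- 4 Phi], where [Phi] is the 4-form
    [B(psi(-, -, -), -)].

    The duality comes from the Clifford algebra of the whole of [O].  Right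
    multiplications by octonions, arranged as (a, b) |-> (b (conj x), a x),
    make it act on two copies of [O].  The product of the eight generators of
    an orthogonal basis [e] anticommutes with every generator, hence it is a
    scalar, the chirality of [e], on the first copy ([cliff_prod_basis]).  Its
    square is the product of the norms of [e], it changes by the sign of a
    permutation of [e], and on orthogonal vectors [Phi] is a coefficient of a
    product of four generators.  Splitting the product of eight generators in
    two halves therefore shows that [Phi] is self-dual ([Phi_self_dual]).

    Being a Hodge dual can be tested on orthogonal bases.  The exterior product
    of forms of degrees p and r, times p! r!, is a sum over all permutations
    ([wedge_alt_sum]), and two alternating maps of top degree agree as soon as
    they agree on one basis.  So it is enough to relate, for each ordering of
    [e], the value of the candidate dual on the last vectors to the value of
    the form on the first ones ([hodge_formula]).  With self-duality that
    relation becomes a contraction of [Phi] over the basis: expanding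
    [psi(e_0, e_1, e_2)] in the basis gives the dual of [psi] ([wedge_Q_id]),
    and the Casimir sum of the [mu(e_i, x e_i) / q(e_i)], which is [8 / 3] times
    [x] ([casimir_mu]), gives the dual of [mu] ([wedge_Q_mu]).  The common factor
    is fixed by the norm of [Phi]: for distinct [u, v, w] in an orthogonal
    basis, [psi(u, v, w)] has norm [q u * q v * q w], so the normalised squares
    of [Phi] sum to 8 * 7 * 6, and [Q /\ Q] takes the value 224 times the
    chirality ([wedge_Q_Q]).  Uniqueness of the dual uses that [B] and [B_h]
    are nondegenerate ([hodge_unique]).

    The other expressions for the duals are the Mathews identities
      mu /\ psi = - (3 / 2) Q /\ Id   and   mu o psi = 3 Q /\ mu.
    They use only equivariance, [x, mu(u, v)] = mu(x u, v) + mu(u, x v), and the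
    formula for [mu] through [psi]: by equivariance the antisymmetrisation of
    mu(psi(v_0, v_1, v_2), v_3) is zero ([alt_sum_jacobi]), and the other
    antisymmetrised products reduce to that one. *)

Set Implicit Arguments.
Unset Strict Implicit.
Unset Printing Implicit Defensive.

Import GRing.Theory.
Local Open Scope ring_scope.

(** * Shuffles and permutations *)

Definition reorder (T : Type) (n : nat) (v : n.-tuple T) (s : 'S_n) :
  n.-tuple T := [tuple tnth v (s i) | i < n].
Arguments reorder : simpl never.

Lemma tnth_reorder (T : Type) (n : nat) (v : n.-tuple T) (s : 'S_n) i :
  tnth (reorder v s) i = tnth v (s i).
Proof. exact: tnth_mktuple. Qed.

Lemma reorder1 (T : Type) (n : nat) (v : n.-tuple T) : reorder v 1%g = v.
Proof. by apply: eq_from_tnth => i; rewrite tnth_reorder perm1. Qed.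

Lemma reorderM (T : Type) (n : nat) (v : n.-tuple T) (s t : 'S_n) :
  reorder v (s * t)%g = reorder (reorder v t) s.
Proof. by apply: eq_from_tnth => i; rewrite !tnth_reorder permM. Qed.

Lemma perm_tperm_ind (T : finType) (P : {perm T} -> Prop) :
  P 1%g -> (forall i j s, i != j -> P s -> P (tperm i j * s)%g) ->
  forall s, P s.
Proof.
move=> P1 PM s; have [ts -> ] := prod_tpermP s.
elim: ts => [|[i j] ts IH] /=; first by rewrite big_nil.
by case/andP=> dij /IH Pts; rewrite big_cons; apply: PM.
Qed.

Definition lto (n : nat) : rel 'I_n := fun a c => (a < c)%N.

Lemma sorted_ltoP (n p : nat) (J : p.-tuple 'I_n) :
  sorted (@lto n) J =
  [forall i : 'I_p, forall j : 'I_p, (i < j)%N ==> (tnth J i < tnth J j)%N].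
Proof.
case: p J => [|p] J; first by rewrite tuple0; symmetry; apply/forallP; case.
rewrite sorted_pairwise => [|b a c]; last exact: ltn_trans.
move: (tnth J ord0) => x0.
apply/(pairwiseP x0)/forallP => [h i|h i j].
  apply/forallP=> j; apply/implyP=> lij.
  by rewrite !(tnth_nth x0); apply: h; rewrite ?inE ?size_tuple.
rewrite !inE size_tuple => li lj lij.
have := forallP (h (Ordinal li)) (Ordinal lj) => /implyP /(_ lij).
by rewrite !(tnth_nth x0).
Qed.

Lemma sorted_lto_val (n : nat) (s : seq 'I_n) :
  sorted (@lto n) s = sorted ltn (map val s).
Proof. by rewrite sorted_map. Qed.

(** Sums over shuffles, over increasing tuples and over all permutations are
    compared through this: an orbit of repetition-free tuples under reordering
    is free and contains exactly one increasing tuple. *)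
Lemma sort_perm_unique (n p : nat) (J : p.-tuple 'I_n) : uniq J ->
  {a0 : 'S_p | forall a : 'S_p, sorted (@lto n) (reorder J a) = (a == a0)}.
Proof.
move=> uJ; pose leo : rel 'I_n := fun a c => (a <= c)%N.
have trlto : transitive (@lto n) by move=> b a c; apply: ltn_trans.
have pJ : perm_eq (sort leo J) J by rewrite perm_sort.
have sJ : sorted (@lto n) (sort leo J).
  rewrite sorted_lto_val ltn_sorted_uniq_leq map_inj_uniq; last exact: val_inj.
  rewrite (perm_uniq pJ) uJ sorted_map; apply: sort_sorted.
  by move=> a b; apply: leq_total.
have /sig_eqW[a0 Ea0] : exists a : 'S_p, sort leo J = reorder J a.
  exact: (tuple_permP pJ).
exists a0 => a; apply/idP/eqP => [sa | -> ]; last by rewrite -Ea0.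
have Ea : reorder J a = reorder J a0.
  apply: val_inj; rewrite /= -/(tval (reorder J a)) -/(tval (reorder J a0)) -Ea0.
  apply: (irr_sorted_eq trlto _ sa sJ) => [x|x]; first exact: ltnn.
  rewrite (perm_mem pJ); apply/tnthP/tnthP => [[i ->]|[i ->]].
    by exists (a i); rewrite tnth_reorder.
  by exists (a^-1%g i); rewrite tnth_reorder permKV.
apply/permP=> i; have := congr1 (fun t => tnth t i) Ea.
rewrite !tnth_reorder => /eqP; have x0 := tnth J i; rewrite !(tnth_nth x0).
by rewrite nth_uniq ?size_tuple // => /eqP /val_inj.
Qed.

Lemma uniq_reorder (T : eqType) (n : nat) (v : n.-tuple T) (s : 'S_n) :
  uniq (reorder v s) = uniq v.
Proof.
apply: perm_uniq; apply/tuple_permP; exists s; exact: erefl.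
Qed.

Lemma sum_uniq_sorted (V : nmodType) (n p : nat) (F : p.-tuple 'I_n -> V) :
  (forall J s, F (reorder J s) = F J) ->
  \sum_(J : p.-tuple 'I_n | uniq J) F J =
  (\sum_(J : p.-tuple 'I_n | sorted (@lto n) J) F J) *+ p`!.
Proof.
move=> FS.
transitivity (\sum_(J : p.-tuple 'I_n | uniq J)
   \sum_(a : 'S_p | sorted (@lto n) (reorder J a)) F J).
  apply: eq_bigr => J uJ; have [a0 Ea] := sort_perm_unique uJ.
  by rewrite (eq_bigl _ _ Ea) big_pred1_eq.
rewrite (exchange_big_dep xpredT) //.
transitivity (\sum_(a : 'S_p) \sum_(J : p.-tuple 'I_n | sorted (@lto n) J) F J).
  apply: eq_bigr => a _.
  rewrite (reindex_inj (h := fun J => reorder J a^-1%g)); last first.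
    move=> J J' /(congr1 (fun t => reorder t a)).
    by rewrite -!reorderM mulgV !reorder1.
  apply: eq_big => [J|J _]; last exact: FS.
  rewrite -reorderM mulgV reorder1 uniq_reorder andb_idl //.
  rewrite sorted_lto_val ltn_sorted_uniq_leq => /andP[].
  by rewrite map_inj_uniq //; apply: val_inj.
by rewrite sumr_const card_Sn.
Qed.

Section Block.
Variables p r : nat.

(** [block a b] permutes the first [p] positions by [a] and the last [r] by [b];
    these permutations act on the arguments of an exterior product without
    mixing the two factors. *)
Definition block_fun (a : 'S_p) (b : 'S_r) (x : 'I_(p + r)) : 'I_(p + r) :=
  match split x with inl i => lshift r (a i) | inr j => rshift p (b j) end.

Lemma block_fun_inj a b : injective (block_fun a b).
Proof.
apply: (can_inj (g := block_fun a^-1%g b^-1%g)) => x.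
rewrite -{2}(splitK x) /block_fun; case: (split x) => i.
  by rewrite (unsplitK (inl _)) /= permK.
by rewrite (unsplitK (inr _)) /= permK.
Qed.

Definition block a b : 'S_(p + r) := perm (@block_fun_inj a b).

Lemma block_lshift a b i : block a b (lshift r i) = lshift r (a i).
Proof. by rewrite permE /block_fun (unsplitK (inl _)). Qed.

Lemma block_rshift a b i : block a b (rshift p i) = rshift p (b i).
Proof. by rewrite permE /block_fun (unsplitK (inr _)). Qed.

Lemma blockP (s t : 'S_(p + r)) :
  (forall i, s (lshift r i) = t (lshift r i)) ->
  (forall i, s (rshift p i) = t (rshift p i)) -> s = t.
Proof.
by move=> hl hr; apply/permP=> x; case: (split_ordP x) => i ->.
Qed.

Lemma blockM a b a' b' : block (a * a') (b * b') = (block a b * block a' b')%g.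
Proof.
by apply: blockP => i; rewrite !permM ?block_lshift ?block_rshift permM.
Qed.

(** A block permutation is the product of its two blocks, and each block is a
    product of transpositions that stay transpositions in the larger group. *)
Lemma odd_block a b : odd_perm (block a b) = odd_perm a (+) odd_perm b.
Proof.
have block1 : block 1 1 = 1%g.
  by apply: blockP => i; rewrite ?block_lshift ?block_rshift !perm1.
have L : forall a, odd_perm (block a 1) = odd_perm a.
  apply: perm_tperm_ind => [|i j s nij IH]; first by rewrite block1 !odd_perm1.
  rewrite -{1}[1%g]mulg1 blockM !odd_permM IH !odd_tperm nij; congr (_ (+) _).
  suff -> : block (tperm i j) 1 = tperm (lshift r i) (lshift r j).
    by rewrite odd_tperm (inj_eq (@lshift_inj _ _)) nij.
  apply: blockP => x; rewrite ?block_lshift ?block_rshift ?perm1.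
    case: tpermP => [->|->|/eqP n1 /eqP n2]; rewrite ?tpermL ?tpermR //.
    by rewrite tpermD // (inj_eq (@lshift_inj _ _)) eq_sym.
  by rewrite tpermD // eq_lrshift.
have R : forall b, odd_perm (block 1 b) = odd_perm b.
  apply: perm_tperm_ind => [|i j s nij IH]; first by rewrite block1 !odd_perm1.
  rewrite -{1}[1%g]mulg1 blockM !odd_permM IH !odd_tperm nij; congr (_ (+) _).
  suff -> : block 1 (tperm i j) = tperm (rshift p i) (rshift p j).
    by rewrite odd_tperm (inj_eq (@rshift_inj _ _)) nij.
  apply: blockP => x; rewrite ?block_lshift ?block_rshift ?perm1.
    by rewrite tpermD // eq_rlshift.
  case: tpermP => [->|->|/eqP n1 /eqP n2]; rewrite ?tpermL ?tpermR //.
  by rewrite tpermD // (inj_eq (@rshift_inj _ _)) eq_sym.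
by rewrite -[a]mulg1 -[b in LHS]mul1g blockM odd_permM L R mulg1.
Qed.

Definition ltuple (T : Type) (v : (p + r).-tuple T) : p.-tuple T :=
  [tuple tnth v (lshift r i) | i < p].
Definition rtuple (T : Type) (v : (p + r).-tuple T) : r.-tuple T :=
  [tuple tnth v (rshift p i) | i < r].
Arguments ltuple : simpl never.
Arguments rtuple : simpl never.

Lemma cat_lrtuple (T : Type) (v : (p + r).-tuple T) :
  tval v = ltuple v ++ rtuple v.
Proof.
have E : enum 'I_(p + r) = map (lshift r) (enum 'I_p) ++ map (@rshift p r) (enum 'I_r).
  have vE n : map (@nat_of_ord n) (enum 'I_n) = iota 0 n by apply: val_enum_ord.
  apply: (inj_map (@ord_inj _)); rewrite vE iotaD map_cat.
  rewrite -(map_comp _ (lshift r)) -(map_comp _ (@rshift p r)).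
  congr (_ ++ _); first by rewrite -vE; apply: eq_map.
  rewrite add0n -[p in iota p r]addn0 iotaDl -vE -(map_comp (addn p)).
  exact: eq_map.
by rewrite -[LHS]map_tnth_enum E map_cat -(map_comp _ (lshift r)) -(map_comp _ (@rshift p r)).
Qed.

Lemma nth_ltuple (T : Type) (x0 : T) (v : (p + r).-tuple T) i :
  (i < p)%N -> nth x0 (ltuple v) i = nth x0 v i.
Proof. by move=> li; rewrite cat_lrtuple nth_cat size_tuple li. Qed.

Lemma nth_rtuple (T : Type) (x0 : T) (v : (p + r).-tuple T) i :
  nth x0 (rtuple v) i = nth x0 v (p + i).
Proof.
by rewrite cat_lrtuple nth_cat size_tuple ltnNge leq_addr /= addKn.
Qed.

Lemma ltuple_block T (v : (p + r).-tuple T) a b :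
  ltuple (reorder v (block a b)) = reorder (ltuple v) a.
Proof.
by apply: eq_from_tnth => i; rewrite !tnth_mktuple block_lshift.
Qed.

Lemma rtuple_block T (v : (p + r).-tuple T) a b :
  rtuple (reorder v (block a b)) = reorder (rtuple v) b.
Proof.
by apply: eq_from_tnth => i; rewrite !tnth_mktuple block_rshift.
Qed.

Lemma shuffle_sorted (s : 'S_(p + r)) :
  shuffle s = sorted (@lto _) (ltuple (reorder (ord_tuple _) s)) &&
              sorted (@lto _) (rtuple (reorder (ord_tuple _) s)).
Proof.
rewrite !sorted_ltoP /shuffle; congr (_ && _); apply: eq_forallb => i;
apply: eq_forallb => j; by rewrite !tnth_mktuple /= !tnth_ord_tuple.
Qed.

(** Shuffles represent the cosets of the block permutations: sorting each of
    the two blocks of values of a permutation singles out one shuffle. *)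
Lemma sum_shuffle (V : nmodType) (T : 'S_(p + r) -> V) :
  (forall a b s, T (block a b * s)%g = T s) ->
  \sum_s T s = (\sum_(s | shuffle s) T s) *+ (p`! * r`!).
Proof.
move=> TS; pose J s := ltuple (reorder (ord_tuple (p + r)) s).
pose K s := rtuple (reorder (ord_tuple (p + r)) s).
have uJ s : uniq (J s).
  rewrite map_inj_uniq ?enum_uniq // => i j; rewrite !tnth_reorder !tnth_ord_tuple.
  by move/perm_inj/lshift_inj.
have uK s : uniq (K s).
  rewrite map_inj_uniq ?enum_uniq // => i j; rewrite !tnth_reorder !tnth_ord_tuple.
  by move/perm_inj/rshift_inj.
have JS a b s : J (block a b * s)%g = reorder (J s) a.
  by rewrite /J reorderM ltuple_block.
have KS a b s : K (block a b * s)%g = reorder (K s) b.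
  by rewrite /K reorderM rtuple_block.
transitivity (\sum_s \sum_(ab : 'S_p * 'S_r | shuffle (block ab.1 ab.2 * s)%g) T s).
  apply: eq_bigr => s _; have [a0 Ea] := sort_perm_unique (uJ s).
  have [b0 Eb] := sort_perm_unique (uK s).
  rewrite (big_pred1 (a0, b0)) // => -[a b] /=; rewrite shuffle_sorted.
  by rewrite -/(J _) -/(K _) JS KS Ea Eb xpair_eqE.
rewrite (exchange_big_dep xpredT) //.
transitivity (\sum_(ab : 'S_p * 'S_r) \sum_(s | shuffle s) T s).
  apply: eq_bigr => -[a b] _ /=.
  rewrite (reindex_inj (h := fun s => (block a b)^-1 * s)%g) /=; last exact: mulgI.
  apply: eq_big => [s|s _]; first by rewrite mulKVg.
  by rewrite -(TS a b) mulKVg.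
by rewrite sumr_const cardE -cardT card_prod !card_Sn.
Qed.

End Block.

(** Both families are completed by listing the points that they miss in
    increasing order; the permutation matches the two completed lists. *)
Lemma perm_extend (n p : nat) (l h : 'I_p -> 'I_n) :
  injective l -> injective h -> exists s : 'S_n, forall i, s (l i) = h i.
Proof.
move=> il ih.
pose ext (f : 'I_p -> 'I_n) := codom f ++ [seq x <- enum 'I_n | x \notin codom f].
have uext f : injective f -> uniq (ext f).
  move=> jf; rewrite cat_uniq filter_uniq ?enum_uniq // andbT.
  rewrite map_inj_uniq // ?enum_uniq /=.
  by apply/hasPn => x; rewrite mem_filter => /andP[].
have mext f x : x \in ext f.
  by rewrite mem_cat mem_filter mem_enum andbT; case: (x \in codom f).
have sext f : injective f -> size (ext f) = n.
  move=> jf; rewrite -[RHS]card_ord -(card_uniqP (uext f jf)).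
  by apply: eq_card => x; rewrite mext.
have lt f x : injective f -> (index x (ext f) < n)%N.
  by move=> jf; rewrite -{2}(sext f jf) index_mem mext.
case: n => [|n] in l h il ih ext uext mext sext lt *.
  by exists 1%g => i; case: (l i).
pose g x := nth ord0 (ext h) (index x (ext l)).
have ig : injective g.
  move=> x y /eqP; rewrite nth_uniq ?uext ?sext ?lt // => /eqP.
  by move/index_inj; apply; rewrite ?mext.
exists (perm ig) => i; rewrite permE /g.
have icod f : injective f -> index (f i) (ext f) = i.
  move=> jf; rewrite index_cat codom_f.
  have <- : nth ord0 (codom f) i = f i by rewrite (nth_map i) ?nth_ord_enum ?size_enum_ord.
  rewrite index_uniq ?size_codom ?card_ord //.
  by rewrite map_inj_uniq // enum_uniq.
rewrite (icod l) // -[i in nth _ _ i](icod h) //.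
by rewrite nth_index ?mext.
Qed.

(** By [perm_extend] the permutations with prescribed values at [p] positions
    form a coset, so their number does not depend on the prescription; counting
    all the permutations shows that it is [(n - p)!]. *)
Lemma sum_perm_image (V : nmodType) (n p : nat) (l : 'I_p -> 'I_n)
    (F : p.-tuple 'I_n -> V) : injective l ->
  \sum_(s : 'S_n) F [tuple s (l i) | i < p] =
  (\sum_(J : p.-tuple 'I_n | uniq J) F J) *+ (n - p)`!.
Proof.
move=> il; pose img (s : 'S_n) := [tuple s (l i) | i < p].
have uim s : uniq (img s).
  by rewrite map_inj_uniq ?enum_uniq // => i j /perm_inj/il.
have lepn : (p <= n)%N by move: (leq_card l il); rewrite !card_ord.
pose N := #|[pred s | img s == img 1%g]|.
have NJ (J : p.-tuple 'I_n) : uniq J -> #|[pred s | img s == J]| = N.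
  move=> uJ; have [|t Et] := @perm_extend n p l (tnth J) il.
    move=> i j /eqP; have x0 := tnth J i.
    by rewrite !(tnth_nth x0) nth_uniq ?size_tuple // => /eqP /val_inj.
  rewrite -(card_imset _ (mulIg t^-1%g)); apply: eq_card => s.
  apply/imsetP/idP => [[s' /eqP Es' ->]|/eqP Es].
    apply/eqP/eq_from_tnth => i; rewrite !tnth_mktuple permM perm1.
    by apply/eqP; rewrite (canF_eq (permKV t)) Et -Es' tnth_mktuple.
  exists (s * t)%g; last by rewrite mulgK.
  apply/eqP/eq_from_tnth => i; rewrite tnth_mktuple permM -Et.
  by have := congr1 (fun x => tnth x i) Es; rewrite !tnth_mktuple perm1 => ->.
have EN (W : nmodType) (G : p.-tuple 'I_n -> W) :
    \sum_s G (img s) = (\sum_(J : p.-tuple 'I_n | uniq J) G J) *+ N.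
  rewrite (partition_big img (fun J : p.-tuple 'I_n => uniq J)); last first.
    by move=> s _; apply: uim.
  rewrite -sumrMnl; apply: eq_bigr => J uJ.
  rewrite -(NJ J uJ) -sumr_const.
  by apply: eq_big => [s|s /eqP ->].
rewrite EN; congr (_ *+ _).
have Eu : #|[pred J : p.-tuple 'I_n | uniq J]| = n ^_ p.
  rewrite -[n in RHS]card_ord -(card_uniq_tuples p (predT : pred 'I_n)).
  by apply: eq_card => t; rewrite !inE all_predT.
have := EN _ (fun=> 1%N); rewrite !sumr_const Eu cardE -cardT card_Sn.
rewrite !natn -[_ *+ N]mulr_natr natn -(ffact_fact lepn) => /eqP.
by rewrite eqn_pmul2l ?ffact_gt0 // => /eqP <-.
Qed.

(** * Alternating maps and exterior products *)

Lemma tnth_tset (T : Type) (p : nat) (v : p.-tuple T) i x j :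
  tnth (tset v i x) j = if j == i then x else tnth v j.
Proof. exact: tnth_mktuple. Qed.

Lemma nth_tset (T : Type) (x0 : T) (p : nat) (v : p.-tuple T) i x j :
  (j < p)%N -> nth x0 (tset v i x) j = if j == i :> nat then x else nth x0 v j.
Proof.
by move=> lj; rewrite -!(tnth_nth x0 _ (Ordinal lj)) tnth_tset -val_eqE.
Qed.

Lemma tset_same (T : Type) (p : nat) (v : p.-tuple T) i :
  tset v i (tnth v i) = v.
Proof. by apply: eq_from_tnth => j; rewrite tnth_tset; case: eqP => // ->. Qed.

Section Alternating.
Variables (k : fieldType) (E F : lmodType k).

Section Form.
Variables (p : nat) (f : p.-tuple E -> F).
Implicit Type v : p.-tuple E.
Hypothesis altf : is_alt f.

Lemma alt_linear v i a x y :
  f (tset v i (a *: x + y)) = a *: f (tset v i x) + f (tset v i y).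
Proof. exact: altf.1. Qed.

Lemma alt_additive v i x y : f (tset v i (x + y)) = f (tset v i x) + f (tset v i y).
Proof. by rewrite -[x in LHS]scale1r alt_linear scale1r. Qed.

Lemma alt_set0 v i : f (tset v i 0) = 0.
Proof.
by have := alt_linear v i (-1) 0 0; rewrite scaler0 addr0 scaleN1r addNr.
Qed.

Lemma alt_sum_slot v i (I : Type) (r : seq I) (P : pred I) (c : I -> k) (x : I -> E) :
  f (tset v i (\sum_(j <- r | P j) c j *: x j)) =
  \sum_(j <- r | P j) c j *: f (tset v i (x j)).
Proof.
elim: r => [|j r IH]; first by rewrite !big_nil alt_set0.
by rewrite !big_cons; case: (P j); rewrite // alt_linear IH.
Qed.

(** Polarise the vanishing of [f] on a sum placed in two slots. *)
Lemma alt_tperm v i j : i != j -> f (reorder v (tperm i j)) = - f v.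
Proof.
move=> nij; pose w x y := tset (tset v i x) j y.
have w0 x : f (w x x) = 0.
  apply: (altf.2 _ i j nij); rewrite !tnth_tset eqxx (negbTE nij).
  by rewrite eqxx.
have wl x y z : f (w (x + y) z) = f (w x z) + f (w y z).
  have Ew u : w u z = tset (tset v j z) i u.
    apply: eq_from_tnth => l; rewrite !tnth_tset.
    by case: (l =P j) => [->|]; rewrite // eq_sym (negbTE nij).
  by rewrite !Ew alt_additive.
have wr x y z : f (w z (x + y)) = f (w z x) + f (w z y) by rewrite alt_additive.
have := w0 (tnth v i + tnth v j).
rewrite wl !wr !w0 add0r addr0 => /eqP; rewrite addrC addr_eq0 => /eqP.
have -> : w (tnth v i) (tnth v j) = v.
  apply: eq_from_tnth => l; rewrite !tnth_tset.
  by case: (l =P j) => [->//|_]; case: (l =P i) => [->|].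
have -> // : w (tnth v j) (tnth v i) = reorder v (tperm i j).
apply: eq_from_tnth => l; rewrite tnth_reorder !tnth_tset.
case: tpermP => [->|->|/eqP/negbTE-> /eqP/negbTE->//]; rewrite eqxx //.
by rewrite (negbTE nij).
Qed.

Lemma alt_perm v (s : 'S_p) : f (reorder v s) = (-1) ^+ s *: f v.
Proof.
elim/perm_tperm_ind: s => [|i j s nij IH].
  by rewrite reorder1 odd_perm1 scale1r.
rewrite reorderM alt_tperm // IH odd_permM odd_tperm nij signr_addb.
by rewrite mulN1r scaleNr.
Qed.

Lemma alt_uniq v : ~~ uniq v -> f v = 0.
Proof.
move=> nu; suff /existsP[i /existsP[j /andP[nij /eqP Eij]]] :
    [exists i, exists j, (i != j) && (tnth v i == tnth v j)].
  exact: (altf.2 _ _ _ nij).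
apply: contraNT nu; rewrite negb_exists => /forallP h.
rewrite -[tval v]map_tnth_enum map_inj_uniq ?enum_uniq // => i j Eij.
have := h i; rewrite negb_exists => /forallP /(_ j).
by rewrite Eij eqxx andbT negbK => /eqP.
Qed.

End Form.

Lemma is_alt_scale p (f : p.-tuple E -> F) c :
  is_alt f -> is_alt (fun v => c *: f v).
Proof.
move=> altf; split=> [v i a x y|v i j nij Eij].
  by rewrite alt_linear // scalerDr !scalerA (mulrC c).
by rewrite (altf.2 _ _ _ nij Eij) scaler0.
Qed.

Lemma is_alt_sub p (f g : p.-tuple E -> F) :
  is_alt f -> is_alt g -> is_alt (fun v => f v - g v).
Proof.
move=> altf altg; split=> [v i a x y|v i j nij Eij].
  by rewrite !alt_linear // scalerBr opprD addrACA.
by rewrite (altf.2 _ _ _ nij Eij) (altg.2 _ _ _ nij Eij) subrr.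
Qed.

Definition alt_sum (n : nat) (T : n.-tuple E -> F) (v : n.-tuple E) : F :=
  \sum_(s : 'S_n) (-1) ^+ s *: T (reorder v s).

Lemma eq_alt_sum n (T T' : n.-tuple E -> F) v :
  T =1 T' -> alt_sum T v = alt_sum T' v.
Proof. by move=> h; apply: eq_bigr => s _; rewrite h. Qed.

Lemma alt_sumD n (T T' : n.-tuple E -> F) v :
  alt_sum (fun w => T w + T' w) v = alt_sum T v + alt_sum T' v.
Proof. by rewrite -big_split; apply: eq_bigr => s _; rewrite scalerDr. Qed.

Lemma alt_sumZ n (T : n.-tuple E -> F) c v :
  alt_sum (fun w => c *: T w) v = c *: alt_sum T v.
Proof.
by rewrite scaler_sumr; apply: eq_bigr => s _; rewrite !scalerA mulrC.
Qed.

Lemma alt_sumN n (T : n.-tuple E -> F) v :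
  alt_sum (fun w => - T w) v = - alt_sum T v.
Proof.
by rewrite -scaleN1r -alt_sumZ; apply: eq_alt_sum => w; rewrite scaleN1r.
Qed.

Lemma alt_sum_reorder n (T : n.-tuple E -> F) t v :
  alt_sum (fun w => T (reorder w t)) v = (-1) ^+ t *: alt_sum T v.
Proof.
rewrite /alt_sum scaler_sumr (reindex_inj (mulgI t^-1%g)) /=.
apply: eq_bigr => s _; rewrite scalerA -reorderM mulKVg odd_permM odd_permV.
by rewrite signr_addb.
Qed.

(** The form in which antisymmetry is used below: exchanging two arguments of
    the summand changes the sign of its antisymmetrisation. *)
Lemma alt_sum_tperm n (T T' : n.-tuple E -> F) i j v : i != j ->
  (forall w, T' w = T (reorder w (tperm i j))) -> alt_sum T' v = - alt_sum T v.
Proof.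
move=> nij h; rewrite (eq_alt_sum _ h) alt_sum_reorder odd_tperm nij.
by rewrite scaleN1r.
Qed.

End Alternating.

Section TwoAlternating.
Variables (k : fieldType) (E F : lmodType k).
Hypothesis two0 : 2 != 0 :> k.

Lemma eq_opp0 (V : lmodType k) (x : V) : x = - x -> x = 0.
Proof.
move/eqP; rewrite -addr_eq0 -mulr2n -scaler_nat scaler_eq0 (negbTE two0).
by move/eqP.
Qed.

Lemma alt_sum_eq0 n (T : n.-tuple E -> F) v i j :
  i != j -> tnth v i = tnth v j -> alt_sum T v = 0.
Proof.
move=> nij Eij; apply: eq_opp0.
rewrite -[in RHS](reorder1 v); have Ev : reorder v (tperm i j) = v.
  apply: eq_from_tnth => l; rewrite tnth_reorder.
  by case: tpermP => [->|->|//]; rewrite Eij.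
rewrite {1}/alt_sum (reindex_inj (mulIg (tperm i j))) /= -sumrN.
apply: eq_bigr => s _; rewrite reorderM Ev reorder1 odd_permM odd_tperm nij.
by rewrite signr_addb mulrN1 scaleNr.
Qed.

End TwoAlternating.

Section Wedge.
Variables (k : fieldType) (E F G H : lmodType k) (p r : nat).
Variable Phi : F -> G -> H.
Hypothesis PhiL : forall a x y z, Phi (a *: x + y) z = a *: Phi x z + Phi y z.
Hypothesis PhiR : forall a x y z, Phi z (a *: x + y) = a *: Phi z x + Phi z y.
Variables (f : p.-tuple E -> F) (g : r.-tuple E -> G).
Hypotheses (altf : is_alt f) (altg : is_alt g).

Lemma PhiZl a x z : Phi (a *: x) z = a *: Phi x z.
Proof.
have P0 : Phi 0 z = 0.
  by have := PhiL (-1) 0 0 z; rewrite scaler0 addr0 scaleN1r addNr.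
by rewrite -[a *: x in LHS]addr0 PhiL P0 addr0.
Qed.

Lemma PhiZr a x z : Phi z (a *: x) = a *: Phi z x.
Proof.
have P0 : Phi z 0 = 0.
  by have := PhiR (-1) 0 0 z; rewrite scaler0 addr0 scaleN1r addNr.
by rewrite -[a *: x in LHS]addr0 PhiR P0 addr0.
Qed.

Lemma wedgeE v : wedge Phi f g v =
  \sum_(s : 'S_(p + r) | shuffle s)
    (-1) ^+ s *: Phi (f (ltuple (reorder v s))) (g (rtuple (reorder v s))).
Proof.
apply: eq_bigr => s _; congr (_ *: Phi (f _) (g _));
by apply: eq_from_tnth => i; rewrite !tnth_mktuple.
Qed.

(** Each shuffle stands for the [p! r!] permutations that differ from it by a
    block permutation, and the signs picked up by [f] and [g] in reordering
    their arguments are those of the block permutation.  Sums over all the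
    permutations are easier to transform than sums over shuffles, so every
    exterior product below is computed in this form. *)
Lemma wedge_alt_sum v :
  (p`! * r`!)%:R *: wedge Phi f g v =
  alt_sum (fun w => Phi (f (ltuple w)) (g (rtuple w))) v.
Proof.
rewrite wedgeE scaler_nat /alt_sum sum_shuffle // => a b s.
rewrite reorderM ltuple_block rtuple_block (alt_perm altf) (alt_perm altg).
rewrite PhiZl PhiZr !scalerA odd_permM odd_block; congr (_ *: _).
by move: (odd_perm a) (odd_perm b) (odd_perm s) => [] [] [];
  rewrite /= ?(expr0, expr1) ?(mulr1, mul1r, mulrN1, mulN1r, opprK).
Qed.

Lemma wedge_linear v i a x y :
  wedge Phi f g (tset v i (a *: x + y)) =
  a *: wedge Phi f g (tset v i x) + wedge Phi f g (tset v i y).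
Proof.
rewrite !wedgeE scaler_sumr -big_split; apply: eq_bigr => s _ /=.
rewrite scalerA [a * _]mulrC -scalerA -scalerDr; congr (_ *: _).
have Es z : reorder (tset v i z) s = tset (reorder v s) (s^-1%g i) z.
  apply: eq_from_tnth => l; rewrite !(tnth_reorder, tnth_tset).
  by rewrite (canF_eq (permK s)).
rewrite !Es; case: (split_ordP (s^-1%g i)) => j Ej.
  have El z : ltuple (tset (reorder v s) (s^-1%g i) z) =
              tset (ltuple (reorder v s)) j z.
    apply: eq_from_tnth => l; rewrite !(tnth_mktuple, tnth_tset) Ej.
    by rewrite (inj_eq (@lshift_inj _ _)).
  have Er z : rtuple (tset (reorder v s) (s^-1%g i) z) = rtuple (reorder v s).
    apply: eq_from_tnth => l; rewrite !(tnth_mktuple, tnth_tset) Ej.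
    by rewrite eq_rlshift.
  by rewrite !El !Er alt_linear // PhiL.
have Er z : rtuple (tset (reorder v s) (s^-1%g i) z) =
            tset (rtuple (reorder v s)) j z.
  apply: eq_from_tnth => l; rewrite !(tnth_mktuple, tnth_tset) Ej.
  by rewrite (inj_eq (@rshift_inj _ _)).
have El z : ltuple (tset (reorder v s) (s^-1%g i) z) = ltuple (reorder v s).
  apply: eq_from_tnth => l; rewrite !(tnth_mktuple, tnth_tset) Ej.
  by rewrite eq_lrshift.
by rewrite !El !Er alt_linear // PhiR.
Qed.

(** Multilinearity holds shuffle by shuffle; the vanishing on repeated arguments
    is read off the full antisymmetrisation, at the price of dividing by 2 and
    by [p! r!]. *)
Lemma wedge_is_alt : 2 != 0 :> k -> (p`! * r`!)%:R != 0 :> k ->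
  is_alt (wedge Phi f g).
Proof.
move=> two0 f0; split; first exact: wedge_linear.
move=> v i j nij Eij; apply: (scalerI f0).
by rewrite wedge_alt_sum scaler0 (alt_sum_eq0 two0 _ nij Eij).
Qed.

End Wedge.

Section Basis.
Variables (k : fieldType) (E : vectType k) (F : lmodType k) (n : nat).
Variable e : n.+1.-tuple E.
Hypothesis be : basis_of {: E} e.

(** Replace the arguments by combinations of basis vectors one slot at a time:
    the induction is on the number of slots still holding arbitrary vectors. *)
Lemma alt_basis_eq0 p (f : p.-tuple E -> F) : is_alt f ->
  (forall J : p.-tuple 'I_n.+1, f [tuple of map (tnth e) J] = 0) ->
  forall v, f v = 0.
Proof.
move=> altf h v.
suff : forall m (J : p.-tuple 'I_n.+1) (w : p.-tuple E),
    (forall i : 'I_p, (m <= i)%N -> tnth w i = tnth e (tnth J i)) -> f w = 0.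
  move=> hm; apply: (hm p [tuple ord0 | i < p]) => i.
  by rewrite leqNgt ltn_ord.
elim=> [|m IH] J w hw.
  rewrite -(h J); congr f; apply: eq_from_tnth => i.
  by rewrite tnth_map hw.
have [lmp|lpm] := ltnP m p; last first.
  by apply: (IH J) => i /(leq_trans lpm); rewrite leqNgt ltn_ord.
pose i0 := Ordinal lmp.
rewrite -(tset_same w i0) (coord_basis be (memvf (tnth w i0))).
rewrite (alt_sum_slot altf) big1 // => j _.
rewrite (IH (tset J i0 j)) ?scaler0 // => i lmi.
rewrite !tnth_tset; case: eqP => [_|/eqP ni].
  by rewrite (tnth_nth 0).
by apply: hw; rewrite ltn_neqAle lmi eq_sym andbT.
Qed.

End Basis.

(** Linearity as a property of plain functions, so that maps such as
    [fun u => psi u v w] need no bundled structure. *)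
Definition linear_map (k : fieldType) (U V : lmodType k) (f : U -> V) : Prop :=
  forall a x y, f (a *: x + y) = a *: f x + f y.

Section LinearMap.
Variables (k : fieldType) (U V : lmodType k) (f : U -> V).
Hypothesis linf : linear_map f.

Lemma lmap0 : f 0 = 0.
Proof.
by have := linf (-1) 0 0; rewrite scaler0 addr0 scaleN1r addNr.
Qed.

Lemma lmapD x y : f (x + y) = f x + f y.
Proof. by rewrite -[x in LHS]scale1r linf scale1r. Qed.

Lemma lmapZ a x : f (a *: x) = a *: f x.
Proof. by rewrite -[a *: x]addr0 linf lmap0 addr0. Qed.

Lemma lmapN x : f (- x) = - f x.
Proof. by rewrite -scaleN1r lmapZ scaleN1r. Qed.

Lemma lmapB x y : f (x - y) = f x - f y.
Proof. by rewrite lmapD lmapN. Qed.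

Lemma lmap_sum (I : Type) (r : seq I) (P : pred I) (x : I -> U) :
  f (\sum_(i <- r | P i) x i) = \sum_(i <- r | P i) f (x i).
Proof.
elim: r => [|i r IH]; first by rewrite !big_nil lmap0.
by rewrite !big_cons; case: (P i); rewrite // lmapD IH.
Qed.

End LinearMap.

(** * Octonions: identities and traces *)

(** Locked: otherwise the defining difference would unify with the additions
    that rewriting rules look for. *)
Definition oconj (k : fieldType) (O : octonionAlgebra k) : O -> O :=
  locked (@oct_conj k O).

Section Octonions.
Variables (k : fieldType) (O : octonionAlgebra k).
Hypothesis two0 : 2 != 0 :> k.

Local Notation B := (@octB k O).
Local Notation q := (@oct_norm k O).
Local Notation cj := (@oconj k O).
Local Notation "x '**' y" := (@oct_mul k O x y) (at level 40, left associativity).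
Local Notation "1o" := (@oct_one k O).
Implicit Types (u v w x y z : O) (a b c : k).

Lemma polarB u v : polar q u v = 2 * B u v.
Proof. by rewrite /octB mulrC divfK. Qed.

Lemma BC u v : B u v = B v u.
Proof. by rewrite /octB /polar [v + u]addrC addrAC. Qed.

Lemma Bl a u v w : B (a *: u + v) w = a * B u w + B v w.
Proof. by rewrite /octB (oct_norm_quadratic O).2 mulrDl mulrA. Qed.

Lemma BDl u v w : B (u + v) w = B u w + B v w.
Proof. by rewrite -[u in LHS]scale1r Bl mul1r. Qed.
Lemma B0l w : B 0 w = 0.
Proof. by apply: (addrI (B 0 w)); rewrite -BDl !addr0. Qed.
Lemma BZl a u w : B (a *: u) w = a * B u w.
Proof. by rewrite -[a *: u]addr0 Bl B0l addr0. Qed.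
Lemma BNl u w : B (- u) w = - B u w.
Proof. by rewrite -scaleN1r BZl mulN1r. Qed.
Lemma BDr u v w : B w (u + v) = B w u + B w v.
Proof. by rewrite !(BC w) BDl. Qed.
Lemma BZr a u w : B w (a *: u) = a * B w u.
Proof. by rewrite !(BC w) BZl. Qed.
Lemma BNr u w : B w (- u) = - B w u.
Proof. by rewrite !(BC w) BNl. Qed.
Lemma B_suml (I : Type) (r : seq I) (P : pred I) (x : I -> O) w :
  B (\sum_(i <- r | P i) x i) w = \sum_(i <- r | P i) B (x i) w.
Proof.
elim: r => [|i r IH]; first by rewrite !big_nil B0l.
by rewrite !big_cons; case: (P i); rewrite // BDl IH.
Qed.

Definition Blin := (BDl, BDr, BZl, BZr, BNl, BNr).

Lemma qZ a u : q (a *: u) = a ^+ 2 * q u.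
Proof. exact: (oct_norm_quadratic O).1. Qed.

Lemma Bxx u : B u u = q u.
Proof.
rewrite /octB /polar.
have -> : u + u = 2 *: u by rewrite scaler_nat mulr2n.
by rewrite qZ; field.
Qed.

Lemma qD u v : q (u + v) = q u + q v + 2 * B u v.
Proof. by rewrite -polarB /polar; ring. Qed.

Lemma B_nondeg u : (forall v, B u v = 0) -> u = 0.
Proof.
by move=> h; apply: oct_norm_nondegenerate => v; rewrite polarB h mulr0.
Qed.

Lemma B_inj x y : (forall z, B x z = B y z) -> x = y.
Proof.
move=> h; apply/eqP; rewrite -subr_eq0; apply/eqP/B_nondeg => z.
by rewrite !Blin h subrr.
Qed.

Lemma omDl x y z : (x + y) ** z = x ** z + y ** z. Proof. exact: linearDl. Qed.
Lemma omDr x y z : z ** (x + y) = z ** x + z ** y. Proof. exact: linearDr. Qed.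
Lemma omNl x z : (- x) ** z = - (x ** z). Proof. exact: linearNl. Qed.
Lemma omNr x z : z ** (- x) = - (z ** x). Proof. exact: linearNr. Qed.
Lemma omZl a x z : (a *: x) ** z = a *: (x ** z). Proof. exact: linearZl_LR. Qed.
Lemma omZr a x z : z ** (a *: x) = a *: (z ** x). Proof. exact: linearZr_LR. Qed.
Definition omlin := (omDl, omDr, omZl, omZr, omNl, omNr).

Lemma om0l z : 0 ** z = 0. Proof. exact: linear0l. Qed.

Lemma om1l x : 1o ** x = x. Proof. exact: oct_mul1. Qed.
Lemma om1r x : x ** 1o = x. Proof. exact: oct_mulr1. Qed.

(** If [q 1] were not 1, multiplicativity would force [q] to vanish, and a
    nondegenerate form on a space of dimension 8 does not. *)
Lemma q1 : q 1o = 1.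
Proof.
have [//|n1] := eqVneq (q 1o) 1.
have q0 u : q u = 0.
  have := oct_normM 1o u; rewrite om1l => /eqP.
  by rewrite -subr_eq0 -{1}[q u]mul1r -mulrBl mulf_eq0 subr_eq0 eq_sym (negbTE n1) => /eqP.
have z0 u : u = 0 by apply: B_nondeg => v; rewrite /octB /polar !q0 !subr0 mul0r.
have : vpick {: O} != 0 by rewrite vpick0 -dimv_eq0 oct_dim.
by rewrite [vpick _]z0 eqxx.
Qed.

Lemma BMl x y z : B (x ** y) (x ** z) = q x * B y z.
Proof. by rewrite /octB /polar -omDr !oct_normM; field. Qed.

Lemma BMr x y z : B (y ** x) (z ** x) = B y z * q x.
Proof. by rewrite /octB /polar -omDl !oct_normM; field. Qed.

(** The polarisation of the multiplicativity of [q] in both factors; all the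
    identities of the octonions below are consequences of it. *)
Lemma BM x y z w : B (x ** y) (z ** w) + B (x ** w) (z ** y) = 2 * B x z * B y w.
Proof.
have := BMl (x + z) y w.
rewrite qD !omlin !Blin !BMl => h.
rewrite (BC (x ** w)); have -> : 2 * B x z * B y w =
  (q x + q z + 2 * B x z) * B y w - q x * B y w - q z * B y w by ring.
by rewrite -h; ring.
Qed.

Lemma cjE x : cj x = (2 * B x 1o) *: 1o - x.
Proof. by rewrite /oconj -lock /oct_conj polarB. Qed.

Lemma B1o : B 1o 1o = 1. Proof. by rewrite Bxx q1. Qed.

Lemma cj_linear : linear_map cj.
Proof. by move=> a x y; apply: B_inj => z; rewrite !cjE !Blin; ring. Qed.

Lemma cjK x : cj (cj x) = x.
Proof. by apply: B_inj => z; rewrite !cjE !Blin B1o; ring. Qed.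

Lemma B_cjl x y : B (cj x) y = B x (cj y).
Proof. by rewrite !cjE !Blin (BC y) (BC 1o); ring. Qed.

Lemma B_cj x y : B (cj x) (cj y) = B x y.
Proof. by rewrite B_cjl cjK. Qed.

Lemma q_cj x : q (cj x) = q x.
Proof. by rewrite -!Bxx B_cj. Qed.

(** [BM] with one argument equal to 1. *)
Lemma B_adjl x y z : B (x ** y) z = B y (cj x ** z).
Proof.
have := BM x y 1o z; rewrite !om1l cjE !omlin om1l !Blin => h.
by rewrite (BC y (x ** z)) -h; ring.
Qed.

Lemma B_adjr x y z : B (x ** y) z = B x (z ** cj y).
Proof.
have := BM x y z 1o; rewrite !om1r cjE !omlin om1r !Blin => h.
by rewrite -[RHS]addr0 mulrAC -h; ring.
Qed.

(** Left multiplications satisfy Clifford relations; with adjunction the claim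
    becomes [BM]. *)
Lemma cliffL x y z : cj x ** (y ** z) + cj y ** (x ** z) = (2 * B x y) *: z.
Proof.
apply: B_inj => w; rewrite !Blin !(B_adjl (cj _)) !cjK.
by rewrite [B (x ** z) _]BC BM (BC y).
Qed.

Lemma cliffL' x y z : x ** (cj y ** z) + y ** (cj x ** z) = (2 * B x y) *: z.
Proof. by rewrite -{1}[x]cjK -{2}[y]cjK cliffL B_cj. Qed.

Lemma cliffR x y z : (z ** x) ** cj y + (z ** y) ** cj x = (2 * B x y) *: z.
Proof.
apply: B_inj => w; rewrite !Blin !(B_adjr _ (cj _)) !cjK.
by rewrite BM mulrAC.
Qed.

Lemma cliffR' x y z : (z ** cj x) ** y + (z ** cj y) ** x = (2 * B x y) *: z.
Proof. by rewrite -{2}[x]cjK -{1}[y]cjK cliffR B_cj. Qed.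

Lemma om_cjl x y : cj x ** (x ** y) = q x *: y.
Proof.
have h := cliffL x x y; apply: (scalerI two0).
by rewrite scalerA -Bxx -h scaler_nat mulr2n.
Qed.

Lemma om_cjl' x y : x ** (cj x ** y) = q x *: y.
Proof. by rewrite -{1}[x]cjK om_cjl q_cj. Qed.

Lemma om_cjr x y : (y ** x) ** cj x = q x *: y.
Proof.
have h := cliffR x x y; apply: (scalerI two0).
by rewrite scalerA -Bxx -h scaler_nat mulr2n.
Qed.

Lemma om_cjr' x y : (y ** cj x) ** x = q x *: y.
Proof. by rewrite -{2}[x]cjK om_cjr q_cj. Qed.

Section OrthogonalBasis.
Variable e : 8.-tuple O.
Hypothesis he : orthogonal_basis e.
Local Notation e_ i := (tnth e i).

Lemma orthE i j : i != j -> B (e_ i) (e_ j) = 0.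
Proof. exact: he.2. Qed.

Lemma basis_coord x : x = \sum_i coord e i x *: e_ i.
Proof.
rewrite {1}(coord_basis he.1 (memvf x)); apply: eq_bigr => i _.
by rewrite (tnth_nth 0).
Qed.

Lemma B_coord x i : B x (e_ i) = coord e i x * q (e_ i).
Proof.
rewrite {1}(basis_coord x) B_suml (bigD1 i) //= big1 => [|j nij].
  by rewrite addr0 BZl Bxx.
by rewrite BZl orthE // mulr0.
Qed.

Lemma q_basis i : q (e_ i) != 0.
Proof.
apply: contraNneq (free_not0 (basis_free he.1) (mem_tnth i e)) => q0.
apply/eqP/B_nondeg => v; rewrite BC (basis_coord v) B_suml big1 // => j _.
by rewrite BZl; have [->|nj] := eqVneq j i; rewrite ?Bxx ?q0 ?orthE ?mulr0.
Qed.

Lemma expand x : x = \sum_i (B x (e_ i) / q (e_ i)) *: e_ i.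
Proof.
rewrite {1}(basis_coord x); apply: eq_bigr => i _.
by rewrite B_coord mulfK ?q_basis.
Qed.

Lemma expand_map (V : lmodType k) (f : O -> V) x : linear_map f ->
  \sum_i (B x (e_ i) / q (e_ i)) *: f (e_ i) = f x.
Proof.
move=> lf; rewrite [in RHS](expand x) (lmap_sum lf).
by apply: eq_bigr => i _; rewrite (lmapZ lf).
Qed.

Lemma parseval x y : \sum_i B x (e_ i) * B y (e_ i) / q (e_ i) = B x y.
Proof.
have lf : linear_map (V := k^o) (B y).
  by move=> a u v; rewrite !Blin.
rewrite (BC x y) -(expand_map x lf); apply: eq_bigr => i _.
by rewrite mulrAC.
Qed.

(** The trace computed in the orthogonal basis [e]; see [lfun_traceE]. *)
Definition otrace (f : O -> O) : k := \sum_i B (f (e_ i)) (e_ i) / q (e_ i).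

(** Expanding the inner map in the basis turns both sides into the same double
    sum. *)
Lemma otraceC f g : linear_map f -> linear_map g ->
  otrace (fun x => f (g x)) = otrace (fun x => g (f x)).
Proof.
move=> lf lg.
have E f1 g1 : linear_map f1 -> otrace (fun x => f1 (g1 x)) =
   \sum_i \sum_j B (g1 (e_ i)) (e_ j) * B (f1 (e_ j)) (e_ i) / (q (e_ i) * q (e_ j)).
  move=> lf1; apply: eq_bigr => i _.
  rewrite -(expand_map (g1 (e_ i)) lf1) B_suml mulr_suml; apply: eq_bigr => j _.
  by rewrite BZl; field; rewrite !q_basis.
rewrite E // E // exchange_big; apply: eq_bigr => i _; apply: eq_bigr => j _.
by rewrite [B (g _) _ * _]mulrC [q (e_ i) * _]mulrC.
Qed.

Lemma otrace_mul x y : otrace (fun z => x ** (cj y ** z)) = 8 * B x y.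
Proof.
rewrite /otrace (eq_bigr (fun=> B x y)) => [|i _].
  by rewrite sumr_const card_ord mulr_natl.
by rewrite B_adjl BMr B_cj mulfK ?q_basis // BC.
Qed.

Lemma lfun_traceE (f : 'End(O)) : lfun_trace f = otrace f.
Proof.
pose b := vbasis {: O}; have bb : basis_of {: O} b := vbasisP _.
have -> : lfun_trace f = \sum_i coord b i (f b`_i).
  rewrite /lfun_trace /mxtrace; apply: eq_bigr => i _.
  by rewrite /passmx.mxof mxE /= passmx.vecof_delta mxE.
have lc i : linear_map (V := k^o) (fun x => coord b i (f x)).
  by move=> a x y; rewrite !linearP.
under eq_bigr => i _ do rewrite -(expand_map _ (lc i)).
rewrite exchange_big; apply: eq_bigr => j _.
rewrite {2}(coord_basis bb (memvf (f (e_ j)))) B_suml mulr_suml.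
by apply: eq_bigr => i _; rewrite BZl -[_ *: _]/(_ * _) mulrC mulrA.
Qed.

Definition mul4 x y z w : O -> O := fun t => x ** (cj y ** (z ** (cj w ** t))).
Definition mul4' x y z w : O -> O := fun t => cj x ** (y ** (cj z ** (w ** t))).

Lemma om_lin x : linear_map (oct_mul x).
Proof. by move=> a u v; rewrite !omlin. Qed.

Lemma mul4_lin x y z w : linear_map (mul4 x y z w).
Proof. by move=> a u v; rewrite /mul4 !(omDr, omZr). Qed.

Lemma otrace_rot x y z w : otrace (mul4' x y z w) = otrace (mul4 y z w x).
Proof.
rewrite /mul4' (otraceC (om_lin (cj x)) (g := fun t => y ** (cj z ** (w ** t)))) //.
by move=> a u v; rewrite !omlin.
Qed.

Lemma otrace_rot2 x y z w : otrace (mul4 x y z w) = otrace (mul4 z w x y).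
Proof.
have lf u v : linear_map (fun t => u ** (cj v ** t)).
  by move=> a u1 v1; rewrite !omlin.
exact: (otraceC (lf x y) (lf z w)).
Qed.

Lemma eq_otrace f g : f =1 g -> otrace f = otrace g.
Proof. by move=> h; apply: eq_bigr => i _; rewrite h. Qed.

Lemma otraceD f g : otrace (fun x => f x + g x) = otrace f + otrace g.
Proof. by rewrite -big_split; apply: eq_bigr => i _; rewrite BDl mulrDl. Qed.

Lemma otraceZ c f : otrace (fun x => c *: f x) = c * otrace f.
Proof. by rewrite mulr_sumr; apply: eq_bigr => i _; rewrite BZl mulrA. Qed.

Lemma otrace_swap12 x y z w :
  otrace (mul4 x y z w) = 16 * B x y * B z w - otrace (mul4 y x z w).
Proof.
apply/eqP; rewrite -subr_eq opprK -otraceD.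
rewrite (eq_otrace (g := fun t => (2 * B x y) *: (z ** (cj w ** t)))).
  by rewrite otraceZ otrace_mul; apply/eqP; ring.
by move=> t; rewrite /mul4 cliffL'.
Qed.

Lemma otrace_swap34 x y z w :
  otrace (mul4 x y z w) = 16 * B x y * B z w - otrace (mul4 x y w z).
Proof.
apply/eqP; rewrite -subr_eq opprK -otraceD.
rewrite (eq_otrace (g := fun t => (2 * B z w) *: (x ** (cj y ** t)))).
  by rewrite otraceZ otrace_mul; apply/eqP; ring.
by move=> t; rewrite /mul4 -!omDr cliffL' !omlin.
Qed.

Lemma otrace_swap23 x y z w :
  otrace (mul4 x y z w) = 16 * B y z * B x w - otrace (mul4 x z y w).
Proof.
apply/eqP; rewrite -subr_eq opprK -otraceD.
rewrite (eq_otrace (g := fun t => (2 * B y z) *: (x ** (cj w ** t)))).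
  by rewrite otraceZ otrace_mul; apply/eqP; ring.
by move=> t; rewrite /mul4 -!omDr cliffL !omlin.
Qed.

(** For [m] running over the basis, the sum of the traces of
    [L_(conj m) L_x L_(conj y) L_z L_(conj w) L_m], divided by [q m], is computed
    in two ways: by cyclicity, and by moving [L_(conj m)] to the right with the
    Clifford relations. *)
Lemma otrace_contract x y z w :
  8 * otrace (mul4 x y z w) =
  2 * otrace (mul4 x y z w) - 2 * otrace (mul4 z w y x) +
  2 * otrace (mul4 y w z x) + 6 * otrace (mul4 y z w x).
Proof.
pose M m t := cj m ** mul4 x y z w (m ** t).
have E1 m : otrace (M m) = q m * otrace (mul4 x y z w).
  rewrite /M (otraceC (om_lin (cj m)) (g := fun t => mul4 x y z w (m ** t))).
    rewrite -otraceZ; apply: eq_otrace => t.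
    by rewrite om_cjl' (lmapZ (mul4_lin x y z w)).
  move=> a u v; have -> : m ** (a *: u + v) = a *: (m ** u) + m ** v.
    by rewrite !omlin.
  exact: mul4_lin.
have E2 m t : M m t =
    (2 * B x m) *: mul4' y z w m t + (- (2 * B y m)) *: mul4' x z w m t +
    (2 * B z m) *: mul4' x y w m t + (- (2 * B w m)) *: mul4' x y z m t +
    q m *: mul4' x y z w t.
  rewrite /M /mul4.
  have h1 u v s : cj u ** (v ** s) = (2 * B u v) *: s - cj v ** (u ** s).
    by rewrite -cliffL addrK.
  have h2 u v s : u ** (cj v ** s) = (2 * B u v) *: s - v ** (cj u ** s).
    by rewrite -cliffL' addrK.
  rewrite h1 (h2 m y) (h1 m z) (h2 m w) om_cjl.
  rewrite /mul4'; apply: B_inj => s; rewrite !omlin !Blin.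
  by rewrite (BC m x) (BC m y) (BC m z) (BC m w); ring.
have E3 : \sum_i (q (e_ i))^-1 * otrace (M (e_ i)) = 8 * otrace (mul4 x y z w).
  rewrite (eq_bigr (fun=> otrace (mul4 x y z w))) => [|i _].
    by rewrite sumr_const card_ord mulr_natl.
  by rewrite E1 mulKf ?q_basis.
rewrite -{1}E3.
have E4 i : (q (e_ i))^-1 * otrace (M (e_ i)) =
   2 * (B x (e_ i) / q (e_ i) * otrace (mul4' y z w (e_ i)) -
        B y (e_ i) / q (e_ i) * otrace (mul4' x z w (e_ i)) +
        B z (e_ i) / q (e_ i) * otrace (mul4' x y w (e_ i)) -
        B w (e_ i) / q (e_ i) * otrace (mul4' x y z (e_ i))) +
   otrace (mul4' x y z w).
  rewrite (eq_otrace (E2 _)) !otraceD !otraceZ; field; exact: q_basis.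
have E5 u x1 x2 x3 : \sum_i B u (e_ i) / q (e_ i) * otrace (mul4' x1 x2 x3 (e_ i)) =
    otrace (mul4' x1 x2 x3 u).
  apply: (expand_map (V := k^o) (f := fun w => otrace (mul4' x1 x2 x3 w))).
  move=> a u1 v1; rewrite -[a *: (_ : k^o)]/(a * _) -otraceZ -otraceD; apply: eq_otrace => t.
  by rewrite /mul4' !omlin.
rewrite (eq_bigr _ (fun i _ => E4 i)) big_split sumr_const card_ord -mulr_sumr.
rewrite /= !big_split /= !sumrN !E5 !otrace_rot.
by rewrite (otrace_rot2 z w) -mulr_natl; ring.
Qed.

(** The Clifford relations determine the trace up to its totally antisymmetric
    part.  That part vanishes: for distinct [x, y, z, w] in an orthogonal basis,
    moving [L_(conj m)] across the product gives [mul4' x y z w], with sign [+]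
    for the four basis vectors [m] outside [x, y, z, w] and [-] for the four
    others, so [otrace_contract] equates 8 times this part with 0. *)
Lemma otrace4 x y z w : otrace (mul4 x y z w) =
  8 * (B x y * B z w - B x z * B y w + B x w * B y z).
Proof.
have := otrace_contract x y z w.
have -> : otrace (mul4 y z w x) = 16 * (B w x * B y z - B z x * B y w + B y x * B z w)
    - otrace (mul4 x y z w).
  by rewrite (otrace_swap34 y z) (otrace_swap23 y z) (otrace_swap12 y x); ring.
have -> : otrace (mul4 y w z x) = 16 * (B z x * B y w - B w x * B y z)
    + otrace (mul4 x y z w).
  rewrite (otrace_swap34 y w) (otrace_swap23 y w) (otrace_swap12 y x).
  by rewrite (otrace_swap34 x y w) (BC y x); ring.
have -> : otrace (mul4 z w y x) = 16 * (B z w * B x y) - otrace (mul4 x y z w).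
  rewrite (otrace_swap34 z w y) (otrace_swap23 z w) (otrace_swap12 z x).
  rewrite (otrace_swap34 x z) (otrace_swap23 x z).
  by rewrite (BC z x) (BC w x) (BC y x); ring.
rewrite (BC z x) (BC w x) (BC y x) => h.
have e0 : 8 != 0 :> k.
  by rewrite (_ : 8 = 2 ^+ 3 :> k) ?expf_neq0 //; ring.
by apply: (mulfI e0); rewrite h; ring.
Qed.

End OrthogonalBasis.
End Octonions.

(** * The Clifford action by right multiplications and its chirality *)

Section SplitTwo.
Variables (T : Type) (x0 : T).

Lemma cat_take_nth2 (l : seq T) i j : (i < j)%N -> (j < size l)%N ->
  l = take i l ++ nth x0 l i :: take (j - i.+1) (drop i.+1 l)
      ++ nth x0 l j :: drop j.+1 l.
Proof.
move=> lij ljn; rewrite -{1}(cat_take_drop i l) (drop_nth x0) ?(ltn_trans lij) //.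
congr (_ ++ _ :: _); rewrite -{1}(cat_take_drop (j - i.+1) (drop i.+1 l)).
by rewrite drop_drop subnK // -drop_nth.
Qed.

End SplitTwo.

Section Clifford.
Variables (k : fieldType) (O : octonionAlgebra k).
Hypothesis two0 : 2 != 0 :> k.

Local Notation B := (@octB k O).
Local Notation q := (@oct_norm k O).
Local Notation cj := (@oconj k O).
Local Notation "x '**' y" := (@oct_mul k O x y) (at level 40, left associativity).
Local Notation "1o" := (@oct_one k O).
Implicit Types (u v w x y : O) (a b c : k) (z : (O * O)%type).

(** Generators of the Clifford algebra of [q] acting on two copies of [O]; the
    conjugation makes the square of [cliff_gen x] the scalar [q x], see
    [cliff_gen_sq].  In [cliff_prod l] the head of [l] acts first. *)
Definition cliff_gen x z : O * O := (z.2 ** cj x, z.1 ** x).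
Definition cliff_prod (l : seq O) z : O * O := foldl (fun t x => cliff_gen x t) z l.

Lemma cliff_gen_linr x : linear_map (cliff_gen x).
Proof. by move=> a [u1 u2] [v1 v2]; rewrite /cliff_gen /= !omlin. Qed.

Lemma cliff_gen_linl z : linear_map (fun x => cliff_gen x z).
Proof. by move=> a x y; rewrite /cliff_gen cj_linear // !omlin. Qed.

Lemma cliff_gen_polar x y z : cliff_gen y (cliff_gen x z) + cliff_gen x (cliff_gen y z) = (2 * B x y) *: z.
Proof.
case: z => a b; rewrite /cliff_gen /=; congr pair => /=; first exact: cliffR.
by rewrite -cliffR'.
Qed.

Lemma cliff_genC x y z : B x y = 0 -> cliff_gen y (cliff_gen x z) = - cliff_gen x (cliff_gen y z).
Proof. by move=> h; apply/eqP; rewrite -addr_eq0 cliff_gen_polar h mulr0 scale0r. Qed.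

Lemma cliff_gen_sq x z : cliff_gen x (cliff_gen x z) = q x *: z.
Proof. by case: z => a b; rewrite /cliff_gen /= om_cjr // om_cjr'. Qed.

Lemma cliff_prod_cat l1 l2 z : cliff_prod (l1 ++ l2) z = cliff_prod l2 (cliff_prod l1 z).
Proof. exact: foldl_cat. Qed.

Lemma cliff_prod_lin l : linear_map (cliff_prod l).
Proof.
by elim: l => [//|x l IH] a u v; rewrite /cliff_prod /= cliff_gen_linr; apply: IH.
Qed.

(** Each generator that [cliff_gen y] crosses is orthogonal to it and
    contributes a sign. *)
Lemma cliff_prod_pass l y z : (forall x, x \in l -> B x y = 0) ->
  cliff_gen y (cliff_prod l z) = (-1) ^+ size l *: cliff_prod l (cliff_gen y z).
Proof.
elim: l z => [|x l IH] z h; first by rewrite scale1r.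
rewrite /= IH => [|x' hx']; last by apply: h; rewrite inE hx' orbT.
rewrite cliff_genC ?h ?mem_head // (lmapN (@cliff_prod_lin l)) scalerN exprS mulN1r.
by rewrite scaleNr.
Qed.

Definition orthogonal_seq := pairwise (fun x y => B x y == 0).

(** Reversing a product exchanges each of its pairs of factors once. *)
Lemma cliff_prod_rev l z : orthogonal_seq l ->
  cliff_prod (rev l) z = (-1) ^+ 'C(size l, 2) *: cliff_prod l z.
Proof.
elim: l z => [|x l IH] z; first by rewrite scale1r.
rewrite /orthogonal_seq /= => /andP[/allP ox ol].
rewrite rev_cons -cats1 cliff_prod_cat /= IH // (lmapZ (cliff_gen_linr x)).
rewrite cliff_prod_pass => [|y /ox/eqP hy]; last by rewrite BC.
by rewrite scalerA -exprD binS bin1 addnC.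
Qed.

Lemma cliff_prod_revK l z : cliff_prod (rev l) (cliff_prod l z) = (\prod_(x <- l) q x) *: z.
Proof.
elim: l z => [|x l IH] z; first by rewrite big_nil scale1r.
rewrite rev_cons -cats1 cliff_prod_cat /= IH (lmapZ (cliff_gen_linr x)) cliff_gen_sq scalerA.
by rewrite big_cons mulrC.
Qed.

Definition pairB z z' := B z.1 z'.1 + B z.2 z'.2.

Lemma cliff_gen_adj x z z' : pairB (cliff_gen x z) z' = pairB z (cliff_gen x z').
Proof. by rewrite /pairB /cliff_gen /= B_adjr // cjK // (B_adjr _ z.1) // addrC. Qed.

Lemma cliff_prod_adj l z z' : pairB (cliff_prod l z) z' = pairB z (cliff_prod (rev l) z').
Proof.
elim: l z z' => [//|x l IH] z z' /=.
by rewrite IH cliff_gen_adj rev_cons -cats1 cliff_prod_cat.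
Qed.

Lemma cliff_prod_even l u : ~~ odd (size l) -> (cliff_prod l (u, 0)).2 = 0.
Proof.
move=> h; have [n] : {n | size l = n.*2}.
  by exists (size l)./2; rewrite -[LHS]odd_double_half (negbTE h).
elim: n l u {h} => [|n IH] [|x [|y l]] u //= [/IH h].
by rewrite /cliff_gen /= !om0l; apply: h.
Qed.

(** Bringing [x] and [y] across [m] costs the same sign twice, and exchanging
    them costs one more. *)
Lemma cliff_prod_swap l1 l2 m x y z : orthogonal_seq (l1 ++ x :: m ++ y :: l2) ->
  cliff_prod (l1 ++ y :: m ++ x :: l2) z = - cliff_prod (l1 ++ x :: m ++ y :: l2) z.
Proof.
rewrite /orthogonal_seq pairwise_cat pairwise_cons => /and3P[_ _ /andP[]].
rewrite all_cat pairwise_cat allrel_consr /=.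
move=> /andP[/allP xm /andP[/eqP xy _]] /andP[/andP[/allP my _] _].
rewrite !cliff_prod_cat /= !cliff_prod_cat /= !(@cliff_prod_pass m).
- rewrite (cliff_genC _ xy) (lmapN (@cliff_prod_lin m)) scalerN (lmapN (@cliff_prod_lin l2)).
  by rewrite opprK.
- by move=> t /my/eqP.
- by move=> t /xm/eqP; rewrite BC.
Qed.

Lemma orthogonal_tupleP n (e : n.-tuple O) :
  (forall i j, i != j -> B (tnth e i) (tnth e j) = 0) -> orthogonal_seq e.
Proof.
move=> h; apply/(pairwiseP 0) => i j; rewrite !inE size_tuple => li lj lij.
rewrite -!(tnth_nth 0 e (Ordinal _)); apply/eqP/h.
by rewrite -val_eqE /= neq_ltn lij.
Qed.

Lemma cliff_prod_perm n (e : n.-tuple O) (s : 'S_n) z :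
  (forall i j, i != j -> B (tnth e i) (tnth e j) = 0) ->
  cliff_prod (reorder e s) z = (-1) ^+ s *: cliff_prod e z.
Proof.
elim/perm_tperm_ind: s e => [|i j s nij IH] e oe.
  by rewrite reorder1 odd_perm1 scale1r.
wlog lij : i j nij / (i < j)%N.
  move=> h; have := nij; rewrite -val_eqE neq_ltn => /orP[]; first exact: h.
  by rewrite tpermC; apply: h; rewrite eq_sym.
rewrite reorderM; set f := reorder e s.
have -> : (-1) ^+ (tperm i j * s)%g *: cliff_prod e z = - cliff_prod f z.
  by rewrite /f IH // odd_permM odd_tperm nij signr_addb mulN1r scaleNr.
set g := reorder f _.
have of_ : orthogonal_seq f.
  apply: orthogonal_tupleP => a b nab; rewrite !tnth_reorder; apply: oe.
  by rewrite (inj_eq perm_inj).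
have gE (l : 'I_n) : nth 0 g l = nth 0 f (tperm i j l).
  by rewrite -!tnth_nth tnth_reorder.
have gE' l : (l < n)%N -> l != i -> l != j -> nth 0 g l = nth 0 f l.
  by move=> ln ni nj; rewrite (gE (Ordinal ln)) tpermD // -val_eqE eq_sym.
rewrite [X in cliff_prod X](cat_take_nth2 0 lij) ?size_tuple //.
rewrite [X in _ = - cliff_prod X _](cat_take_nth2 0 lij) ?size_tuple //.
rewrite !gE tpermL tpermR.
have -> : take i g = take i f.
  apply: (@eq_from_nth _ 0) => [|l]; rewrite !size_take !size_tuple ltn_ord // => li.
  by rewrite !nth_take // gE' //; have := ltn_ord i; lia.
have -> : drop j.+1 g = drop j.+1 f.
  apply: (@eq_from_nth _ 0) => [|l]; rewrite !size_drop !size_tuple // => li.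
  by rewrite !nth_drop gE' //; lia.
have -> : take (j - i.+1) (drop i.+1 g) = take (j - i.+1) (drop i.+1 f).
  have sz (h : n.-tuple O) : size (take (j - i.+1) (drop i.+1 h)) = (j - i.+1)%N.
    rewrite size_take size_drop size_tuple; case: ltnP => //.
    by have := ltn_ord j; lia.
  apply: (@eq_from_nth _ 0) => [|l]; rewrite !sz // => li.
  by rewrite !nth_take // !nth_drop gE' //; have := ltn_ord j; lia.
by apply: cliff_prod_swap; rewrite -cat_take_nth2 // size_tuple.
Qed.

Section SelfDual.
Variable e : 8.-tuple O.
Hypothesis he : orthogonal_basis e.
Local Notation e_ i := (tnth e i).

Definition chirality (e : 8.-tuple O) : k := B (cliff_prod e (1o, 0)).1 1o.

Lemma chirality_reorder (s : 'S_8) : chirality (reorder e s) = (-1) ^+ s * chirality e.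
Proof. by rewrite /chirality cliff_prod_perm ?BZl //; apply: he.2. Qed.

(** By linearity [y] may be taken in the basis; its generator then commutes with
    itself and anticommutes with the seven others. *)
Lemma cliff_prod_basis_anticomm y z : cliff_gen y (cliff_prod e z) = - cliff_prod e (cliff_gen y z).
Proof.
have lf1 : linear_map (fun y => cliff_gen y (cliff_prod e z)) by apply: cliff_gen_linl.
have lf2 : linear_map (fun y => - cliff_prod e (cliff_gen y z)).
  by move=> a u v; rewrite (@cliff_gen_linl z) cliff_prod_lin opprD scalerN.
rewrite -(expand_map two0 he y lf1) -(expand_map two0 he y lf2).
apply: eq_bigr => i _; congr (_ *: _); set x := e_ i.
have li : (i < size e)%N by rewrite size_tuple.
have Ee : tval e = take i e ++ x :: drop i.+1 e.
  by rewrite /x (tnth_nth 0) -drop_nth // cat_take_drop.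
have sz : (size (take i e) + size (drop i.+1 e) = 7)%N.
  by rewrite size_takel ?size_drop ?size_tuple; move: li; rewrite size_tuple; lia.
move: (take i e) (drop i.+1 e) Ee sz => l1 l2 Ee sz.
have sg : (-1) ^+ size l2 = - (-1) ^+ size l1 :> k.
  have n0 : (-1) ^+ size l1 != 0 :> k by rewrite signr_eq0.
  apply: (mulfI n0); rewrite -exprD sz mulrN -expr2 sqrr_sign.
  by rewrite -signr_odd expr1.
have := orthogonal_tupleP he.2.
rewrite /orthogonal_seq Ee pairwise_cat /= allrel_consr.
case/and3P=> /andP[/allP h1 _] _ /andP[/allP h2 _].
rewrite cliff_prod_cat /= cliff_prod_pass => [|t /h2/eqP]; last by rewrite BC.
rewrite !cliff_prod_cat /= -[cliff_gen x z]scale1r.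
have E1 : cliff_prod l1 (cliff_gen x z) = (-1) ^+ size l1 *: cliff_gen x (cliff_prod l1 z).
  by rewrite cliff_prod_pass => [|t /h1/eqP //]; rewrite signrZK.
rewrite scale1r E1 (lmapZ (cliff_gen_linr x)) (lmapZ (@cliff_prod_lin _)).
by rewrite -scaleNr sg.
Qed.

(** Write the product as [f] on the first copy of [O].  Anticommuting with a
    generator twice gives [f (v y) = f v * y], hence [f v = c v] with [c = f 1].
    The product is also equal to its reversal, the number of pairs being 28, so
    it is self-adjoint; this makes [c] orthogonal to the imaginary octonions,
    hence a scalar. *)
Lemma cliff_prod_basis u : cliff_prod e (u, 0) = (chirality e *: u, 0).
Proof.
have E2 v : (cliff_prod e (v, 0)).2 = 0 by apply: cliff_prod_even; rewrite size_tuple.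
have E1 v y : (cliff_prod e (v, 0)).1 ** y = - (cliff_prod e (0, v ** y)).2.
  by have := congr1 snd (cliff_prod_basis_anticomm y (v, 0)); rewrite /cliff_gen /= !om0l.
have E v y : (cliff_prod e (v ** y, 0)).1 = (cliff_prod e (v, 0)).1 ** y.
  by rewrite E1 -{2}[v ** y]om1r -E1 om1r.
pose c := (cliff_prod e (1o, 0)).1.
have Ec v : (cliff_prod e (v, 0)).1 = c ** v by rewrite -[v in LHS]om1l E.
have cE : c = chirality e *: 1o.
  have cb v : B c v = B c (cj v).
    have := cliff_prod_adj e (1o, 0) (v, 0).
    rewrite cliff_prod_rev ?size_tuple; last exact: orthogonal_tupleP he.2.
    rewrite (_ : 'C(8, 2) = 28)%N // -signr_odd scale1r /pairB /= !E2 !B0l !addr0.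
    by rewrite !Ec om1r => ->; rewrite BC B_adjr // om1l.
  apply: (B_inj two0) => v; rewrite BZl /chirality -/c; apply: (mulfI two0).
  have := cb v; rewrite cjE // !Blin (BC v) => h.
  have -> : 2 * B c v = B c v + B c v by ring.
  by rewrite {1}h; ring.
by rewrite [LHS]surjective_pairing E2 Ec cE omZl om1l.
Qed.

(** The reversed product, composed with the product, contracts to the norms. *)
Lemma chirality_sq : chirality e ^+ 2 = \prod_(x <- e) q x.
Proof.
have := cliff_prod_revK e (1o, 0); rewrite cliff_prod_rev ?size_tuple; last exact: orthogonal_tupleP he.2.
rewrite (_ : 'C(8, 2) = 28)%N // -signr_odd scale1r !cliff_prod_basis => /(congr1 fst) /=.
move=> /(congr1 (fun x => B x 1o)); rewrite !BZl B1o // !mulr1 => <-.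
by rewrite expr2.
Qed.

Definition cliff_coef (l : seq O) : k := B (cliff_prod l (1o, 0)).1 1o.

(** Applying the reversal of the right half to the product over the whole basis
    cancels that half up to its norms; four factors make 6 pairs, so the reversal
    has sign [+]. *)
Lemma cliff_coef_self_dual (L := ltuple (p := 4) (r := 4) e)
    (R := rtuple (p := 4) (r := 4) e) :
  (\prod_(x <- R) q x) * cliff_coef L = chirality e * cliff_coef R.
Proof.
have EL : tval e = L ++ R by apply: (@cat_lrtuple 4 4).
have oR : orthogonal_seq R.
  have := orthogonal_tupleP he.2; rewrite /orthogonal_seq EL pairwise_cat.
  by case/and3P.
have := cliff_prod_revK R (cliff_prod L (1o, 0)).
rewrite -[cliff_prod R (cliff_prod L _)]cliff_prod_cat -EL cliff_prod_basis.
rewrite cliff_prod_rev // size_tuple (_ : 'C(4, 2) = 6)%N // -signr_odd scale1r.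
have -> : (chirality e *: 1o, 0) = chirality e *: (1o, 0 : O) by congr pair; rewrite scaler0.
rewrite (lmapZ (@cliff_prod_lin R)) => /(congr1 (fun z => B z.1 1o)) /=.
by rewrite !BZl => ->.
Qed.

End SelfDual.
End Clifford.

(** * The triple product and its 4-form *)

Section Psi.
Variables (k : fieldType) (O : octonionAlgebra k).
Hypothesis two0 : 2 != 0 :> k.

Local Notation B := (@octB k O).
Local Notation q := (@oct_norm k O).
Local Notation cj := (@oconj k O).
Local Notation "x '**' y" := (@oct_mul k O x y) (at level 40, left associativity).
Local Notation "1o" := (@oct_one k O).
Implicit Types (u v w x y z : O) (a b c : k).

Lemma cj_mul x y : cj (x ** y) = cj y ** cj x.
Proof.
apply: (B_inj two0) => z.
by rewrite B_cjl // B_adjl // -B_adjr // B_adjl // BC.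
Qed.

(** [so_act u v] is the moment map of the full orthogonal Lie algebra of [B]. *)
Definition so_act u v w := B u w *: v - B v w *: u.
(** The covariant [psi], see [psi3_mu]; on pairwise orthogonal vectors it is the
    triple product of [psi3_orth]. *)
Definition psi3 u v w := B u v *: w + B u w *: v - B v w *: u - (v ** cj u) ** w.

Lemma mul_cj_polar u v : u ** cj v = (2 * B u v) *: 1o - v ** cj u.
Proof.
apply/eqP; rewrite eq_sym subr_eq; apply/eqP.
by have := cliffR two0 u v 1o; rewrite !om1l => <-.
Qed.

(** [v (conj u)] and [u (conj v)] add up to [2 B(u, v)], and the other terms of
    [psi3] are arranged to compensate exactly for this. *)
Lemma psi3_swap12 u v w : psi3 v u w = - psi3 u v w.
Proof.
rewrite /psi3 (mul_cj_polar u v); apply: (B_inj two0) => z.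
by rewrite !(omlin, om1l) !Blin (BC v u); ring.
Qed.

Lemma psi3_swap23 u v w : psi3 u w v = - psi3 u v w.
Proof.
rewrite /psi3; apply: (B_inj two0) => z.
have h : (w ** cj u) ** v = (2 * B u v) *: w - (w ** cj v) ** u.
  by rewrite -cliffR' // addrK.
have h2 : (v ** cj u) ** w = (2 * B u w) *: v - (v ** cj w) ** u.
  by rewrite -cliffR' // addrK.
by rewrite h h2 (mul_cj_polar v w) !(omlin, om1l) !Blin (BC w v); ring.
Qed.

Lemma psi3_cyc u v w : psi3 w u v = psi3 u v w.
Proof. by rewrite psi3_swap12 psi3_swap23 opprK. Qed.

Lemma psi3_diag u v : psi3 u u v = 0.
Proof. by apply: (eq_opp0 two0); rewrite -psi3_swap12. Qed.

Lemma psi3_linl v w : linear_map (fun u => psi3 u v w).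
Proof.
move=> a u1 u2; apply: (B_inj two0) => z.
by rewrite /psi3 cj_linear // !omlin !Blin; ring.
Qed.

Lemma psi3_linm u w : linear_map (fun v => psi3 u v w).
Proof.
by move=> a v v' /=; rewrite !(psi3_swap12 _ u w) psi3_linl // opprD scalerN.
Qed.

Lemma psi3_linr u v : linear_map (psi3 u v).
Proof.
by move=> a w w' /=; rewrite !(psi3_swap23 u _ v) psi3_linm opprD scalerN.
Qed.

Lemma psi3_diag23 u v : psi3 v u u = 0.
Proof. by rewrite psi3_cyc psi3_diag. Qed.

Lemma psi3_diag13 u v : psi3 u v u = 0.
Proof. by rewrite psi3_cyc psi3_diag23. Qed.

Lemma psi3_orth u v w : B u v = 0 -> B u w = 0 -> B v w = 0 ->
  psi3 u v w = (u ** cj v) ** w.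
Proof.
move=> h1 h2 h3; rewrite /psi3 h1 h2 h3 (mul_cj_polar u v) h1.
by apply: (B_inj two0) => z; rewrite !(omlin, om1l) !Blin; ring.
Qed.

Definition Phi u v w x := B (psi3 u v w) x.

(** Moving [w] across [B] turns the product into [B(v (conj u), x (conj w))], whose
    dependence on [w, x] is again governed by [mul_cj_polar]. *)
Lemma Phi_swap34 u v w x : Phi u v x w = - Phi u v w x.
Proof.
have E s t : B ((v ** cj u) ** s) t = B (v ** cj u) (t ** cj s).
  by rewrite B_adjr.
rewrite /Phi /psi3 !Blin !E (mul_cj_polar w x) !Blin.
have -> : B (v ** cj u) 1o = B u v by rewrite B_adjr // cjK // om1l BC.
by rewrite (BC w x); ring.
Qed.

Lemma Phi_swap12 u v w x : Phi v u w x = - Phi u v w x.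
Proof. by rewrite /Phi psi3_swap12 BNl. Qed.

Lemma Phi_swap23 u v w x : Phi u w v x = - Phi u v w x.
Proof. by rewrite /Phi psi3_swap23 BNl. Qed.

Lemma Phi_diag34 u v w : Phi u v w w = 0.
Proof. exact/(eq_opp0 two0 (V := k^o))/Phi_swap34. Qed.

Lemma Phi_diag24 u v w : Phi u v w v = 0.
Proof. by rewrite Phi_swap34 /Phi psi3_diag23 B0l oppr0. Qed.

Lemma Phi_diag14 u v w : Phi u v w u = 0.
Proof. by rewrite Phi_swap12 Phi_diag24 oppr0. Qed.

(** The link with the Clifford action: on orthogonal vectors [Phi] is the scalar
    coefficient of a product of four generators. *)
Lemma Phi_orth u v w x : orthogonal_seq [:: u; v; w; x] ->
  Phi u v w x = cliff_coef [:: u; v; w; x].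
Proof.
rewrite /orthogonal_seq /= !andbT => /and3P[/and3P[/eqP h1 /eqP h2 _] /andP[/eqP h3 _] _].
by rewrite /Phi psi3_orth // /cliff_coef /cliff_prod /cliff_gen /= om1l [RHS]B_adjr // om1l cjK.
Qed.

End Psi.

(** * The Lie algebra h and its moment map *)

Section LieH.
Variables (k : fieldType) (O : octonionAlgebra k).
Hypothesis two0 : 2 != 0 :> k.
Variables (C : falgType k) (iota : {linear oct_ImT O -> C}).
Variables (rho : {linear C -> 'End(O)}).
Hypothesis hrho : extends_left_mul iota rho.
Variables (e : 8.-tuple O).
Hypothesis he : orthogonal_basis e.

Local Notation B := (@octB k O).
Local Notation q := (@oct_norm k O).
Local Notation cj := (@oconj k O).
Local Notation "x '**' y" := (@oct_mul k O x y) (at level 40, left associativity).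
Local Notation "1o" := (@oct_one k O).
Local Notation h := (lie_h iota).
Local Notation act := (@hact k O C iota rho).
Local Notation hb := (@hB k O C iota rho).
Local Notation e_ i := (tnth e i).
Implicit Types (u v w x y z : O).

(** Locked for the same reason as [oconj]. *)
Definition impart x : O := locked (x - B x 1o *: 1o).

Lemma impartE x : impart x = x - B x 1o *: 1o.
Proof. by rewrite /impart -lock. Qed.

Lemma impart_lin : linear_map impart.
Proof.
by move=> a x y; apply: (B_inj two0) => z; rewrite !impartE !Blin; ring.
Qed.

Lemma B_impart1 x : B (impart x) 1o = 0.
Proof. by rewrite !impartE !Blin B1o // mulr1 subrr. Qed.

Lemma impart_id x : B x 1o = 0 -> impart x = x.
Proof. by rewrite !impartE => ->; rewrite scale0r subr0. Qed.

Lemma impartK x : impart (impart x) = impart x.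
Proof. exact/impart_id/B_impart1. Qed.

Lemma B_impart x y : B (impart x) y = B x (impart y).
Proof. by rewrite !impartE !Blin (BC 1o); ring. Qed.

Lemma cj_imag x : B x 1o = 0 -> cj x = - x.
Proof. by move=> h0; rewrite cjE // h0 mulr0 scale0r sub0r. Qed.

Lemma mem_imag x : B x 1o = 0 -> x \in oct_Im O.
Proof. by move=> h0; apply/mem_oct_Im; rewrite -cj_imag // /oconj -lock. Qed.

Lemma imag_orth1 (u : oct_ImT O) : B (vsval u) 1o = 0.
Proof.
have /mem_oct_Im := subvsP u; have -> : oct_conj (vsval u) = cj (vsval u).
  by rewrite /oconj -lock.
rewrite cjE // => /(congr1 (fun x => B x 1o)) /eqP.
rewrite !Blin B1o // -subr_eq0 mulr1 opprK subrK mulf_eq0 (negbTE two0).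
by move/eqP.
Qed.

(** Every octonion, through its imaginary part, defines a vector of the Clifford
    algebra; sums over a basis of [O] then replace sums over a basis of
    [Im(O)]. *)
Definition im_vec x : oct_ImT O := vsproj (oct_Im O) (impart x).

Lemma vsval_im_vec x : vsval (im_vec x) = impart x.
Proof. by rewrite vsprojK // mem_imag // B_impart1. Qed.

Lemma im_vec_vsval (u : oct_ImT O) : im_vec (vsval u) = u.
Proof. by rewrite /im_vec impart_id ?imag_orth1 // vsvalK. Qed.

Lemma im_vec_lin : linear_map im_vec.
Proof. by move=> a x y; rewrite /im_vec impart_lin linearP. Qed.

Definition cliff_comm x y : C :=
  iota (im_vec x) * iota (im_vec y) - iota (im_vec y) * iota (im_vec x).

Lemma cliff_comm_linl y : linear_map (cliff_comm^~ y).
Proof.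
move=> a x x'; rewrite /cliff_comm im_vec_lin !linearP mulrDl mulrDr -scalerAl -scalerAr.
by rewrite opprD addrACA -scalerBr.
Qed.

Lemma cliff_commC x y : cliff_comm y x = - cliff_comm x y. Proof. by rewrite opprB. Qed.

Definition h_comm x y : h := vsproj (commutator_space iota) (cliff_comm x y).

Lemma vsval_h_comm x y : vsval (h_comm x y) = cliff_comm x y.
Proof. by rewrite vsprojK // memv_commutator_space. Qed.

Lemma h_commC x y : h_comm y x = - h_comm x y.
Proof. by rewrite /h_comm cliff_commC linearN. Qed.

Lemma h_comm_linl y : linear_map (h_comm^~ y).
Proof. by move=> a x x'; rewrite /h_comm cliff_comm_linl linearP. Qed.

Lemma h_comm_linr x : linear_map (h_comm x).
Proof.
by move=> a y y'; rewrite !(h_commC _ x) h_comm_linl opprD scalerN.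
Qed.

Lemma h_comm_impart x y : h_comm (impart x) (impart y) = h_comm x y.
Proof. by rewrite /h_comm /cliff_comm /im_vec !impartK. Qed.

(** The kernel of [f - g] contains the commutators, hence all of [h]. *)
Lemma h_ext (V : vectType k) (f g : h -> V) : linear_map f -> linear_map g ->
  (forall x y, f (h_comm x y) = g (h_comm x y)) -> f =1 g.
Proof.
move=> lf lg fg t.
pose F (s : C) := f (vsproj (commutator_space iota) s) - g (vsproj _ s).
have lF : linear F.
  by move=> a s s'; rewrite /F linearP lf lg scalerBr opprD addrACA.
pose L := GRing.isLinear.Build _ _ _ _ _ lF.
pose F' : {linear C -> V} := HB.pack F L.
have FE s : s \in lker (linfun F') -> F s = 0.
  by rewrite memv_ker lfunE => /eqP.
have sub : (commutator_space iota <= lker (linfun F'))%VS.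
  apply: commutator_space_min => u v; rewrite memv_ker lfunE /=.
  rewrite -[u]im_vec_vsval -[v]im_vec_vsval -/(cliff_comm _ _) -/(h_comm _ _) /F.
  by rewrite -/(h_comm _ _) fg subrr.
have := FE (vsval t) (subvP sub _ (subvsP t)).
by rewrite /F vsvalK => /eqP; rewrite subr_eq0 => /eqP.
Qed.

Lemma act_linl w : linear_map (act^~ w).
Proof.
by move=> a x y; rewrite /hact !linearP /= !lfunE /= !lfunE.
Qed.

Lemma act_linr t : linear_map (act t).
Proof. by move=> a x y; rewrite /hact linearP. Qed.

Lemma act_h_comm x y w : act (h_comm x y) w = x ** (y ** w) - y ** (x ** w).
Proof.
have [_ rM rI] := hrho.
rewrite /hact vsval_h_comm /cliff_comm linearB /= !rM lfunE /= lfunE /= !lfunE /= !rI.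
rewrite lfunE /= !rI !vsval_im_vec !impartE; apply: (B_inj two0) => z.
by rewrite !(omlin, om1l) !Blin; ring.
Qed.

Lemma hBE s t : hb s t = - (3 / 8) * otrace e (fun w => act s (act t w)).
Proof.
rewrite /hB (lfun_traceE two0 he); congr (_ * _); apply: eq_otrace => w.
by rewrite lfunE.
Qed.

Lemma hBC s t : hb s t = hb t s.
Proof. by rewrite !hBE (otraceC two0 he (act_linr s) (act_linr t)). Qed.

Lemma hB_linl t : linear_map (V := k^o) (hb^~ t).
Proof.
move=> a s s'; rewrite !hBE.
rewrite (eq_otrace e (g := fun w => a *: act s (act t w) + act s' (act t w))).
  by rewrite otraceD // otraceZ //= -[a *: (_ : k^o)]/(a * _); ring.
by move=> w; rewrite act_linl.
Qed.

Lemma hB_linr t : linear_map (V := k^o) (hb t).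
Proof. by move=> a s s'; rewrite !(hBC t) hB_linl. Qed.

Lemma eight0 : 8 != 0 :> k.
Proof. by rewrite (_ : 8 = 2 ^+ 3 :> k) ?expf_neq0 //; ring. Qed.

(** On imaginary octonions conjugation is a sign, so [otrace4] gives the trace of
    each of the four products in the expansion of the two commutators; the
    factor 12 is [4 * 8 * 3 / 8]. *)
Lemma hB_h_comm_im (x y z w : O) :
  B x 1o = 0 -> B y 1o = 0 -> B z 1o = 0 -> B w 1o = 0 ->
  hb (h_comm x y) (h_comm z w) = 12 * (B x z * B y w - B x w * B y z).
Proof.
move=> hx hy hz hw; have e0 := eight0; rewrite hBE.
pose T (a b c d : O) := otrace e (fun r : O => a ** (b ** (c ** (d ** r)))).
have E (a b c d : O) : B b 1o = 0 -> B d 1o = 0 -> T a b c d =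
    8 * (B a b * B c d - B a c * B b d + B a d * B b c).
  move=> hb1 hd1; rewrite -(otrace4 two0 he); apply: eq_otrace => r.
  by rewrite /mul4 (cj_imag hb1) (cj_imag hd1) !omNl !omNr opprK.
have -> : otrace e (fun r => act (h_comm x y) (act (h_comm z w) r)) =
    T x y z w + (-1) * T y x z w + (-1) * T x y w z + T y x w z.
  rewrite -!otraceZ // -!otraceD //; apply: eq_otrace => r.
  rewrite !act_h_comm !omDr !omNr; apply: (B_inj two0) => r'.
  by rewrite !Blin; ring.
by rewrite !E // (BC y x) (BC w z); field.
Qed.

Lemma hB_h_comm x y z w : hb (h_comm x y) (h_comm z w) =
  12 * (B (impart x) z * B (impart y) w - B (impart x) w * B (impart y) z).
Proof.
have K (a b : O) : B (impart a) (impart b) = B (impart a) b.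
  by rewrite -B_impart impartK.
by rewrite -(h_comm_impart x) -(h_comm_impart z) hB_h_comm_im ?B_impart1 // !K.
Qed.

Hypothesis three0 : 3 != 0 :> k.

Lemma n24_neq0 : 24 != 0 :> k.
Proof. by rewrite (_ : 24 = 8 * 3 :> k) ?mulf_neq0 ?eight0 //; ring. Qed.

(** The commutators of an orthogonal basis, although linearly dependent, reproduce
    the elements of [h] like an orthogonal basis.  By [h_ext] it is enough to test a commutator, where
    [hB_h_comm] turns the sum into two expansions in the basis. *)
Lemma h_expand t :
  \sum_i \sum_j (hb t (h_comm (e_ i) (e_ j)) / (q (e_ i) * q (e_ j))) *: h_comm (e_ i) (e_ j)
  = 24 *: t.
Proof.
pose f t : h := \sum_i \sum_j
  (hb t (h_comm (e_ i) (e_ j)) / (q (e_ i) * q (e_ j))) *: h_comm (e_ i) (e_ j).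
apply: (h_ext (f := f) (g := fun t => 24 *: t)) => [a s s'|a s s'|x y].
- rewrite /f scaler_sumr -big_split; apply: eq_bigr => i _ /=.
  rewrite scaler_sumr -big_split; apply: eq_bigr => j _ /=.
  rewrite hB_linl -[a *: (_ : k^o)]/(a * _) mulrDl scalerDl scalerA.
  by move: (hb s _) (hb s' _) => c c'; rewrite mulrA.
- by rewrite scalerDr !scalerA mulrC.
have E u v : \sum_i \sum_j (B u (e_ i) * B v (e_ j) / (q (e_ i) * q (e_ j)))
    *: h_comm (e_ i) (e_ j) = h_comm u v.
  rewrite -(expand_map two0 he u (h_comm_linl v)); apply: eq_bigr => i _.
  rewrite -(expand_map two0 he v (h_comm_linr (e_ i))) scaler_sumr.
  apply: eq_bigr => j _; rewrite scalerA; congr (_ *: _).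
  by field; rewrite !q_basis.
have -> : f (h_comm x y) = 12 *: h_comm (impart x) (impart y) -
    12 *: h_comm (impart y) (impart x).
  rewrite -(E (impart x)) -(E (impart y)) !scaler_sumr -sumrB.
  apply: eq_bigr => i _.
  rewrite !scaler_sumr -sumrB; apply: eq_bigr => j _.
  rewrite !scalerA -scalerBl hB_h_comm; congr (_ *: _).
  by field; rewrite !q_basis.
by rewrite (h_commC (impart x)) scalerN opprK -scalerDl h_comm_impart; congr (_ *: _); ring.
Qed.

Lemma hB_nondeg t : (forall s, hb t s = 0) -> t = 0.
Proof.
move=> h0; apply: (scalerI n24_neq0); rewrite scaler0 -h_expand.
by rewrite big1 // => i _; rewrite big1 // => j _; rewrite h0 mul0r scale0r.
Qed.

Lemma hB_inj s t : (forall r, hb s r = hb t r) -> s = t.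
Proof.
move=> E; apply/eqP; rewrite -subr_eq0; apply/eqP/hB_nondeg => r.
by rewrite (lmapB (hB_linl r)) E subrr.
Qed.

Section Moment.
Variable mu : 2.-tuple O -> h.
Hypothesis hmu : is_moment_map rho mu.
Local Notation m u v := (mu [tuple u; v]).

(** [h_expand] at [mu(u, v)], whose products with commutators are given by the
    defining property of the moment map. *)
Lemma mu_expand u v :
  \sum_i \sum_j (B (act (h_comm (e_ i) (e_ j)) u) v / (q (e_ i) * q (e_ j)))
     *: h_comm (e_ i) (e_ j) = 24 *: m u v.
Proof.
rewrite -h_expand; apply: eq_bigr => i _; apply: eq_bigr => j _.
by rewrite hBC hmu.2.
Qed.

Lemma contract_im u v w :
  \sum_i (B (impart (e_ i) ** u) v / q (e_ i)) *: (impart (e_ i) ** w) =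
  (v ** cj u) ** w - B u v *: w.
Proof.
have lf : linear_map (fun t => impart t ** w).
  by move=> a s t; rewrite impart_lin !omlin.
transitivity (impart (impart (v ** cj u)) ** w).
  rewrite -(expand_map two0 he (impart (v ** cj u)) lf).
  by apply: eq_bigr => i _; rewrite B_adjr // B_impart BC.
rewrite impartK !impartE B_adjr // cjK // om1l (BC v); apply: (B_inj two0) => z.
by rewrite !(omlin, om1l) !Blin; ring.
Qed.

Lemma imag_sq x w : B x 1o = 0 -> x ** (x ** w) = - q x *: w.
Proof.
move=> hx; have := om_cjl two0 x w; rewrite cj_imag // omNl => h0.
by rewrite scaleNr -h0 opprK.
Qed.

Lemma q_impart x : q (impart x) = q x - B 1o x * B 1o x.
Proof. by rewrite -!Bxx // !impartE !Blin B1o // (BC x 1o); ring. Qed.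

(** Imaginary parts of an orthogonal basis of [O] behave like an orthogonal basis
    of the 7-dimensional [Im(O)]. *)
Lemma contract_sq w :
  \sum_i (q (e_ i))^-1 *: (impart (e_ i) ** (impart (e_ i) ** w)) = (- 7) *: w.
Proof.
transitivity ((\sum_i - (1 - B 1o (e_ i) * B 1o (e_ i) / q (e_ i))) *: w).
  rewrite scaler_suml; apply: eq_bigr => i _.
  rewrite imag_sq ?B_impart1 // scalerA; congr (_ *: _).
  by rewrite q_impart; field; rewrite q_basis.
congr (_ *: _); rewrite sumrN sumrB sumr_const card_ord parseval // B1o //.
by ring.
Qed.

(** Paired with a fixed vector, the sum is a trace of four left multiplications
    conjugated by the octonion conjugation, so [otrace4] applies. *)
Lemma contract_mul u v w :
  \sum_i (q (e_ i))^-1 *: ((v ** cj (e_ i ** u)) ** (e_ i ** w)) =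
  8 *: (B u v *: w - B v w *: u + B u w *: v).
Proof.
apply: (B_inj two0) => z; rewrite B_suml.
have lL := @mul4_lin _ O w z v u.
transitivity (otrace e (fun t => cj (mul4 w z v u (cj t)))).
  apply: eq_bigr => i _; rewrite BZl mulrC; congr (_ / _).
  have -> : B ((v ** cj (e_ i ** u)) ** (e_ i ** w)) z =
            B (mul4 w z v u (cj (e_ i))) (cj (e_ i)).
    rewrite /mul4 (B_adjl two0 w) (B_adjl two0 (cj z)) cjK //.
    by rewrite B_adjr // !cj_mul.
  by rewrite B_cjl.
rewrite (otraceC two0 he (@cj_linear _ _ two0) (g := fun t => mul4 w z v u (cj t))).
  rewrite (eq_otrace e (g := mul4 w z v u)) => [|t]; last by rewrite cjK.
  by rewrite (otrace4 two0 he) !Blin (BC w u) (BC w v) (BC w z) (BC u v) (BC u z) (BC v z); ring.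
by move=> a s t; rewrite cj_linear // lL.
Qed.

Local Notation D i j x := (impart (e_ i) ** (impart (e_ j) ** x)).

Lemma imag_anticomm x y w : B x 1o = 0 -> B y 1o = 0 ->
  y ** (x ** w) = - (x ** (y ** w)) - (2 * B x y) *: w.
Proof.
move=> hx hy; have := cliffL two0 x y w.
rewrite (cj_imag hx) (cj_imag hy) !omNl => <-.
by rewrite opprD !opprK addKr.
Qed.

(** The coefficients and the commutators of [mu_expand] are both antisymmetric in
    [i, j], so the commutator applied to [w] may be replaced by twice a product;
    the Clifford relation does the same for the one in the coefficient, at the cost of the scalar evaluated by
    [contract_sq]. *)
Lemma act_mu_contract u v w : 24 *: act (m u v) w =
  4 *: (\sum_i \sum_j (B (D i j u) v / (q (e_ i) * q (e_ j))) *: D i j w)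
  - (28 * B u v) *: w.
Proof.
pose c i j := B (act (h_comm (e_ i) (e_ j)) u) v / (q (e_ i) * q (e_ j)).
have cC i j : c j i = - c i j.
  by rewrite /c h_commC (lmapN (act_linl u)) BNl mulNr [q (e_ j) * _]mulrC.
have actE i j x : act (h_comm (e_ i) (e_ j)) x = D i j x - D j i x.
  by rewrite -h_comm_impart act_h_comm.
have cE i j : c i j = 2 * (B (D i j u) v / (q (e_ i) * q (e_ j))) +
    2 * B u v * ((B (impart (e_ i)) (e_ j) / q (e_ j)) / q (e_ i)).
  rewrite /c actE (imag_anticomm u (B_impart1 (e_ i)) (B_impart1 (e_ j))).
  by rewrite -[B _ (impart (e_ j))]B_impart impartK !Blin; field; rewrite !q_basis.
have -> : 24 *: act (m u v) w = 2 *: \sum_i \sum_j c i j *: D i j w.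
  rewrite -(lmapZ (act_linl w)) -mu_expand (lmap_sum (act_linl w)).
  transitivity (\sum_i \sum_j c i j *: D i j w - \sum_i \sum_j c i j *: D j i w).
    rewrite -sumrB; apply: eq_bigr => i _; rewrite (lmap_sum (act_linl w)) -sumrB.
    by apply: eq_bigr => j _; rewrite (lmapZ (act_linl w)) -scalerBr -actE.
  rewrite [X in _ - X]exchange_big /= scaler_nat mulr2n; congr (_ + _).
  rewrite -sumrN; apply: eq_bigr => i _; rewrite -sumrN; apply: eq_bigr => j _.
  by rewrite cC scaleNr opprK.
have A2 : \sum_i \sum_j ((B (impart (e_ i)) (e_ j) / q (e_ j)) / q (e_ i)) *: D i j w
    = (- 7) *: w.
  rewrite -(contract_sq w); apply: eq_bigr => i _.
  have lf : linear_map (fun t => impart (e_ i) ** (impart t ** w)).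
    by move=> a s t; rewrite impart_lin !omlin.
  rewrite -[X in _ *: X](congr1 (fun t => impart (e_ i) ** (t ** w)) (impartK (e_ i))).
  rewrite -(expand_map two0 he _ lf) scaler_sumr; apply: eq_bigr => j _.
  by rewrite scalerA mulrC.
have -> : \sum_i \sum_j c i j *: D i j w =
    2 *: (\sum_i \sum_j (B (D i j u) v / (q (e_ i) * q (e_ j))) *: D i j w)
    + (2 * B u v) *: ((- 7) *: w).
  rewrite -A2 !scaler_sumr -big_split; apply: eq_bigr => i _ /=.
  rewrite !scaler_sumr -big_split; apply: eq_bigr => j _ /=.
  by rewrite cE !scalerA -scalerDl.
rewrite scalerDr !scalerA -scaleNr; congr (_ *: _ + _ *: _); ring.
Qed.

(** Sum over the outer factor with [contract_im], then over the inner one with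
    [contract_mul]; passing from imaginary parts to octonions produces the
    terms with [B(1, e_j)], which are expansions of 1. *)
Lemma act_mu u v w : act (m u v) w =
  (4 / 3) *: so_act u v w + (1 / 3) *: (B u v *: w - (v ** cj u) ** w).
Proof.
apply: (scalerI n24_neq0); rewrite act_mu_contract exchange_big /=.
have E1 j : \sum_i (B (D i j u) v / (q (e_ i) * q (e_ j))) *: D i j w =
    (q (e_ j))^-1 *: ((v ** cj (impart (e_ j) ** u)) ** (impart (e_ j) ** w)) -
    (B (impart (e_ j) ** u) v / q (e_ j)) *: (impart (e_ j) ** w).
  rewrite [X in _ - X *: _]mulrC -scalerA -scalerBr -contract_im scaler_sumr.
  apply: eq_bigr => i _; rewrite scalerA; congr (_ *: _).
  by field; rewrite !q_basis.
rewrite (eq_bigr _ (fun j _ => E1 j)) sumrB contract_im.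
have E2 j : (q (e_ j))^-1 *: ((v ** cj (impart (e_ j) ** u)) ** (impart (e_ j) ** w)) =
    (q (e_ j))^-1 *: ((v ** cj (e_ j ** u)) ** (e_ j ** w)) -
    (B 1o (e_ j) / q (e_ j)) *: ((v ** cj (e_ j ** u)) ** w) -
    (B 1o (e_ j) / q (e_ j)) *: ((v ** cj u) ** (e_ j ** w)) +
    (B 1o (e_ j) * B 1o (e_ j) / q (e_ j)) *: ((v ** cj u) ** w).
  rewrite !impartE !(omDl, omNl, omZl, om1l) -scaleN1r !(lmapD (cj_linear two0)).
  rewrite !(lmapZ (cj_linear two0)) (BC _ 1o); apply: (B_inj two0) => z.
  by rewrite !omlin !Blin; field; rewrite q_basis.
have lf1 : linear_map (fun t => (v ** cj (t ** u)) ** w).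
  by move=> a s t; rewrite !omlin cj_linear // !omlin.
have lf2 : linear_map (fun t => (v ** cj u) ** (t ** w)).
  by move=> a s t; rewrite !omlin.
rewrite (eq_bigr _ (fun j _ => E2 j)) !big_split /= !sumrN contract_mul.
rewrite (expand_map two0 he 1o lf1) (expand_map two0 he 1o lf2).
rewrite -scaler_suml parseval // B1o // !om1l /so_act.
by apply: (B_inj two0) => z; rewrite !Blin; field.
Qed.

Lemma act_mu_psi3 u v w : act (m u v) w = so_act u v w + (1 / 3) *: psi3 u v w.
Proof.
rewrite act_mu /so_act /psi3; apply: (B_inj two0) => z.
by rewrite !Blin; field.
Qed.

Lemma mu_linl v : linear_map (fun u => m u v).
Proof.
move=> a u u'; apply: hB_inj => t; rewrite !(hBC _ t) (hB_linr t) !hmu.2.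
by rewrite act_linr !Blin.
Qed.

Lemma mu_linr u : linear_map (fun v => m u v).
Proof.
move=> a v v'; apply: hB_inj => t; rewrite !(hBC _ t) (hB_linr t) !hmu.2.
by rewrite !Blin.
Qed.

Lemma muC u v : m v u = - m u v.
Proof.
have n01 : (ord0 : 'I_2) != ord_max by [].
rewrite -(alt_tperm hmu.1 [tuple u; v] n01); congr mu.
by apply: eq_from_tnth => -[[|[|//]] lt]; rewrite tnth_reorder permE.
Qed.

Lemma act_skew t u v : B (act t u) v = - B u (act t v).
Proof. by rewrite [in RHS]BC -!hmu.2 muC (lmapN (hB_linr t)). Qed.

(** Paired with [s], the sum is [- Tr(s t)], which is [8 / 3] times [hb s t] by
    definition of [hb]. *)
Lemma casimir_mu t :
  \sum_i (q (e_ i))^-1 *: m (e_ i) (act t (e_ i)) = (8 / 3) *: t.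
Proof.
apply: hB_inj => s; rewrite !(hBC _ s) (lmap_sum (hB_linr s)).
rewrite (lmapZ (hB_linr s)) [in RHS]hBE -[_ *: (_ : k^o)]/(_ * _) mulrA.
transitivity (- otrace e (fun w => act s (act t w))); last first.
  by have e0 := eight0; field; apply/andP.
rewrite /otrace -sumrN; apply: eq_bigr => i _.
rewrite (lmapZ (hB_linr s)) hmu.2 act_skew -[_ *: (_ : k^o)]/(_ * _) BC.
by rewrite mulrN mulrC.
Qed.

Lemma psi3_mu u v w :
  act (m u v) w + act (m w u) v + act (m v w) u = psi3 u v w.
Proof.
rewrite !act_mu_psi3 -(psi3_cyc two0 v w u) (psi3_cyc two0 u v w) /so_act.
apply: (B_inj two0) => z; rewrite !Blin.
by rewrite (BC w v) (BC w u) (BC v u); field.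
Qed.

Lemma cov_psiE (v : 3.-tuple O) : cov_psi rho mu v = psi3 v`_0 v`_1 v`_2.
Proof. by rewrite /cov_psi -psi3_mu. Qed.

(** [Phi] is alternating, so the four terms of [Q] are equal. *)
Lemma cov_QE (v : 4.-tuple O) :
  cov_Q rho mu v = - 4 * Phi v`_0 v`_1 v`_2 v`_3.
Proof.
rewrite /cov_Q !cov_psiE /=; move: v`_0 v`_1 v`_2 v`_3 => v0 v1 v2 v3.
rewrite ![B _ (psi3 _ _ _)]BC -!/(Phi _ _ _ _).
have -> : Phi v1 v2 v3 v0 = - Phi v0 v1 v2 v3.
  by rewrite Phi_swap34 // Phi_swap23 // Phi_swap12 //; ring.
have -> : Phi v3 v0 v1 v2 = - Phi v0 v1 v2 v3.
  by rewrite Phi_swap12 // Phi_swap23 // Phi_swap34 //; ring.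
have -> : Phi v2 v3 v0 v1 = Phi v0 v1 v2 v3.
  rewrite Phi_swap23 // Phi_swap12 // Phi_swap34 // Phi_swap23 //.
  by ring.
by ring.
Qed.

Section Equivariance.
Hypothesis cliffC : forall u : oct_ImT O, iota u * iota u = (- q (vsval u))%:A.

Lemma iota_anticomm (u v : oct_ImT O) :
  exists c : k, iota u * iota v = c%:A - iota v * iota u.
Proof.
exists (- q (vsval (u + v)) + q (vsval u) + q (vsval v)).
have := cliffC (u + v); rewrite linearD mulrDl !mulrDr !cliffC => E.
apply/eqP; rewrite eq_sym subr_eq !scalerDl -E !scaleNr; apply/eqP.
by rewrite -addrA [X in _ + X]addrC addrA addrA subrK addrC !addrA subrr add0r.
Qed.

(** Vectors of the Clifford algebra anticommute up to scalars, so moving a vector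
    across a product of two leaves a combination of these two. *)
Lemma bracket_iota (a b c : oct_ImT O) : exists d, 
  (iota a * iota b - iota b * iota a) * iota c -
  iota c * (iota a * iota b - iota b * iota a) = iota d.
Proof.
have [x Ex] := iota_anticomm b c; have [y Ey] := iota_anticomm a c.
have K (s t : oct_ImT O) (x1 y1 : k) : iota t * iota c = x1%:A - iota c * iota t ->
    iota s * iota c = y1%:A - iota c * iota s ->
    iota s * iota t * iota c - iota c * (iota s * iota t) = iota (x1 *: s - y1 *: t).
  move=> E1 E2; rewrite -(mulrA (iota s)) E1 mulrBr (mulrA (iota s) (iota c)) E2.
  rewrite mulrBl mulr_algr mulr_algl -(mulrA (iota c)).
  rewrite opprB [_ * _ - _]addrC addrA addrK.
  by rewrite linearB !linearZ.
exists ((x *: a - y *: b) - (y *: b - x *: a)).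
rewrite linearB /= -(K _ _ _ _ Ex Ey) -(K _ _ _ _ Ey Ex) mulrBl mulrBr.
by rewrite opprB opprD opprK !addrA addrAC [X in X + _ = _]addrAC.
Qed.

Lemma lieC_linear (x : C) : linear (fun y : C => x * y - y * x).
Proof.
move=> a y y'; rewrite mulrDr mulrDl -scalerAr -scalerAl opprD addrACA.
by rewrite -scalerBr.
Qed.

Lemma lie_ind (W : {vspace C}) (f : C -> C) : linear f ->
  (forall a b, f (iota a * iota b - iota b * iota a) \in W) ->
  forall t : h, f (vsval t) \in W.
Proof.
move=> lf hW t; pose L := GRing.isLinear.Build _ _ _ _ _ lf.
pose F : {linear C -> C} := HB.pack f L.
have : (commutator_space iota <= linfun F @^-1: W)%VS.
  by apply: commutator_space_min => a b; rewrite -memv_preim lfunE; apply: hW.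
by move/subvP/(_ _ (subvsP t)); rewrite -memv_preim lfunE.
Qed.

Lemma lie_iota (t : h) (c : oct_ImT O) :
  exists d, vsval t * iota c - iota c * vsval t = iota d.
Proof.
pose f (y : C) := - (iota c * y - y * iota c).
have lf : linear f.
  by move=> a y y'; rewrite /f lieC_linear opprD scalerN.
have : f (vsval t) \in limg (linfun iota).
  apply: lie_ind => // a b; have [d Ed] := bracket_iota a b c.
  by rewrite /f opprB Ed -[iota d]lfunE memv_img ?memvf.
by case/memv_imgP => d _; rewrite lfunE /f opprB; exists d.
Qed.

(** [t |-> [s, t]] is a derivation, and by [lie_iota] it maps vectors to vectors, so
    it maps commutators of vectors to sums of such commutators. *)
Lemma lie_closed (s t : h) :
  vsval s * vsval t - vsval t * vsval s \in commutator_space iota.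
Proof.
apply: (@lie_ind _ (fun y : C => vsval s * y - y * vsval s) _ _ t).
  exact: lieC_linear.
move=> a b; have [a' Ea] := lie_iota s a; have [b' Eb] := lie_iota s b.
have -> : vsval s * (iota a * iota b - iota b * iota a) -
    (iota a * iota b - iota b * iota a) * vsval s =
    (iota a' * iota b - iota b * iota a') + (iota a * iota b' - iota b' * iota a).
  have leibniz (x y z : C) :
      x * (y * z) - y * z * x = (x * y - y * x) * z + y * (x * z - z * x).
    by rewrite mulrBl mulrBr !mulrA addrA subrK.
  have dist (x y z : C) :
      x * (y - z) - (y - z) * x = (x * y - y * x) - (x * z - z * x).
    by rewrite mulrBr mulrBl !opprD addrACA.
  rewrite -Ea -Eb dist !leibniz; set A := _ - iota a * _; set A' := _ - iota b * _.
  by rewrite [A' * _ + _]addrC opprD addrACA.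
by rewrite rpredD // memv_commutator_space.
Qed.

Definition lie (s t : h) : h :=
  vsproj (commutator_space iota) (vsval s * vsval t - vsval t * vsval s).

Lemma act_lie s t w : act (lie s t) w = act s (act t w) - act t (act s w).
Proof.
have [_ rM _] := hrho.
rewrite /hact vsprojK ?lie_closed // linearB /= !rM lfunE /= lfunE /= !lfunE /=.
by rewrite lfunE.
Qed.

(** The invariance of trace forms. *)
Lemma hB_lie s t r : hb s (lie t r) = hb (lie s t) r.
Proof.
rewrite !hBE; congr (_ * _).
pose T (a b c : h) := otrace e (fun w => act a (act b (act c w))).
transitivity (T s t r + (-1) * T s r t).
  rewrite -otraceZ // -otraceD //; apply: eq_otrace => w.
  by rewrite act_lie (lmapB (act_linr s)) scaleN1r.
transitivity (T s t r + (-1) * T t s r).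
  congr (_ + _ * _); rewrite /T.
  rewrite (otraceC two0 he (f := fun w => act s (act r w)) _ (act_linr t)) //.
  by move=> a x y; rewrite !act_linr.
rewrite -otraceZ // -otraceD //; apply: eq_otrace => w.
by rewrite act_lie scaleN1r.
Qed.

(** By nondegeneracy, test against [s]: invariance of [hb] moves the bracket to
    [s], where the defining property of [mu] applies. *)
Lemma mu_equivariant t u v : lie t (m u v) = m (act t u) v + m u (act t v).
Proof.
apply: hB_inj => s; rewrite !(hBC _ s) (lmapD (hB_linr s)) hB_lie !hmu.2.
by rewrite act_lie !Blin (act_skew t (act s u)) opprK.
Qed.

End Equivariance.
End Moment.
End LieH.

(** Makes [mu] a function of two vectors, to which [linear_map] applies in each
    argument. *)
Definition mu2 (E F : Type) (mu : 2.-tuple E -> F) (u v : E) : F :=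
  mu [tuple u; v].

Section Mathews.
Variables (k : fieldType) (O : octonionAlgebra k).
Hypothesis two0 : 2 != 0 :> k.
Hypothesis three0 : 3 != 0 :> k.
Variables (C : falgType k) (iota : {linear oct_ImT O -> C}).
Variables (rho : {linear C -> 'End(O)}).
Hypothesis hrho : extends_left_mul iota rho.
Variables (e : 8.-tuple O).
Hypothesis he : orthogonal_basis e.
Variable mu : 2.-tuple O -> lie_h iota.
Hypothesis hmu : is_moment_map rho mu.
Hypothesis cliffC :
  forall u : oct_ImT O, iota u * iota u = (- oct_norm (vsval u))%:A.

Local Notation B := (@octB k O).
Local Notation h := (lie_h iota).
Local Notation act := (@hact k O C iota rho).
Local Notation m := (mu2 mu).

Let alinl := @act_linl k O C iota rho.
Let alinr := @act_linr k O C iota rho.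
Let mlinl v : linear_map (fun u => m u v) := mu_linl two0 hrho he three0 hmu v.
Let mlinr u : linear_map (m u) := mu_linr two0 hrho he three0 hmu u.
Let mC u v : m v u = - m u v := muC hmu u v.
Let psi_mu u v w : act (m u v) w + act (m w u) v + act (m v w) u = psi3 u v w :=
  psi3_mu two0 hrho he three0 hmu u v w.
Let equiv t u v : lie t (m u v) = m (act t u) v + m u (act t v) :=
  mu_equivariant two0 hrho he three0 hmu cliffC t u v.
Let act_psi u v w : act (m u v) w = so_act u v w + (1 / 3) *: psi3 u v w :=
  act_mu_psi3 two0 hrho he three0 hmu u v w.

Lemma lieC (s t : h) : lie t s = - lie s t.
Proof. by rewrite /lie -linearN opprB. Qed.

Section Jacobi.
Variables (n : nat) (V : lmodType k).
Variables (i0 i1 i2 i3 : 'I_n).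
Hypothesis ui : uniq [:: i0; i1; i2; i3].
Variable K : n.-tuple O -> h -> V.
Hypothesis Klin : forall w, linear_map (K w).
Hypothesis Kinv : forall w i j, i \in [:: i0; i1; i2; i3] ->
  j \in [:: i0; i1; i2; i3] -> K (reorder w (tperm i j)) =1 K w.

(** Write [i] for the argument at position [i].  Exchanging [(0, 1)] with [(2, 3)]
    is even and negates the bracket of [mu(0, 1)] and [mu(2, 3)], so this bracket
    antisymmetrises to zero.  By
    equivariance it also antisymmetrises to twice [mu(mu(0, 1)(2), 3)], and [psi(0, 1, 2)]
    is the sum of the three rotations of [mu(0, 1)(2)].  The context [K], in
    which the other arguments may occur, must be insensitive to exchanging the
    four positions involved. *)
Lemma alt_sum_jacobi v :
  alt_sum (fun w => K w (m (psi3 (tnth w i0) (tnth w i1) (tnth w i2)) (tnth w i3))) v = 0.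
Proof.
move: ui; rewrite /= !inE !negb_or !andbT.
case/and3P=> /and3P[n01 n02 n03] /andP[n12 n13] n23.
have ns := (negbTE n01, negbTE n02, negbTE n03, negbTE n12, negbTE n13,
  negbTE n23).
have ns' : ((i1 == i0) = false) * ((i2 == i0) = false) * ((i3 == i0) = false) *
  ((i2 == i1) = false) * ((i3 == i1) = false) * ((i3 == i2) = false).
  by do !split; apply/negbTE; rewrite eq_sym.
have inv i j w x : i \in [:: i0; i1; i2; i3] -> j \in [:: i0; i1; i2; i3] ->
    K (reorder w (tperm i j)) x = K w x by move=> *; apply: Kinv.
have I : (i0 \in [:: i0; i1; i2; i3]) * (i1 \in [:: i0; i1; i2; i3]) *
   (i2 \in [:: i0; i1; i2; i3]) * (i3 \in [:: i0; i1; i2; i3]).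
  by rewrite !inE !eqxx !orbT.
have comp i j (w : n.-tuple O) l : tnth (reorder w (tperm i j)) l =
    tnth w (if l == i then j else if l == j then i else l).
  by rewrite tnth_reorder permE.
have swap (T T' : n.-tuple O -> V) i j : i != j ->
    (forall w, T' w = T (reorder w (tperm i j))) -> alt_sum T' v = - alt_sum T v.
  by move=> nij hT; apply: (alt_sum_tperm (i := i) (j := j)).
pose P w := K w (m (act (m (tnth w i0) (tnth w i1)) (tnth w i2)) (tnth w i3)).
pose P1 w := K w (m (act (m (tnth w i2) (tnth w i0)) (tnth w i1)) (tnth w i3)).
pose P2 w := K w (m (act (m (tnth w i1) (tnth w i2)) (tnth w i0)) (tnth w i3)).
pose P3 w := K w (m (act (m (tnth w i0) (tnth w i2)) (tnth w i1)) (tnth w i3)).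
pose P4 w := K w (m (tnth w i2) (act (m (tnth w i0) (tnth w i1)) (tnth w i3))).
pose L w := K w (lie (m (tnth w i0) (tnth w i1)) (m (tnth w i2) (tnth w i3))).
pose L1 w := K w (lie (m (tnth w i2) (tnth w i1)) (m (tnth w i0) (tnth w i3))).
have EP3 : alt_sum P3 v = - alt_sum P v.
  by apply: (swap _ _ i1 i2) => // w; rewrite /P inv ?I // !comp !(ns, ns', eqxx).
have EP1 : alt_sum P1 v = - alt_sum P3 v.
  by apply: (swap _ _ i0 i2) => // w; rewrite /P3 inv ?I // !comp !(ns, ns', eqxx).
have EP2 : alt_sum P2 v = - alt_sum P3 v.
  by apply: (swap _ _ i0 i1) => // w; rewrite /P3 inv ?I // !comp !(ns, ns', eqxx).
have EP4 : alt_sum P4 v = alt_sum P v.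
  apply: oppr_inj; rewrite -alt_sumN; apply: (swap _ _ i2 i3) => // w.
  rewrite /P inv ?I // !comp !(ns, ns', eqxx) /P4.
  by rewrite (mC _ (tnth w i2)) (lmapN (Klin w)) opprK.
have EL : alt_sum L v = alt_sum P v + alt_sum P4 v.
  rewrite -alt_sumD; apply: eq_alt_sum => w.
  by rewrite /L equiv (lmapD (Klin w)).
have EL0 : alt_sum L v = 0.
  have EL1 : alt_sum L1 v = - alt_sum L v.
    apply: (swap _ _ i0 i2) => // w.
    by rewrite /L inv ?I // !comp !(ns, ns', eqxx).
  have : alt_sum (fun w => - L w) v = - alt_sum L1 v.
    apply: (swap _ _ i1 i3) => // w.
    by rewrite /L1 inv ?I // !comp !(ns, ns', eqxx) lieC (lmapN (Klin w)).
  by rewrite alt_sumN EL1 opprK => E; apply: (eq_opp0 two0); rewrite E.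
have P0 : alt_sum P v = 0.
  apply: (scalerI two0); rewrite scaler0 -EL0 EL EP4.
  by rewrite scaler_nat mulr2n.
transitivity (alt_sum P v + alt_sum P1 v + alt_sum P2 v).
  rewrite -!alt_sumD; apply: eq_alt_sum => w.
  by rewrite -psi_mu !(lmapD (mlinl _)) !(lmapD (Klin w)).
by rewrite EP1 EP2 EP3 P0 !oppr0 !addr0.
Qed.

End Jacobi.
Section MuPsi.
Variables (n : nat) (V : lmodType k).
Variables (i0 i1 i2 i3 i4 : 'I_n).
Hypothesis ui : uniq [:: i0; i1; i2; i3; i4].
Variable K : n.-tuple O -> O -> V.
Hypothesis Klin : forall w, linear_map (K w).
Hypothesis Kinv : forall w i j, i \in [:: i0; i1; i2; i3; i4] ->
  j \in [:: i0; i1; i2; i3; i4] -> K (reorder w (tperm i j)) =1 K w.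

(** Let [p = psi(0, 1, 2)] and let [G] be the antisymmetrisation of [B(p, 3) 4].
    The formula for [mu] through [psi] expands [mu(3, 4)(p)] into two terms that
    antisymmetrise to [G], and [psi(3, 4, p) / 3].  The same formula for
    [mu(p, 3)(4)], which antisymmetrises to 0 by [alt_sum_jacobi], shows that
    [psi(p, 3, 4)] antisymmetrises to [3 G].  The total is [3 G].  The context
    [K] serves to reuse the computation inside [mu]. *)
Lemma alt_sum_mu_psi v :
  alt_sum (fun w => K w (act (m (tnth w i3) (tnth w i4))
                       (psi3 (tnth w i0) (tnth w i1) (tnth w i2)))) v =
  3 *: alt_sum (fun w => Phi (tnth w i0) (tnth w i1) (tnth w i2) (tnth w i3)
                   *: K w (tnth w i4)) v.
Proof.
move: (ui); rewrite /= !inE !negb_or !andbT.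
case/and4P=> /and4P[n01 n02 n03 n04] /and3P[n12 n13 n14] /andP[n23 n24] n34.
have ns := (negbTE n01, negbTE n02, negbTE n03, negbTE n04, negbTE n12,
  negbTE n13, negbTE n14, negbTE n23, negbTE n24, negbTE n34).
have comp i j (w : n.-tuple O) l : tnth (reorder w (tperm i j)) l =
    tnth w (if l == i then j else if l == j then i else l).
  by rewrite tnth_reorder permE.
have n43 : (i4 == i3) = false by rewrite eq_sym (negbTE n34).
have inv34 w x : K (reorder w (tperm i3 i4)) x = K w x.
  by apply: Kinv; rewrite !inE eqxx !orbT.
have swap34 (T T' : n.-tuple O -> V) :
    (forall w, T' w = T (reorder w (tperm i3 i4))) -> alt_sum T' v = - alt_sum T v.
  by move=> hT; apply: (alt_sum_tperm (i := i3) (j := i4)).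
pose p (w : n.-tuple O) := psi3 (tnth w i0) (tnth w i1) (tnth w i2).
pose G w := B (p w) (tnth w i3) *: K w (tnth w i4).
pose G' w := B (p w) (tnth w i4) *: K w (tnth w i3).
pose R w := K w (psi3 (p w) (tnth w i3) (tnth w i4)).
pose S (w : n.-tuple O) := B (tnth w i3) (tnth w i4) *: K w (p w).
have Kact w a b c : K w (act (m a b) c) =
    B a c *: K w b - B b c *: K w a + 3^-1 *: K w (psi3 a b c).
  rewrite act_psi /so_act (lmapD (Klin w)) (lmapB (Klin w)) !(lmapZ (Klin w)).
  by rewrite mul1r.
have swp (w : n.-tuple O) : p (reorder w (tperm i3 i4)) = p w.
  by rewrite /p !comp !(ns, eqxx).
have EG' : alt_sum G' v = - alt_sum G v.
  by apply: swap34 => w; rewrite /G inv34 swp !comp !(ns, n43, eqxx).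
have ES : alt_sum S v = 0.
  apply: (eq_opp0 two0); apply: swap34 => w.
  by rewrite /S inv34 swp !comp !(ns, n43, eqxx) BC.
have ER : alt_sum R v = 3 *: alt_sum G v.
  have J : alt_sum (fun w => K w (act (m (p w) (tnth w i3)) (tnth w i4))) v = 0.
    apply: (@alt_sum_jacobi n V i0 i1 i2 i3 _ (fun w t => K w (act t (tnth w i4)))).
    - by rewrite /= !inE !negb_or n01 n02 n03 n12 n13 n23.
    - by move=> w a s t; rewrite alinl Klin.
    - move=> w i j hi hj t /=.
      have sub l : l \in [:: i0; i1; i2; i3] -> l \in [:: i0; i1; i2; i3; i4].
        by rewrite !inE => /or4P[]->; rewrite ?orbT.
      rewrite Kinv ?sub // comp; congr (K w (act t (tnth w _))).
      have sep l : l \in [:: i0; i1; i2; i3] -> (i4 == l) = false.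
        by rewrite !inE => /or4P[]/eqP->; apply/negbTE; rewrite eq_sym.
      by rewrite !sep.
  have E3 : 3^-1 * 3 = 1 :> k by rewrite mulVf.
  have : alt_sum G' v + - alt_sum S v + 3^-1 *: alt_sum R v = 0.
    rewrite -J -alt_sumN -alt_sumZ -!alt_sumD; apply: eq_alt_sum => w.
    by rewrite Kact.
  rewrite EG' ES oppr0 addr0 => /eqP; rewrite addrC subr_eq0 => /eqP <-.
  by rewrite scalerA mulfV // scale1r.
transitivity (alt_sum G v + - alt_sum G' v + 3^-1 *: alt_sum R v).
  rewrite -alt_sumN -alt_sumZ -!alt_sumD; apply: eq_alt_sum => w.
  rewrite Kact -/(p w) /R (psi3_cyc two0 (tnth w i3) (tnth w i4) (p w)).
  by rewrite !(BC _ (p w)).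
rewrite EG' opprK ER scalerA mulVf // scale1r.
by rewrite (_ : 3 = 1 + 1 + 1 :> k) ?scalerDl ?scale1r //; ring.
Qed.

End MuPsi.

Lemma mu_nth (t : 2.-tuple O) : mu t = m t`_0 t`_1.
Proof. by congr mu; apply: eq_from_tnth => -[[|[|//]] lt]; rewrite !(tnth_nth 0). Qed.

Let psiE := cov_psiE two0 hrho he three0 hmu.
Let QE := cov_QE two0 hrho he three0 hmu.

Lemma is_alt_psi : is_alt (cov_psi rho mu).
Proof.
split=> [v i a x y|v i j nij].
  rewrite !psiE !nth_tset //.
  case: i => [[|[|[|//]]] li] /=; first exact: psi3_linl.
    exact: psi3_linm.
  exact: psi3_linr.
rewrite !(tnth_nth 0) psiE.
case: i j nij => [[|[|[|//]]] li] [[|[|[|//]]] lj] //= _ E; rewrite E;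
  by rewrite ?psi3_diag ?psi3_diag13 ?psi3_diag23.
Qed.

Lemma is_alt_Q : is_alt (cov_Q rho mu).
Proof.
split=> [v i a x y|v i j nij].
  rewrite !QE !nth_tset // /Phi.
  have D : forall r s t : k, r = a * s + t -> - 4 * r = a *: (- 4 * s : k^o) + - 4 * t.
    by move=> r s t ->; rewrite -[a *: (_ : k^o)]/(a * _); ring.
  apply: D; case: i => [[|[|[|[|//]]]] li] /=.
  - by rewrite psi3_linl // Bl.
  - by rewrite psi3_linm // Bl.
  - by rewrite psi3_linr // Bl.
  - by rewrite BDr BZr.
rewrite !(tnth_nth 0) QE.
case: i j nij => [[|[|[|[|//]]]] li] [[|[|[|[|//]]]] lj] //= _ E; rewrite E;
  rewrite ?Phi_diag34 ?Phi_diag24 ?Phi_diag14 ?mulr0 // /Phi;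
  by rewrite ?psi3_diag ?psi3_diag13 ?psi3_diag23 // B0l mulr0.
Qed.

Lemma is_alt_id : is_alt (@alt_id O).
Proof.
have E (v : 1.-tuple O) : alt_id v = v`_0 by rewrite /alt_id /thead (tnth_nth 0).
split=> [v i a x y|v i j]; last by rewrite !ord1 eqxx.
by rewrite !E !nth_tset // !ord1.
Qed.

Lemma two3_neq0 i j : (2 ^ i * 3 ^ j)%:R != 0 :> k.
Proof. by rewrite natrM !natrX mulf_neq0 // expf_neq0. Qed.

Lemma mathews_mu_psi v :
  wedge act mu (cov_psi rho mu) v =
  (- (3 / 2)) *: wedgeZ (cov_Q rho mu) (@alt_id O) v.
Proof.
(* [12 = 2! 3!] and [24 = 4! 1!] *)
have n12 : 12 != 0 :> k := two3_neq0 2 1.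
have n24 : 24 != 0 :> k := two3_neq0 3 1.
pose X := alt_sum (fun w : 5.-tuple O => Phi w`_0 w`_1 w`_2 w`_3 *: w`_4) v.
have EW : 12 *: wedge act mu (cov_psi rho mu) v = 3 *: X.
  have h1 a x y z : act (a *: x + y) z = a *: act x z + act y z := alinl z a x y.
  have h2 a x y z : act z (a *: x + y) = a *: act z x + act z y := alinr z a x y.
  have := @wedge_alt_sum _ _ _ _ _ 2 3 act h1 h2 _ _ hmu.1 is_alt_psi v.
  move=> ->.
  pose o i (lt : (i < 5)%N) := Ordinal lt.
  pose o0 := o 0 isT; pose o1 := o 1 isT; pose o2 := o 2 isT; pose o3 := o 3 isT;
  pose o4 := o 4 isT.
  transitivity (3 *: alt_sum (fun w => Phi (tnth w o2) (tnth w o3) (tnth w o4)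
                   (tnth w o0) *: tnth w o1) v).
    rewrite -(@alt_sum_mu_psi 5 O o2 o3 o4 o0 o1 isT (fun _ => id)) //.
    apply: eq_alt_sum => w; rewrite mu_nth psiE !nth_ltuple // !nth_rtuple.
    by rewrite !(tnth_nth 0).
  congr (_ *: _); rewrite -[RHS]opprK.
  pose T a b c d i := alt_sum (fun w : 5.-tuple O => Phi (tnth w a) (tnth w b)
    (tnth w c) (tnth w d) *: tnth w i) v.
  have comp i j (w : 5.-tuple O) l : tnth (reorder w (tperm i j)) l =
    tnth w (if l == i then j else if l == j then i else l).
    by rewrite tnth_reorder permE.
  transitivity (- T o0 o2 o3 o4 o1).
    rewrite /T -alt_sumN; apply: eq_alt_sum => w.
    by rewrite Phi_swap34 // Phi_swap23 // Phi_swap12 // !scaleNr !opprK.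
  congr (- _); transitivity (- T o0 o1 o3 o4 o2).
    by apply: (alt_sum_tperm (i := o1) (j := o2)) => // w; rewrite !comp.
  congr (- _); transitivity (- T o0 o1 o2 o4 o3).
    by apply: (alt_sum_tperm (i := o2) (j := o3)) => // w; rewrite !comp.
  rewrite -[RHS]opprK; congr (- _).
  apply: (alt_sum_tperm (i := o3) (j := o4)) => // w.
  have nt i (li : (i < 5)%N) (t : 5.-tuple O) : t`_i = tnth t (Ordinal li).
    by rewrite (tnth_nth 0).
  by rewrite (nt 0) (nt 1) (nt 2) (nt 3) (nt 4) !comp.
have EQ : 24 *: wedgeZ (cov_Q rho mu) (@alt_id O) v = - 4 *: X.
  have h1 a x y z : (a *: x + y : k^o) *: z = a *: (x *: z) + y *: z :> O.
    by rewrite scalerDl scalerA.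
  have h2 a x y (z : k^o) : z *: (a *: x + y) = a *: (z *: x) + z *: y :> O.
    by rewrite scalerDr !scalerA mulrC.
  have := @wedge_alt_sum _ _ _ _ _ 4 1 (fun (a : k^o) x => a *: x) h1 h2 _ _
            is_alt_Q is_alt_id v.
  move=> ->; rewrite /X -alt_sumZ; apply: eq_alt_sum => w.
  rewrite QE !nth_ltuple // /alt_id /thead (tnth_nth 0) nth_rtuple.
  by rewrite scalerA.
apply: (scalerI n24); transitivity (6 *: X).
  rewrite (_ : 24 = 2 * 12 :> k); last by ring.
  by rewrite -scalerA EW scalerA; congr (_ *: _); ring.
rewrite scalerA mulrC -scalerA EQ scalerA; congr (_ *: _); by field.
Qed.

Lemma lie_linr (s : h) : linear_map (lie s).
Proof.
move=> a t t'; rewrite /lie -linearP; congr (vsproj _ _).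
by rewrite linearP lieC_linear.
Qed.

(** Expand the second [psi]: its three terms have the same antisymmetrisation.  In
    [mu(p, mu(3, 4)(5))] equivariance moves [mu(3, 4)] to [p], since the bracket
    of [mu(3, 4)] with [mu(p, 5)] antisymmetrises to 0 by [alt_sum_jacobi];
    [alt_sum_mu_psi] then gives the factor 3, and the sign comes from the move. *)
Lemma alt_sum_mu_psi_psi (v : 6.-tuple O) :
  alt_sum (fun w : 6.-tuple O =>
    m (psi3 w`_0 w`_1 w`_2) (psi3 w`_3 w`_4 w`_5)) v =
  (- 9) *: alt_sum (fun w : 6.-tuple O =>
     Phi w`_0 w`_1 w`_2 w`_3 *: m w`_4 w`_5) v.
Proof.
pose o i (lt : (i < 6)%N) := Ordinal lt.
pose o0 := o 0 isT; pose o1 := o 1 isT; pose o2 := o 2 isT; pose o3 := o 3 isT;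
pose o4 := o 4 isT; pose o5 := o 5 isT.
have comp i j (w : 6.-tuple O) l : tnth (reorder w (tperm i j)) l =
    tnth w (if l == i then j else if l == j then i else l).
  by rewrite tnth_reorder permE.
have nt i (li : (i < 6)%N) (t : 6.-tuple O) : t`_i = tnth t (Ordinal li).
  by rewrite (tnth_nth 0).
pose p (w : 6.-tuple O) := psi3 (tnth w o0) (tnth w o1) (tnth w o2).
pose N a b c := alt_sum (fun w => m (p w) (act (m (tnth w a) (tnth w b)) (tnth w c))) v.
have N345 : N o3 o5 o4 = - N o3 o4 o5.
  by apply: (alt_sum_tperm (i := o4) (j := o5)) => // w; rewrite /p !comp.
have N534 : N o5 o3 o4 = - N o3 o5 o4.
  by apply: (alt_sum_tperm (i := o3) (j := o5)) => // w; rewrite /p !comp.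
have N453 : N o4 o5 o3 = - N o3 o5 o4.
  by apply: (alt_sum_tperm (i := o3) (j := o4)) => // w; rewrite /p !comp.
transitivity (N o3 o4 o5 + N o5 o3 o4 + N o4 o5 o3).
  rewrite -!alt_sumD; apply: eq_alt_sum => w.
  by rewrite -(psi_mu w`_3) !(lmapD (mlinr _)) (nt 0 isT) (nt 1 isT) (nt 2 isT) (nt 3 isT) (nt 4 isT) (nt 5 isT).
rewrite N534 N453 N345 !opprK.
have J : alt_sum (fun w => lie (m (tnth w o3) (tnth w o4)) (m (p w) (tnth w o5))) v = 0.
  apply: (@alt_sum_jacobi 6 h o0 o1 o2 o5 isT (fun w t => lie (m (tnth w o3) (tnth w o4)) t)).
    by move=> w; apply: lie_linr.
  by move=> w i j; rewrite !inE => /or4P[]/eqP-> /or4P[]/eqP-> t; rewrite !comp.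
have M : alt_sum (fun w => m (act (m (tnth w o3) (tnth w o4)) (p w)) (tnth w o5)) v =
   3 *: alt_sum (fun w => Phi (tnth w o0) (tnth w o1) (tnth w o2) (tnth w o3)
                   *: m (tnth w o4) (tnth w o5)) v.
  apply: (@alt_sum_mu_psi 6 h o0 o1 o2 o3 o4 isT (fun w x => m x (tnth w o5))).
    by move=> w; apply: mlinl.
  move=> w i j; rewrite !inE.
  by case/or4P=> [||| /orP[]]/eqP-> /or4P[||| /orP[]]/eqP-> t; rewrite !comp.
have -> : N o3 o4 o5 = - (3 *: alt_sum (fun w => Phi (tnth w o0) (tnth w o1)
    (tnth w o2) (tnth w o3) *: m (tnth w o4) (tnth w o5)) v).
  rewrite -M -[RHS]add0r -J -alt_sumN -alt_sumD; apply: eq_alt_sum => w.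
  by rewrite equiv [X in X - _]addrC addrK.
rewrite -scaleNr -!scalerDl; congr (_ *: _); first by ring.
by apply: eq_alt_sum => w; rewrite (nt 0 isT) (nt 1 isT) (nt 2 isT) (nt 3 isT) (nt 4 isT) (nt 5 isT).
Qed.

Lemma mathews_mu_comp_psi v :
  mu_comp_psi rho mu v = 3 *: wedgeZ (cov_Q rho mu) mu v.
Proof.
(* [36 = 3! 3!], [48 = 4! 2!], and [144] is a common multiple *)
have n36 : 36 != 0 :> k := two3_neq0 2 2.
have n48 : 48 != 0 :> k := two3_neq0 4 1.
have n144 : 144 != 0 :> k := two3_neq0 4 2.
pose X := alt_sum (fun w : 6.-tuple O =>
     Phi w`_0 w`_1 w`_2 w`_3 *: m w`_4 w`_5) v.
have EW : 36 *: mu_comp_psi rho mu v = (- 9) *: X.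
  have h1 a x y z : m (a *: x + y) z = a *: m x z + m y z := mlinl z a x y.
  have h2 a x y z : m z (a *: x + y) = a *: m z x + m z y := mlinr z a x y.
  have := @wedge_alt_sum _ _ _ _ _ 3 3 m h1 h2 _ _ is_alt_psi is_alt_psi v.
  move=> ->; rewrite -alt_sum_mu_psi_psi; apply: eq_alt_sum => w.
  by rewrite !psiE !nth_ltuple // !nth_rtuple.
have EQ : 48 *: wedgeZ (cov_Q rho mu) mu v = - 4 *: X.
  have h1 a x y z : (a *: x + y : k^o) *: z = a *: (x *: z) + y *: z :> h.
    by rewrite scalerDl scalerA.
  have h2 a x y (z : k^o) : z *: (a *: x + y) = a *: (z *: x) + z *: y :> h.
    by rewrite scalerDr !scalerA mulrC.
  have := @wedge_alt_sum _ _ _ _ _ 4 2 (fun (a : k^o) x => a *: x) h1 h2 _ _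
            is_alt_Q hmu.1 v.
  move=> ->; rewrite /X -alt_sumZ; apply: eq_alt_sum => w.
  by rewrite QE mu_nth !nth_ltuple // !nth_rtuple scalerA.
apply: (scalerI n144); transitivity ((- 36) *: X).
  rewrite (_ : 144 = 4 * 36 :> k); last by ring.
  by rewrite -scalerA EW scalerA; congr (_ *: _); ring.
rewrite scalerA (_ : 144 * 3 = 9 * 48 :> k); last by ring.
by rewrite -scalerA EQ scalerA; congr (_ *: _); ring.
Qed.

End Mathews.

(** * Hodge duals computed in a basis *)

Lemma sum_tupleS (V : nmodType) (I : finType) (p : nat) (F : p.+1.-tuple I -> V) :
  \sum_J F J = \sum_j \sum_(J : p.-tuple I) F [tuple of j :: J].
Proof.
rewrite pair_big /= (reindex (fun jJ : I * p.-tuple I => [tuple of jJ.1 :: jJ.2])) //=.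
exists (fun J : p.+1.-tuple I => (thead J, [tuple of behead J])) => [[j J]|J] _ /=.
  by congr pair; apply: val_inj.
by case/tupleP: J => j J; apply: val_inj.
Qed.

Lemma sum_tuple0 (V : nmodType) (I : finType) (F : 0.-tuple I -> V) :
  \sum_J F J = F [tuple].
Proof. by rewrite (big_pred1 [tuple]) // => J; apply/esym/eqP/val_inj; case: J => -[]. Qed.

Section TopForm.
Variables (k : fieldType) (E : vectType k) (F : lmodType k) (n : nat).
Variable e : n.+1.-tuple E.
Hypothesis be : basis_of {: E} e.

Lemma alt_top_eq0 (f : n.+1.-tuple E -> F) : is_alt f -> f e = 0 ->
  forall v, f v = 0.
Proof.
move=> altf fe0; apply: (alt_basis_eq0 be altf) => J.
have [uJ|nJ] := boolP (uniq J); last first.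
  apply: alt_uniq => //; rewrite map_inj_uniq //.
  exact/tuple_uniqP/free_uniq/(basis_free be).
have inJ : injective (tnth J).
  by move=> i j; apply/tuple_uniqP.
have -> : [tuple of map (tnth e) J] = reorder e (perm inJ).
  by apply: eq_from_tnth => i; rewrite tnth_map tnth_reorder permE.
by rewrite alt_perm // fe0 scaler0.
Qed.

End TopForm.

Section Hodge.
Variables (k : fieldType) (E : vectType k) (F : lmodType k) (p r : nat).
Local Notation n := (p.+1 + r)%N.
Variable e : n.-tuple E.
Hypothesis be : basis_of {: E} e.
Hypotheses (two0 : 2 != 0 :> k) (fact0 : (p.+1`! * r`!)%:R != 0 :> k).
Variable b : F -> F -> k^o.
Hypothesis bL : forall a x y z, b (a *: x + y) z = a *: b x z + b y z.
Hypothesis bR : forall a x y z, b z (a *: x + y) = a *: b z x + b z y.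

Local Notation lt v := (@ltuple p.+1 r _ v).
Local Notation rt v := (@rtuple p.+1 r _ v).

(** Both sides are alternating of top degree, so they are compared on [e], after
    multiplication by [(p + 1)! r!].  The left side becomes a sum over all the
    permutations, where the hypothesis turns [g] into [f]; the resulting terms
    depend only on the images of the first [p + 1] positions, and not on their
    order.  Degrees written as successors make the length of [e] visibly positive. *)
Lemma hodge_formula (c : 'I_n -> k) (f : p.+1.-tuple E -> F) (g : r.-tuple E -> F)
    (omega : n.-tuple E -> k^o) :
  is_alt f -> is_alt g -> is_alt omega ->
  (forall s : 'S_n, (-1) ^+ s *: g (rt (reorder e s)) =
     ((\prod_(i < p.+1) c (s (lshift r i)))^-1 * omega e) *: f (lt (reorder e s))) ->
  forall alpha, is_alt alpha -> forall v : n.-tuple E,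
  wedge (H := k^o) b alpha g v =
  (\sum_(J : p.+1.-tuple 'I_n | sorted (@lto n) J)
     (\prod_(j <- J) c j)^-1 *
     b (alpha [tuple of map (tnth e) J]) (f [tuple of map (tnth e) J])) * omega v.
Proof.
move=> altf altg alto hfg alpha alta v.
pose H (J : p.+1.-tuple 'I_n) := (\prod_(j <- J) c j)^-1 *
     b (alpha [tuple of map (tnth e) J]) (f [tuple of map (tnth e) J]).
set S := (X in X * _); apply/eqP; rewrite -subr_eq0; apply/eqP.
have altW := wedge_is_alt bL bR alta altg two0 fact0.
have altD := is_alt_sub altW (is_alt_scale S alto).
apply: (alt_top_eq0 be altD).
apply: (mulfI fact0); rewrite mulr0.
have := wedge_alt_sum bL bR alta altg e; rewrite mulrBr.
rewrite -[_ *: wedge _ _ _ _]/(_ * wedge (H := k^o) b alpha g e) => ->.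
have EL (s : 'S_n) : lt (reorder e s) =
    [tuple of map (tnth e) [tuple s (lshift r i) | i < p.+1]].
  by apply: eq_from_tnth => i; rewrite [RHS]tnth_map !tnth_mktuple.
have -> : alt_sum (fun w => b (alpha (lt w)) (g (rt w))) e =
    (\sum_(s : 'S_n) H [tuple s (lshift r i) | i < p.+1]) * omega e.
  rewrite mulr_suml; apply: eq_bigr => s _.
  rewrite -(PhiZr bR) hfg (PhiZr bR) EL /H big_map /=.
  rewrite -[_ *: (_ : k^o)]/(_ * _) [RHS]mulrAC; congr (_^-1 * _ * _).
  by rewrite big_enum.
rewrite sum_perm_image; last exact: lshift_inj.
rewrite sum_uniq_sorted => [|J s]; last first.
  rewrite /H (perm_big J) /=; last first.
    by apply/tuple_permP; exists s.
  have -> : [tuple of map (tnth e) (reorder J s)] =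
            reorder [tuple of map (tnth e) J] s.
    by apply: eq_from_tnth => i; rewrite !(tnth_map, tnth_reorder).
  rewrite !alt_perm // (PhiZl bL) (PhiZr bR) scalerA -expr2 sqrr_sign scale1r.
  by [].
rewrite -mulrnA addKn -[_ *+ _]mulr_natl -mulrA -mulrBr.
by rewrite subrr mulr0.
Qed.

(** Such a shuffle preserves both blocks and is increasing on each of them. *)
Lemma shuffle_left_id (t : 'S_n) : shuffle t ->
  (forall i : 'I_p.+1, exists j : 'I_p.+1, t (lshift r i) = lshift r j) -> t = 1%g.
Proof.
rewrite shuffle_sorted => /andP[sl sr] tl.
have trlto : transitive (@lto n) by move=> y x z; apply: ltn_trans.
have irlto : irreflexive (@lto n) by move=> x; apply: ltnn.
have e1 : reorder (ord_tuple n) 1%g = ord_tuple n by rewrite reorder1.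
have sh1 : shuffle (1%g : 'S_n).
  by apply/andP; split; apply/forallP => i; apply/forallP => j; apply/implyP;
    rewrite !perm1 //= ltn_add2l.
move: sh1; rewrite shuffle_sorted e1 => /andP[sl1 sr1].
have tlE i : exists j, lshift r i = t (lshift r j).
  have inj_t : injective (fun j => sval (sig_eqW (tl j))).
    move=> j j'; case: sig_eqW => a Ea; case: sig_eqW => a' Ea' /= Eaa.
    by move: Ea; rewrite Eaa -Ea' => /perm_inj/lshift_inj.
  have /codomP[j Ej] : i \in codom (fun j => sval (sig_eqW (tl j))).
    exact: injF_onto.
  exists j; rewrite Ej; case: sig_eqW => a Ea /=; by rewrite Ea.
have trE i : exists j, t (rshift p.+1 i) = rshift p.+1 j.
  case: (split_ordP (t (rshift p.+1 i))) => j Ej; last by exists j.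
  have [j' Ej'] := tlE j; move: Ej; rewrite Ej' => /perm_inj/eqP.
  by rewrite eq_rlshift.
have EL : lt (reorder (ord_tuple n) t) = lt (ord_tuple n).
  apply: val_inj; apply: (irr_sorted_eq trlto irlto sl sl1) => x.
  apply/tnthP/tnthP => [[i ->]|[i ->]].
    by have [j Ej] := tl i; exists j; rewrite !tnth_mktuple Ej.
  by have [j Ej] := tlE i; exists j; rewrite !tnth_mktuple -Ej.
have ER : rt (reorder (ord_tuple n) t) = rt (ord_tuple n).
  apply: val_inj; apply: (irr_sorted_eq trlto irlto sr sr1) => x.
  apply/tnthP/tnthP => [[i ->]|[i ->]].
    by have [j Ej] := trE i; exists j; rewrite !tnth_mktuple Ej.
  have trE' : exists j, rshift p.+1 i = t (rshift p.+1 j).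
    case: (split_ordP (t^-1%g (rshift p.+1 i))) => j Ej.
      have [j' Ej'] := tl j; move: Ej' ; rewrite -Ej permKV => /eqP.
      by rewrite eq_rlshift.
    by exists j; rewrite -Ej permKV.
  by have [j Ej] := trE'; exists j; rewrite !tnth_mktuple -Ej.
apply: blockP => i; rewrite perm1.
  by have := congr1 (fun u => tnth u i) EL; rewrite !tnth_mktuple !tnth_ord_tuple.
by have := congr1 (fun u => tnth u i) ER; rewrite !tnth_mktuple !tnth_ord_tuple.
Qed.

(** A value of [g] on basis vectors is isolated by the form [alpha] which is the
    determinant of the coordinates along the complementary basis vectors, times
    an arbitrary [x]: in the exterior product of [alpha] and [g] on the basis,
    every shuffle but the identity gives the determinant a zero row. *)
Lemma hodge_unique (g g' : r.-tuple E -> F) :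
  (forall y, (forall x, b x y = 0) -> y = 0) ->
  is_alt g -> is_alt g' ->
  (forall alpha, is_alt alpha -> forall v : n.-tuple E,
     wedge (H := k^o) b alpha g v = wedge (H := k^o) b alpha g' v) ->
  g' =1 g.
Proof.
move=> bnd altg altg' hw v; apply/eqP; rewrite -subr_eq0; apply/eqP.
have altD := is_alt_sub altg' altg; move: v.
apply: (alt_basis_eq0 (n := p + r) be altD) => J.
have [uJ|nJ] := boolP (uniq J); last first.
  apply: (alt_uniq altD); rewrite map_inj_uniq //.
  exact/tuple_uniqP/free_uniq/(basis_free be).
have [|s Es] := @perm_extend n r (@rshift p.+1 r) (tnth J) (@rshift_inj _ _).
  by apply/tuple_uniqP.
have -> : [tuple of map (tnth e) J] = rt (reorder e s).
  by apply: eq_from_tnth => i; rewrite tnth_map !tnth_mktuple Es.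
apply: bnd => x.
pose M (w : p.+1.-tuple E) : 'M[k]_p.+1 :=
  \matrix_(a, c) coord e (s (lshift r c)) (tnth w a).
pose alpha w := \det (M w) *: x.
have alta : is_alt alpha.
  split=> [w i a y z|w i j nij Eij]; rewrite /alpha.
    rewrite scalerA -scalerDl; congr (_ *: _).
    rewrite -[\det (M (tset w i z))]mul1r; apply: (determinant_multilinear (i0 := i)).
    - by apply/rowP => c; rewrite !mxE !tnth_tset eqxx linearP mul1r.
    - apply/matrixP => j c; rewrite !mxE !tnth_tset.
      by rewrite eq_sym (negbTE (neq_lift _ _)).
    - apply/matrixP => j c; rewrite !mxE !tnth_tset.
      by rewrite eq_sym (negbTE (neq_lift _ _)).
  rewrite (determinant_alternate nij) ?scale0r // => c.
  by rewrite !mxE Eij.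
have := hw _ alta (reorder e s); rewrite !wedgeE // => /eqP.
rewrite -subr_eq0 -sumrB (bigD1 1%g) /=; last first.
  by apply/andP; split; apply/forallP => i; apply/forallP => j; apply/implyP;
    rewrite !perm1 //= ltn_add2l.
rewrite big1 => [|t /andP[sht nt1]].
  rewrite addr0 odd_perm1 !scale1r reorder1.
  have -> : alpha (lt (reorder e s)) = x.
    rewrite /alpha (_ : M _ = 1%:M) ?det1 ?scale1r //.
    apply/matrixP => a c; rewrite !mxE !tnth_mktuple (tnth_nth 0).
    rewrite coord_free ?(basis_free be) //.
    by rewrite (inj_eq perm_inj) (inj_eq (@lshift_inj _ _)) eq_sym.
  rewrite subr_eq0 => /eqP Eb.
  by rewrite -[- g _]scaleN1r addrC bR Eb scaleN1r addNr.
have [i Hi] : exists i : 'I_p.+1, forall j : 'I_p.+1, t (lshift r i) != lshift r j.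
  have [/forallP h|] := boolP [forall i, [exists j, t (lshift r i) == lshift r j]].
    case/negP: nt1; apply/eqP/shuffle_left_id => // i.
    by have /existsP[j /eqP] := h i; exists j.
  rewrite negb_forall => /existsP[i]; rewrite negb_exists => /forallP h.
  by exists i.
have -> : alpha (lt (reorder (reorder e s) t)) = 0.
  rewrite /alpha (expand_det_row _ i) big1 ?scale0r // => c _.
  rewrite !mxE !tnth_mktuple (tnth_nth 0) coord_free ?(basis_free be) //.
  by rewrite (inj_eq perm_inj) (negbTE (Hi c)) mul0r.
have b0 z : b 0 z = 0 by rewrite -(scale0r 0) (PhiZl bL) scale0r.
by rewrite !b0 scaler0 subrr.
Qed.

End Hodge.

(** * Self-duality of the 4-form and its exterior products *)

Section Rotation.
Variables (k : fieldType) (E F : lmodType k) (n : nat).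

(** Shifts bring the arguments of an exterior product in the order needed below;
    only squares of shifts are used, because they are even whatever [n] is. *)
Definition rotation : 'S_n := perm (@ordS_inj n).

Lemma alt_sum_square (T : n.-tuple E -> F) (s : 'S_n) v :
  alt_sum (fun w => T (reorder w (s * s)%g)) v = alt_sum T v.
Proof. by rewrite alt_sum_reorder odd_permM addbb scale1r. Qed.

End Rotation.

Section Selfdual.
Variables (k : fieldType) (O : octonionAlgebra k).
Hypothesis two0 : 2 != 0 :> k.
Hypothesis three0 : 3 != 0 :> k.
Local Notation B := (@octB k O).
Local Notation q := (@oct_norm k O).

Lemma orthogonal_basis_reorder (e : 8.-tuple O) (s : 'S_8) :
  orthogonal_basis e -> orthogonal_basis (reorder e s).
Proof.
case=> be oe; split=> [|i j nij]; last first.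
  by rewrite !tnth_reorder oe // (inj_eq perm_inj).
rewrite -(perm_basis (X := e)) //.
by rewrite perm_sym; apply/tuple_permP; exists s.
Qed.

Section Basis.
Variables (e : 8.-tuple O).
Hypothesis he : orthogonal_basis e.

Lemma chirality_neq0 : chirality e != 0.
Proof.
have : chirality e ^+ 2 != 0; last by rewrite expf_eq0.
rewrite chirality_sq // prodf_seq_neq0; apply/allP => x /tnthP[i ->].
exact: q_basis.
Qed.

Lemma Phi_self_dual :
  q e`_4 * q e`_5 * q e`_6 * q e`_7 * Phi e`_0 e`_1 e`_2 e`_3 =
  chirality e * Phi e`_4 e`_5 e`_6 e`_7.
Proof.
have := cliff_coef_self_dual two0 he.
set L := ltuple _; set R := rtuple _.
have EL : tval L = [:: e`_0; e`_1; e`_2; e`_3].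
  apply: (@eq_from_nth _ 0) => [|i]; first by rewrite size_tuple.
  rewrite size_tuple => li; rewrite nth_ltuple //.
  by case: i li => [|[|[|[|]]]].
have ER : tval R = [:: e`_4; e`_5; e`_6; e`_7].
  apply: (@eq_from_nth _ 0) => [|i]; first by rewrite size_tuple.
  rewrite size_tuple => li; rewrite nth_rtuple //.
  by case: i li => [|[|[|[|]]]].
have := orthogonal_tupleP he.2.
have -> : tval e = L ++ R by apply: (@cat_lrtuple 4 4).
rewrite /orthogonal_seq pairwise_cat => /and3P[_ oL oR].
rewrite EL ER in oL oR *.
rewrite -!Phi_orth // !big_cons big_nil mulr1 => <-; ring.
Qed.

Lemma prod_q8 : \prod_(x <- e) q x = q e`_0 * q e`_1 * q e`_2 * q e`_3 *
  (q e`_4 * q e`_5 * q e`_6 * q e`_7).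
Proof.
have {1}-> : tval e = [:: e`_0; e`_1; e`_2; e`_3; e`_4; e`_5; e`_6; e`_7].
  apply: (@eq_from_nth _ 0) => [|i]; first by rewrite size_tuple.
  by rewrite size_tuple => li; case: i li => [|[|[|[|[|[|[|[|]]]]]]]].
by rewrite !big_cons big_nil; ring.
Qed.

(** The same relation with the halves exchanged, since the square of the chirality
    is the product of all the norms. *)
Lemma Phi_self_dual' :
  q e`_0 * q e`_1 * q e`_2 * q e`_3 * Phi e`_4 e`_5 e`_6 e`_7 =
  chirality e * Phi e`_0 e`_1 e`_2 e`_3.
Proof.
apply: (mulfI chirality_neq0); rewrite [RHS]mulrA -expr2 chirality_sq // prod_q8.
by rewrite mulrCA -Phi_self_dual; ring.
Qed.

Lemma q_psi3 i j l : uniq [:: i; j; l] ->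
  q (psi3 (tnth e i) (tnth e j) (tnth e l)) = q (tnth e i) * q (tnth e j) * q (tnth e l).
Proof.
rewrite /= !inE negb_or andbT => /andP[/andP[nij nil_] njl].
rewrite psi3_orth ?orthE // !oct_normM; congr (_ * _ * _); exact: q_cj.
Qed.

(** For three fixed vectors the sum over the fourth is, by Parseval, the
    normalised norm of [psi]: it is 1 if the vectors are distinct and 0
    otherwise, and there are [8 * 7 * 6] triples of distinct vectors. *)
Lemma sum_Phi_sq (F := fun J : 4.-tuple 'I_8 =>
    let w := [tuple of map (tnth e) J] in
    Phi w`_0 w`_1 w`_2 w`_3 ^+ 2 / \prod_(j <- J) q (tnth e j)) :
  \sum_J F J = 336.
Proof.
rewrite sum_tupleS exchange_big /=.
transitivity (\sum_(J : 3.-tuple 'I_8 | uniq J) (1 : k)); last first.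
  rewrite sumr_const; have := card_uniq_tuples 3 (predT : pred 'I_8).
  rewrite card_ord => E; rewrite (_ : #|_| = 8 ^_ 3)%N //.
  by rewrite -E; apply: eq_card => t; rewrite !inE all_predT.
rewrite [RHS]big_mkcond; apply: eq_bigr => J _ /=.
case/tupleP: J => a J; case/tupleP: J => a' J; case/tupleP: J => a'' J.
rewrite {J}[J]tuple0; pose p := psi3 (tnth e a) (tnth e a') (tnth e a'').
have EF j : F [tuple of j :: [tuple of a :: [tuple of a' :: [tuple of a'' :: [tuple]]]]] =
    B p (tnth e j) * B p (tnth e j) / q (tnth e j) *
    (q (tnth e a) * q (tnth e a') * q (tnth e a''))^-1.
  rewrite /F /= !big_cons big_nil.
  have -> : Phi (tnth e j) (tnth e a) (tnth e a') (tnth e a'') = - B p (tnth e j).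
    by rewrite Phi_swap12 // Phi_swap23 // Phi_swap34 // opprK.
  by field; rewrite !q_basis.
rewrite (eq_bigr _ (fun j _ => EF j)) -mulr_suml parseval // Bxx //.
have [u|nu] := boolP (uniq [:: a; a'; a'']).
  by rewrite q_psi3 // mulfV // !mulf_neq0 ?q_basis.
suff -> : p = 0 by rewrite -Bxx // B0l mul0r.
move: nu; rewrite /p /= !inE !negb_and !negbK orbF -orbA => /or3P[]/eqP->.
- by rewrite psi3_diag.
- by rewrite psi3_diag13.
- by rewrite psi3_diag23.
Qed.

End Basis.
End Selfdual.

Section HodgeDuals.
Variables (k : fieldType) (O : octonionAlgebra k).
Hypothesis two0 : 2 != 0 :> k.
Hypothesis three0 : 3 != 0 :> k.
Variables (C : falgType k) (iota : {linear oct_ImT O -> C}).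
Variables (rho : {linear C -> 'End(O)}).
Hypothesis hrho : extends_left_mul iota rho.
Variable mu : 2.-tuple O -> lie_h iota.
Hypothesis hmu : is_moment_map rho mu.
Variables (e : 8.-tuple O).
Hypothesis he : orthogonal_basis e.

Local Notation B := (@octB k O).
Local Notation q := (@oct_norm k O).
Local Notation h := (lie_h iota).
Local Notation act := (@hact k O C iota rho).
Local Notation m := (mu2 mu).
Local Notation Q := (cov_Q rho mu).
Local Notation psi := (cov_psi rho mu).
Local Notation lt p r v := (@ltuple p r _ v).
Local Notation rt p r v := (@rtuple p r _ v).

Let psiE := cov_psiE two0 hrho he three0 hmu.
Let QE := cov_QE two0 hrho he three0 hmu.
Let altQ := is_alt_Q two0 three0 hrho he hmu.
Let altpsi := is_alt_psi two0 three0 hrho he hmu.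

Lemma scaled_square (sg c x y q0 q1 q2 q3 : k) :
  q0 != 0 -> q1 != 0 -> q2 != 0 -> q3 != 0 -> sg * sg = 1 ->
  q0 * q1 * q2 * q3 * y = sg * c * x ->
  sg * (- 4 * x * (- 4 * y)) = 16 * c * (x ^+ 2 / (q0 * (q1 * (q2 * (q3 * 1))))).
Proof.
move=> n0 n1 n2 n3 sq D.
have nq : q0 * q1 * q2 * q3 != 0 by rewrite !mulf_neq0.
have -> : y = sg * c * x / (q0 * q1 * q2 * q3) by rewrite -D [RHS]mulrC mulKf.
have -> : 16 * c * (x ^+ 2 / (q0 * (q1 * (q2 * (q3 * 1))))) =
  16 * (sg * sg) * c * (x ^+ 2 / (q0 * (q1 * (q2 * (q3 * 1))))) by rewrite sq [16 * 1]mulr1.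
by field; rewrite n0 n1 n2 n3.
Qed.

Lemma scaled_dual (sg c x y q0 q1 q2 q3 : k) :
  q0 != 0 -> q1 != 0 -> q2 != 0 -> q3 != 0 -> sg * sg = 1 ->
  q0 * q1 * q2 * q3 * y = sg * c * x ->
  sg * y = c / (q0 * q1 * q2 * q3) * x.
Proof.
move=> n0 n1 n2 n3 sq D; have nq : q0 * q1 * q2 * q3 != 0 by rewrite !mulf_neq0.
have -> : y = sg * c * x / (q0 * q1 * q2 * q3) by rewrite -D [RHS]mulrC mulKf.
by rewrite -[X in _ = X]mul1r -sq; field; rewrite n0 n1 n2 n3.
Qed.

(** After multiplication by [4! 4!], self-duality makes each term of the sum over
    permutations a normalised square of [Phi], up to the chirality of the
    reordered basis, whose sign cancels that of the permutation; each 4-tuple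
    occurs [4!] times. *)
Lemma wedge_Q_Q : wedgeZ Q Q e = 224 * chirality e.
Proof.
(* [576 = 4! 4!] *)
have n576 : 576 != 0 :> k := two3_neq0 two0 three0 6 2.
have h1 a x y z : (a *: x + y : k^o) *: z = a *: (x *: z) + y *: z :> k^o.
  by rewrite scalerDl scalerA.
have h2 a x y (z : k^o) : z *: (a *: x + y) = a *: (z *: x) + z *: y :> k^o.
  by rewrite scalerDr !scalerA mulrC.
have := @wedge_alt_sum _ _ _ _ _ 4 4 (fun (a : k^o) (x : k^o) => a *: x) h1 h2
  _ _ altQ altQ e.
rewrite -[_ *: wedge _ _ _ _]/(_ * wedgeZ Q Q e) => E.
apply: (mulfI n576); rewrite {}E.
pose F (J : 4.-tuple 'I_8) := let w := [tuple of map (tnth e) J] in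
    Phi w`_0 w`_1 w`_2 w`_3 ^+ 2 / \prod_(j <- J) q (tnth e j).
transitivity (16 * chirality e * \sum_(s : 'S_8) F [tuple s (lshift 4 i) | i < 4]).
  rewrite mulr_sumr; apply: eq_bigr => s _.
  rewrite !QE !nth_ltuple // !nth_rtuple; set w := reorder e s.
  have hw : orthogonal_basis w := orthogonal_basis_reorder s he.
  have EJ : map (tnth e) [tuple s (lshift 4 i) | i < 4] = lt 4 4 w.
    by rewrite -map_comp; apply: eq_map => i; rewrite /= tnth_reorder.
  rewrite /F /= -(big_map (tnth e) xpredT) EJ !nth_ltuple //.
  have -> : tval (lt 4 4 w) = [:: w`_0; w`_1; w`_2; w`_3].
    apply: (@eq_from_nth _ 0) => [|i]; first by rewrite size_tuple.
    rewrite size_tuple => li; rewrite nth_ltuple //.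
    by case: i li => [|[|[|[|]]]].
  have := Phi_self_dual' two0 hw; rewrite chirality_reorder // !big_cons big_nil.
  have qn i : (i < 8)%N -> q w`_i != 0.
    by move=> li; rewrite -(tnth_nth 0 w (Ordinal li)) q_basis.
  have := qn 0%N isT; have := qn 1%N isT; have := qn 2%N isT; have := qn 3%N isT.
  move=> n3 n2 n1 n0 D; apply: scaled_square D => //.
  by rewrite -expr2 sqrr_sign.
rewrite (@sum_perm_image _ 8 4 (lshift 4)); last exact: lshift_inj.
have -> : \sum_(J : 4.-tuple 'I_8 | uniq J) F J = 336.
  rewrite -(sum_Phi_sq two0 he) [RHS](bigID (fun J : 4.-tuple 'I_8 => uniq J)) /=.
  rewrite [X in _ + X]big1 ?addr0 // => J nu.
  pose w : 4.-tuple O := [tuple of map (tnth e) J].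
  have nw : ~~ uniq w by apply: contraNN nu => /map_uniq.
  have four0 : - 4 != 0 :> k by rewrite oppr_eq0 (two3_neq0 two0 three0 2 0).
  have /eqP := alt_uniq altQ nw; rewrite QE mulf_eq0 (negbTE four0) /= => /eqP E.
  by rewrite E expr0n mul0r.
rewrite (_ : (8 - 4)`! = 24)%N // -[336 *+ 24]mulr_natl; ring.
Qed.

(** By self-duality [Phi] on four of the five vectors becomes [Phi e_0 e_1 e_2] on
    the fifth one, which is a coordinate of [psi(e_0, e_1, e_2)]; the coordinates
    along [e_0, e_1, e_2] vanish, so the five vectors suffice. *)
Lemma wedge_Q_id :
  wedgeZ Q (@alt_id O) (rt 3 5 e) =
  (- 4 * chirality e / (q e`_0 * q e`_1 * q e`_2)) *: psi (lt 3 5 e).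
Proof.
have n24 : 24 != 0 :> k := two3_neq0 two0 three0 3 1.
have h1 a x y z : (a *: x + y : k^o) *: z = a *: (x *: z) + y *: z :> O.
  by rewrite scalerDl scalerA.
have h2 a x y (z : k^o) : z *: (a *: x + y) = a *: (z *: x) + z *: y :> O.
  by rewrite scalerDr !scalerA mulrC.
have := @wedge_alt_sum _ _ _ _ _ 4 1 (fun (a : k^o) x => a *: x) h1 h2
  _ _ altQ (@is_alt_id k O) (rt 3 5 e).
rewrite -/(wedgeZ Q _ _) => E; apply: (scalerI n24); rewrite {}E.
set v := rt 3 5 e.
pose c := chirality e / (q e`_0 * q e`_1 * q e`_2).
pose G x := (Phi e`_0 e`_1 e`_2 x / q x) *: x.
transitivity (- 4 *: alt_sum (fun w : 5.-tuple O =>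
    Phi w`_1 w`_2 w`_3 w`_4 *: w`_0) v).
  rewrite -alt_sumZ; pose s := (rotation 5 * rotation 5)%g.
  rewrite -[RHS](alt_sum_square _ s); apply: eq_alt_sum => w.
  rewrite QE /alt_id /thead (tnth_nth 0) !nth_ltuple // !nth_rtuple scalerA.
  have nt i j (hi : (i < 5)%N) (hj : (j < 5)%N) : j = ((i + 4) %% 5)%N ->
      (reorder w (s * s)%g)`_i = w`_j.
    move=> Ej; rewrite -(tnth_nth 0 _ (Ordinal hi)) tnth_reorder.
    rewrite (tnth_nth 0) !permM !permE; congr (_`_ _).
    by rewrite Ej /=; case: i hi {Ej} => [|[|[|[|[|]]]]].
  by rewrite (nt 0%N 4%N) // (nt 1%N 0%N) // (nt 2%N 1%N) // (nt 3%N 2%N) // (nt 4%N 3%N).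
have qn i (l : (i < 8)%N) : q e`_i != 0.
  by rewrite -(tnth_nth 0 e (Ordinal l)) q_basis.
have -> : alt_sum (fun w : 5.-tuple O => Phi w`_1 w`_2 w`_3 w`_4 *: w`_0) v =
    c *: \sum_(s : 'S_5) G (tnth v (s ord0)).
  rewrite scaler_sumr; apply: eq_bigr => s _; rewrite !scalerA.
  pose w : 8.-tuple O := reorder e (@block 3 5 1 s).
  have hw : orthogonal_basis w := orthogonal_basis_reorder _ he.
  have wl i : (i < 3)%N -> w`_i = e`_i.
    move=> li; rewrite -(@nth_ltuple 3 5) // /w ltuple_block reorder1.
    by rewrite nth_ltuple.
  have wr (i : nat) : w`_(3 + i) = (reorder v s)`_i.
    by rewrite -(@nth_rtuple 3 5) /w rtuple_block.
  have := Phi_self_dual' two0 hw; rewrite chirality_reorder // (@odd_block 3 5) odd_perm1 addFb.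
  rewrite (wl 0%N) // (wl 1%N) // (wl 2%N) // (wr 0%N : w`_3 = _) (wr 1%N : w`_4 = _) (wr 2%N : w`_5 = _).
  rewrite (wr 3%N : w`_6 = _) (wr 4%N : w`_7 = _).
  have -> : tnth v (s ord0) = (reorder v s)`_0 by rewrite -(tnth_reorder v s) (tnth_nth 0).
  have qx : q (reorder v s)`_0 != 0.
    by have := q_basis two0 hw (Ordinal (isT : 3 < 8)%N); rewrite (tnth_nth 0) (wr 0%N).
  move: (reorder v s) qx => x qx D; congr (_ *: _).
  have sq : (-1) ^+ s * (-1) ^+ s = 1 :> k by rewrite -expr2 sqrr_sign.
  rewrite (scaled_dual (qn 0%N isT) (qn 1%N isT) (qn 2%N isT) qx sq D) /c.
  by move: (qn 0%N isT) (qn 1%N isT) (qn 2%N isT) qx => n0 n1 n2 n3; field; rewrite n0 n1 n2 n3.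
pose F0 (J : 1.-tuple 'I_5) := G (tnth v (tnth J ord0)).
have -> : \sum_(s : 'S_5) G (tnth v (s ord0)) =
    \sum_(s : 'S_5) F0 [tuple s (lshift 4 i) | i < 1].
  apply: eq_bigr => s _; congr (G (tnth v _)); rewrite tnth_mktuple; congr (s _).
  exact: val_inj.
rewrite (@sum_perm_image _ 5 1 (lshift 4)); last exact: lshift_inj.
have -> : \sum_(J : 1.-tuple 'I_5 | uniq J) F0 J = psi (lt 3 5 e).
  rewrite (eq_bigl xpredT) => [|J]; last by case/tupleP: J => j J; rewrite [J]tuple0.
  rewrite sum_tupleS psiE !nth_ltuple //.
  rewrite (expand two0 he (psi3 _ _ _)) (@big_split_ord _ _ _ 3 5) /=.
  rewrite [X in _ = X + _]big1 ?add0r => [|i _].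
    apply: eq_bigr => j _; rewrite sum_tuple0 /F0 /G tnth0 /v.
    by rewrite !tnth_mktuple.
  rewrite (tnth_nth 0 e) -/(Phi _ _ _ _).
  case: i => [[|[|[|//]]] li] /=; rewrite ?Phi_diag14 ?Phi_diag24 ?Phi_diag34 ?mul0r ?scale0r //.
rewrite (_ : (5 - 1)`! = 24)%N // -scaler_nat !scalerA; congr (_ *: _).
by rewrite /c; field; rewrite !qn.
Qed.

(** Summing over [j] gives [mu(e_i, psi(u, v, e_i))]; writing [psi] through [mu],
    the main term is the Casimir sum, [3 * (8 / 3) - 6 = 2]. *)
Lemma contract_Phi_mu u v :
  \sum_i \sum_j (Phi u v (tnth e i) (tnth e j) / (q (tnth e i) * q (tnth e j)))
    *: m (tnth e i) (tnth e j) = 2 *: m u v.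
Proof.
have mlinr a : linear_map (m a) := mu_linr two0 hrho he three0 hmu a.
have mC a a' : m a' a = - m a a' := muC hmu a a'.
have act_psi a b c : act (m a b) c = so_act a b c + (1 / 3) *: psi3 a b c :=
  act_mu_psi3 two0 hrho he three0 hmu a b c.
transitivity (3 *: (\sum_i (q (tnth e i))^-1 *: m (tnth e i) (act (m u v) (tnth e i))) -
  3 *: (\sum_i (B u (tnth e i) / q (tnth e i)) *: m (tnth e i) v) +
  3 *: (\sum_i (B v (tnth e i) / q (tnth e i)) *: m (tnth e i) u)).
  rewrite -scalerBr -scalerDr -sumrB -big_split scaler_sumr.
  apply: eq_bigr => i _ /=; set x := tnth e i.
  transitivity ((q x)^-1 *: m x (psi3 u v x)).
    rewrite -(expand_map two0 he (psi3 u v x) (mlinr x)) scaler_sumr.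
    apply: eq_bigr => j _; rewrite scalerA; congr (_ *: _).
    by rewrite /Phi; field; rewrite /x !q_basis.
  have -> : psi3 u v x = 3 *: act (m u v) x - 3 *: (B u x *: v - B v x *: u).
    rewrite act_psi -scalerBr [so_act _ _ _ + _]addrC addrK scalerA.
    by rewrite mulrC divfK // scale1r.
  rewrite (lmapB (mlinr x)) !(lmapZ (mlinr x)) (lmapB (mlinr x)).
  rewrite !(lmapZ (mlinr x)) !scalerBr !scalerDr !scalerN !scalerA.
  rewrite opprB addrA addrAC.
  by congr (_ *: _ - _ *: _ + _ *: _); ring.
have mlinl a : linear_map (fun u => m u a) := mu_linl two0 hrho he three0 hmu a.
rewrite (casimir_mu two0 hrho he three0 hmu) !(expand_map two0 he _ (mlinl _)).
rewrite (mC u v) scalerN -addrA -opprD -scalerDl scalerA -scalerBl.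
by congr (_ *: _); field.
Qed.

(** As in [wedge_Q_id], with [Phi] on four of the six vectors becoming
    [Phi e_0 e_1] on the two others; the sum is then [contract_Phi_mu]. *)
Lemma wedge_Q_mu :
  wedgeZ Q mu (rt 2 6 e) =
  (- 4 * chirality e / (q e`_0 * q e`_1)) *: mu (lt 2 6 e).
Proof.
have n48 : 48 != 0 :> k := two3_neq0 two0 three0 4 1.
have h1 a x y z : (a *: x + y : k^o) *: z = a *: (x *: z) + y *: z :> h.
  by rewrite scalerDl scalerA.
have h2 a x y (z : k^o) : z *: (a *: x + y) = a *: (z *: x) + z *: y :> h.
  by rewrite scalerDr !scalerA mulrC.
have := @wedge_alt_sum _ _ _ _ _ 4 2 (fun (a : k^o) x => a *: x) h1 h2
  _ _ altQ hmu.1 (rt 2 6 e).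
rewrite -/(wedgeZ Q _ _) => E; apply: (scalerI n48); rewrite {}E.
set v := rt 2 6 e.
pose c := chirality e / (q e`_0 * q e`_1).
pose G x y := (Phi e`_0 e`_1 x y / (q x * q y)) *: m x y.
transitivity (- 4 *: alt_sum (fun w : 6.-tuple O =>
    Phi w`_2 w`_3 w`_4 w`_5 *: m w`_0 w`_1) v).
  rewrite -alt_sumZ; pose s := (rotation 6 * rotation 6)%g.
  rewrite -[RHS](alt_sum_square _ s); apply: eq_alt_sum => w.
  rewrite QE mu_nth !nth_ltuple // !nth_rtuple scalerA.
  have nt i j (hi : (i < 6)%N) (hj : (j < 6)%N) : j = ((i + 4) %% 6)%N ->
      (reorder w (s * s)%g)`_i = w`_j.
    move=> Ej; rewrite -(tnth_nth 0 _ (Ordinal hi)) tnth_reorder.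
    rewrite (tnth_nth 0) !permM !permE; congr (_`_ _).
    by rewrite Ej /=; case: i hi {Ej} => [|[|[|[|[|[|]]]]]].
  by rewrite (nt 0%N 4%N) // (nt 1%N 5%N) // (nt 2%N 0%N) // (nt 3%N 1%N) //
    (nt 4%N 2%N) // (nt 5%N 3%N).
have qn i (l : (i < 8)%N) : q e`_i != 0.
  by rewrite -(tnth_nth 0 e (Ordinal l)) q_basis.
have -> : alt_sum (fun w : 6.-tuple O => Phi w`_2 w`_3 w`_4 w`_5 *: m w`_0 w`_1) v =
    c *: \sum_(s : 'S_6) G (tnth v (s (lshift 4 (ord0 : 'I_2))))
                          (tnth v (s (lshift 4 (ord_max : 'I_2)))).
  rewrite scaler_sumr; apply: eq_bigr => s _; rewrite !scalerA.
  pose w : 8.-tuple O := reorder e (@block 2 6 1 s).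
  have hw : orthogonal_basis w := orthogonal_basis_reorder _ he.
  have wl i : (i < 2)%N -> w`_i = e`_i.
    move=> li; rewrite -(@nth_ltuple 2 6) // /w ltuple_block reorder1.
    by rewrite nth_ltuple.
  have wr (i : nat) : w`_(2 + i) = (reorder v s)`_i.
    by rewrite -(@nth_rtuple 2 6) /w rtuple_block.
  have := Phi_self_dual' two0 hw.
  rewrite chirality_reorder // (@odd_block 2 6) odd_perm1 addFb.
  rewrite (wl 0%N) // (wl 1%N) // (wr 0%N : w`_2 = _) (wr 1%N : w`_3 = _).
  rewrite (wr 2%N : w`_4 = _) (wr 3%N : w`_5 = _).
  rewrite (wr 4%N : w`_6 = _) (wr 5%N : w`_7 = _).
  rewrite -!(tnth_reorder v s) !(tnth_nth 0) /G.
  have qx : q (reorder v s)`_0 != 0.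
    by have := q_basis two0 hw (Ordinal (isT : 2 < 8)%N); rewrite (tnth_nth 0) (wr 0%N).
  have qy : q (reorder v s)`_1 != 0.
    by have := q_basis two0 hw (Ordinal (isT : 3 < 8)%N); rewrite (tnth_nth 0) (wr 1%N).
  move: (reorder v s) qx qy => x qx qy D; congr (_ *: _).
  have sq : (-1) ^+ s * (-1) ^+ s = 1 :> k by rewrite -expr2 sqrr_sign.
  rewrite (scaled_dual (qn 0%N isT) (qn 1%N isT) qx qy sq D) /c.
  by move: (qn 0%N isT) (qn 1%N isT) qx qy => n0 n1 n2 n3; field; rewrite n0 n1 n2 n3.
pose F0 (J : 2.-tuple 'I_6) := G (tnth v (tnth J ord0)) (tnth v (tnth J ord_max)).
have -> : \sum_(s : 'S_6) G (tnth v (s (lshift 4 (ord0 : 'I_2))))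
                          (tnth v (s (lshift 4 (ord_max : 'I_2)))) =
    \sum_(s : 'S_6) F0 [tuple s (lshift 4 i) | i < 2].
  by apply: eq_bigr => s _; congr (G (tnth v _) (tnth v _)); rewrite tnth_mktuple.
rewrite (@sum_perm_image _ 6 2 (lshift 4)); last exact: lshift_inj.
have G0l a a' : a = e`_0 \/ a = e`_1 -> G a a' = 0.
  by rewrite /G => -[]->; rewrite ?Phi_diag24 // /Phi ?psi3_diag13 ?psi3_diag23 // B0l mul0r scale0r.
have G0r a a' : a' = e`_0 \/ a' = e`_1 -> G a a' = 0.
  by rewrite /G => -[]->; rewrite ?Phi_diag14 ?Phi_diag24 // mul0r scale0r.
have G0 a : G a a = 0 by rewrite /G Phi_diag34 // mul0r scale0r.
have -> : \sum_(J : 2.-tuple 'I_6 | uniq J) F0 J = 2 *: mu (lt 2 6 e).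
  rewrite big_mkcond /= (eq_bigr F0) => [|J _]; last first.
    case/tupleP: J => j J; case/tupleP: J => j' J; rewrite {J}[J]tuple0.
    rewrite /= !inE andbT; case: eqP => //= ->.
    by rewrite /F0 !(tnth_nth ord0) /= G0.
  rewrite mu_nth !nth_ltuple // -contract_Phi_mu sum_tupleS.
  rewrite (@big_split_ord _ _ _ 2 6) /=.
  have El (i : 'I_2) : tnth e (lshift 6 i) = e`_0 \/ tnth e (lshift 6 i) = e`_1.
    by rewrite (tnth_nth 0); case: i => [[|[|//]] li]; [left|right].
  rewrite [X in _ = X + _]big1 ?add0r => [|i _]; last first.
    by rewrite big1 // => j _; apply: G0l; apply: El.
  apply: eq_bigr => j _; rewrite sum_tupleS (@big_split_ord _ _ _ 2 6) /=.
  rewrite [X in _ = X + _]big1 ?add0r => [|i _]; last by apply: G0r; apply: El.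
  apply: eq_bigr => i _; rewrite sum_tuple0 /F0 !(tnth_nth ord0 [tuple of _]) /=.
  by rewrite /v !tnth_mktuple.
rewrite (_ : (6 - 2)`! = 24)%N // -scaler_nat !scalerA; congr (_ *: _).
by rewrite /c; field; rewrite !qn.
Qed.

End HodgeDuals.

(** * The Hodge duals of psi and mu *)

Section SmallIntegers.
Variable k : fieldType.
Hypothesis hchar : [pchar k] =i pred0 \/ exists2 p, p \in [pchar k] & (7 < p)%N.

(** All the factorials to be inverted are products of integers up to 7. *)
Lemma small_natr_neq0 n : (0 < n <= 7)%N -> n%:R != 0 :> k.
Proof.
case/andP=> n0 n7; case: hchar => [/pcharf0P-> | [p pk p7]]; first by rewrite -lt0n.
by rewrite -(dvdn_pcharf pk) gtnNdvd // (leq_ltn_trans n7).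
Qed.

Lemma small_fact_neq0 n : (n <= 7)%N -> (n`!)%:R != 0 :> k.
Proof.
elim: n => [|n IH] n7; first by rewrite oner_neq0.
rewrite factS natrM; apply: mulf_neq0; last exact: IH (ltnW n7).
exact: small_natr_neq0.
Qed.

Lemma small_facts_neq0 p r : (p <= 7)%N -> (r <= 7)%N -> (p`! * r`!)%:R != 0 :> k.
Proof. by move=> hp hr; rewrite natrM mulf_neq0 ?small_fact_neq0. Qed.

End SmallIntegers.

Section Duals.
Variables (k : fieldType) (O : octonionAlgebra k).
Hypothesis hchar : [pchar k] =i pred0 \/ exists2 p, p \in [pchar k] & (7 < p)%N.
Variables (C : falgType k) (iota : {linear oct_ImT O -> C}).
Variables (rho : {linear C -> 'End(O)}).
Hypothesis hrho : extends_left_mul iota rho.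
Variable mu : 2.-tuple O -> lie_h iota.
Hypothesis hmu : is_moment_map rho mu.
Variables (e : 8.-tuple O).
Hypothesis he : orthogonal_basis e.
Local Notation Q := (cov_Q rho mu).
Local Notation psi := (cov_psi rho mu).

Let two0 : 2 != 0 :> k := small_natr_neq0 (n := 2) hchar isT.
Let three0 : 3 != 0 :> k := small_natr_neq0 (n := 3) hchar isT.
Let altQ := is_alt_Q two0 three0 hrho he hmu.
Let altpsi := is_alt_psi two0 three0 hrho he hmu.

Lemma is_alt_wedgeZ (F : lmodType k) p r (f : p.-tuple O -> k^o) (g : r.-tuple O -> F) :
  (p <= 7)%N -> (r <= 7)%N -> is_alt f -> is_alt g -> is_alt (wedgeZ f g).
Proof.
move=> hp hr altf altg; apply: wedge_is_alt => //.
- by move=> a x y z; rewrite scalerDl scalerA.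
- by move=> a x y z; rewrite scalerDr !scalerA mulrC.
- exact: small_facts_neq0.
Qed.

(** The constants match: [56 * 4 = 224]. *)
Lemma sign_cancel (sg c x : k) : sg * sg = 1 ->
  sg * - 56 * (- 4 * (sg * c) * x) = x * (224 * c).
Proof.
move=> sq; transitivity (sg * sg * (x * (224 * c))); first by ring.
by rewrite sq mul1r.
Qed.

Lemma sign_sq n (s : 'S_n) : (-1) ^+ s * (-1) ^+ s = 1 :> k.
Proof. by rewrite -expr2 sqrr_sign. Qed.

Lemma hodge_psi :
  is_hodge_dual (i := 3) (j := 5) (@octB k O) e (wedgeZ Q Q) psi
    (fun v => - 56 *: wedgeZ Q (@alt_id O) v).
Proof.
have bL (a : k) (x y z : O) : octB (a *: x + y) z = a *: (octB x z : k^o) + octB y z.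
  exact: Bl.
have bR (a : k) (x y z : O) : octB z (a *: x + y) = a *: (octB z x : k^o) + octB z y.
  by rewrite BDr BZr.
have altW : is_alt (wedgeZ Q (@alt_id O)).
  by apply: is_alt_wedgeZ => //; apply: is_alt_id.
have altg := is_alt_scale (- 56) altW.
have altQQ : is_alt (wedgeZ Q Q) by apply: is_alt_wedgeZ.
have f35 : (3`! * 5`!)%:R != 0 :> k by apply: small_facts_neq0.
have hg : hodge_property (i := 3) (j := 5) (@octB k O) e (wedgeZ Q Q) psi
    (fun v => - 56 *: wedgeZ Q (@alt_id O) v).
  split=> // alpha alta v.
  apply: (@hodge_formula k O O 2 5 e he.1 two0 f35 (@octB k O) bL bR
    (fun i => oct_norm (tnth e i)) psi _ _ altpsi altg altQQ _ alpha alta v) => s.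
  rewrite (wedge_Q_Q two0 three0 hrho hmu he).
  pose w : 8.-tuple O := reorder e s.
  have hw : orthogonal_basis w := orthogonal_basis_reorder s he.
  rewrite -[reorder e s]/w (wedge_Q_id two0 three0 hrho hmu hw) !scalerA.
  congr (_ *: _); rewrite /w chirality_reorder // sign_cancel ?sign_sq //.
  rewrite !big_ord_recl big_ord0 mulr1 -!(tnth_reorder e s) !(tnth_nth 0).
  by rewrite -[in LHS]mulrA.
split=> // g' [altg' hg'].
apply: (@hodge_unique k O O 2 5 e he.1 (@octB k O) bL bR).
- by move=> y hy; apply: (B_nondeg two0) => x; rewrite BC.
- exact: altg.
- exact: altg'.
by move=> alpha alta v; rewrite (hg' alpha alta) (hg.2 alpha alta).
Qed.

Lemma hodge_mu :
  is_hodge_dual (i := 2) (j := 6) (hB rho) e (wedgeZ Q Q) mu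
    (fun v => - 56 *: wedgeZ Q mu v).
Proof.
have bL (a : k) (x y z : lie_h iota) : hB rho (a *: x + y) z = a *: (hB rho x z : k^o) + hB rho y z.
  exact: (hB_linl two0 rho he z a x y).
have bR (a : k) (x y z : lie_h iota) : hB rho z (a *: x + y) = a *: (hB rho z x : k^o) + hB rho z y.
  exact: (hB_linr two0 rho he z a x y).
have altg := is_alt_scale (- 56) (is_alt_wedgeZ (isT : 4 <= 7)%N (isT : 2 <= 7)%N altQ hmu.1).
have altQQ : is_alt (wedgeZ Q Q) by apply: is_alt_wedgeZ.
have f26 : (2`! * 6`!)%:R != 0 :> k by apply: small_facts_neq0.
have hg : hodge_property (i := 2) (j := 6) (hB rho) e (wedgeZ Q Q) mu
    (fun v => - 56 *: wedgeZ Q mu v).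
  split=> // alpha alta v.
  apply: (@hodge_formula k O _ 1 6 e he.1 two0 f26 (@hB _ _ _ _ rho) bL bR
    (fun i => oct_norm (tnth e i)) mu _ _ hmu.1 altg altQQ _ alpha alta v) => s.
  rewrite (wedge_Q_Q two0 three0 hrho hmu he).
  pose w : 8.-tuple O := reorder e s.
  have hw : orthogonal_basis w := orthogonal_basis_reorder s he.
  rewrite -[reorder e s]/w (wedge_Q_mu two0 three0 hrho hmu hw) !scalerA.
  congr (_ *: _); rewrite /w chirality_reorder // sign_cancel ?sign_sq //.
  by rewrite !big_ord_recl big_ord0 mulr1 -!(tnth_reorder e s) !(tnth_nth 0).
split=> // g' [altg' hg'].
apply: (@hodge_unique k O _ 1 6 e he.1 (@hB _ _ _ _ rho) bL bR).
- move=> y hy; apply: (hB_nondeg two0 hrho he three0) => x.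
  by rewrite (hBC two0 rho he).
- exact: altg.
- exact: altg'.
by move=> alpha alta v; rewrite (hg' alpha alta) (hg.2 alpha alta).
Qed.

End Duals.

Theorem proposition5p11 (k : fieldType)
  (hchar : [pchar k] =i pred0 \/ exists2 p, p \in [pchar k] & (7 < p)%N)
  (O : octonionAlgebra k)
  (C : falgType k) (iota : {linear oct_ImT O -> C})
  (hC : is_clifford_algebra
          (fun u : oct_ImT O => - oct_norm (vsval u)) iota)
  (rho : {linear C -> 'End(O)}) (hrho : extends_left_mul iota rho)
  (mu : 2.-tuple O -> lie_h iota) (hmu : is_moment_map rho mu)
  (e : 8.-tuple O) (he : orthogonal_basis e) :
  let psi : 3.-tuple O -> O := cov_psi rho mu in
  let Q : 4.-tuple O -> k^o := cov_Q rho mu in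
  let QQ : 8.-tuple O -> k := wedgeZ Q Q in
  (exists star_psi : 5.-tuple O -> O,
     [/\ is_hodge_dual (i := 3) (j := 5) (@octB k O) e QQ psi star_psi,
         forall v, star_psi v = - 56 *: wedgeZ Q (@alt_id O) v
       & forall v, star_psi v = (112 / 3) *: wedge (hact rho) mu psi v]) /\
  (exists star_mu : 6.-tuple O -> lie_h iota,
     [/\ is_hodge_dual (i := 2) (j := 6) (hB rho) e QQ mu star_mu,
         forall v, star_mu v = - 56 *: wedgeZ Q mu v
       & forall v, star_mu v = - (56 / 3) *: mu_comp_psi rho mu v]).
Proof.
move=> psi Q QQ.
have two0 : 2 != 0 :> k := small_natr_neq0 (n := 2) hchar isT.
have three0 : 3 != 0 :> k := small_natr_neq0 (n := 3) hchar isT.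
split; [exists (fun v => - 56 *: wedgeZ Q (@alt_id O) v) |
        exists (fun v => - 56 *: wedgeZ Q mu v)]; split => // [|v].
- exact: hodge_psi.
- rewrite (mathews_mu_psi two0 three0 hrho he hmu hC.1) scalerA.
  by congr (_ *: _); field; rewrite two0 three0.
- exact: hodge_mu.
- rewrite (mathews_mu_comp_psi two0 three0 hrho he hmu hC.1) scalerA.
  by congr (_ *: _); field.
Qed.
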